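(* Let $n,p$ be positive integers with $n-p-1>0$ and $0\le\gamma_i\le p$ for $i=1,\dots,p$. For $N>0$ observe $Y\in\mathbb R^{n\times p}$ with independent entries $Y_{ai}\sim\mathrm N(M_{ai},N^{-1})$. Let $\hat M_{\mathrm{SVS}}$ and $\hat M_{\mathrm{MSVS2}}$ be the generalized Bayes estimators with respect to $\pi_{\mathrm{SVS}}(M)=\det(M^\top M)^{-(n-p-1)/2}$ and $\pi_{\mathrm{MSVS2}}(M)=\pi_{\mathrm{SVS}}(M)\prod_{i=1}^p\|M_{\cdot i}\|^{-\gamma_i}$. Then for every $M$ with $M^\top M$ nonsingular, $$N^2\left(\mathrm E_M[(\hat M_{\mathrm{MSVS2}}-M)^\top(\hat M_{\mathrm{MSVS2}}-M)]-\mathrm E_M[(\hat M_{\mathrm{SVS}}-M)^\top(\hat M_{\mathrm{SVS}}-M)]\right)\to-2(p-1)D+DM^\top MD$$ as $N\to\infty$, where $D=\mathrm{diag}(\gamma_1\|M_{\cdot1}\|^{-2},\dots,\gamma_p\|M_{\cdot p}\|^{-2})$. Consequently, if $p\ge2$ and $0<\gamma_1=\dots=\gamma_p<2-2/p$, then $\hat M_{\mathrm{MSVS2}}$ asymptotically dominates $\hat M_{\mathrm{SVS}}$ under the matrix quadratic loss, i.e., the limit matrix is negative definite for every such $M$.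
   Context: $M_{\cdot i}$ is the $i$-th column of $M$. The generalized Bayes estimator with respect to a nonnegative function $\pi$ with finite marginal $m_\pi(Y)=\int p(Y\mid M)\pi(M)\,\mathrm dM$ is the posterior mean $\int Mp(Y\mid M)\pi(M)\,\mathrm dM/m_\pi(Y)$. The matrix quadratic loss of $\hat M$ is the $p\times p$ matrix $(\hat M-M)^\top(\hat M-M)$. *)

(* Defs.v *)
From HB Require Import structures.
From mathcomp Require Import all_boot all_order all_algebra.
From mathcomp Require Import all_classical all_reals all_analysis.
Set Implicit Arguments. Unset Strict Implicit. Unset Printing Implicit Defensive.
Import Order.TTheory GRing.Theory Num.Theory.
Import numFieldNormedType.Exports.
Local Open Scope classical_set_scope.
Local Open Scope ring_scope.

Section Defs.
Variables (R : realType) (n p : nat).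
Notation mat := 'M[R]_(n, p).

Definition upd (A : mat) (k : 'I_n * 'I_p) (t : R) : mat :=
  \matrix_(a, i) if (a, i) == k then t else A a i.

Fixpoint iint (s : seq ('I_n * 'I_p)) (F : mat -> R) (A : mat) : R :=
  match s with
  | [::] => F A
  | k :: s' => Rintegral (@lebesgue_measure R) setT (fun t => iint s' F (upd A k t))
  end.

(* integral over R^{n x p} w.r.t. Lebesgue measure dM (iterated over all np entries) *)
Definition mxint (F : mat -> R) : R := iint (enum [set: ('I_n * 'I_p)%type]) F 0.

Definition dens (N : R) (M Y : mat) : R :=
  \prod_(a < n) \prod_(i < p)
     (Num.sqrt (N / (2 * pi)) * expR (- (N * (Y a i - M a i) ^+ 2) / 2)).

Definition gbayes (N : R) (pr : mat -> R) (Y : mat) : mat :=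
  \matrix_(a, i) (mxint (fun M => M a i * dens N M Y * pr M)
                  / mxint (fun M => dens N M Y * pr M)).

Definition risk (N : R) (est : mat -> mat) (M : mat) : 'M[R]_p :=
  \matrix_(i, j) mxint (fun Y => ((est Y - M)^T *m (est Y - M)) i j * dens N M Y).

Definition colnorm (M : mat) (i : 'I_p) : R := Num.sqrt (\sum_(a < n) M a i ^+ 2).

Definition piSVS (M : mat) : R :=
  powR (\det (M^T *m M)) (- ((n - p - 1)%N%:R / 2)).

Definition piMSVS2 (gamma : 'I_p -> R) (M : mat) : R :=
  piSVS M * \prod_(i < p) powR (colnorm M i) (- gamma i).

Definition Dmat (gamma : 'I_p -> R) (M : mat) : 'M[R]_p :=
  diag_mx (\row_i (gamma i / colnorm M i ^+ 2)).

Definition limit_mx (gamma : 'I_p -> R) (M : mat) : 'M[R]_p :=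
  - ((2 * (p - 1)%N%:R) *: Dmat gamma M) + Dmat gamma M *m M^T *m M *m Dmat gamma M.

End Defs.

(* Main.v *)
(* With [s = 1 / sqrt N], [M = th + s x] and [Y = th + s z], the posterior mean is
   [th + s t(z)], where [t(z)] is the mean of [x] under the density proportional to
   [g(x - z) pi(th + s x)], [g] the standard Gaussian density.  If [pi] has value
   [c], gradient [L] and Hessian [H] at [th], Taylor expansion gives
     E[t_k(z) t_l(z)] = delta_kl + s^2 (2 H_kl / c - L_k L_l / c^2) + o(s^2).
   In terms of the log-prior, with gradient [l0] and Hessian [k0] for the SVS prior
   and increments [eta], [etaH] contributed by the column norms, the difference of
   the two risks scaled by [N^2] tends to
     sum_a (2 etaH + l0 eta + eta l0 + eta eta)((a,i),(a,j)),
   and column operations on the determinant give sum_a l0_ai th_aj = -(n-p-1) delta_ij,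
   which turns this sum into the limit matrix.

   The tails need three facts on [pi]: it is integrable against every Gaussian, it is
   twice differentiable at [th], and it is a.e. at least a multiple of
   [exp (- |X|^2)].  For the first, columns are integrated out one at a time: by
   Cramer's rule against a maximal minor of the other columns, the Gram determinant
   of [x | M] dominates (entry of [x] minus a combination of pivot entries)^2 times
   that of [M], and a geometric mean over the non-pivot rows leaves only
   singularities of exponent (n-1)/n < 1 in each entry. *)

Require Import Defs.
From HB Require Import structures.
From mathcomp Require Import all_boot all_order all_algebra.
From mathcomp Require Import all_classical all_reals all_analysis.
From mathcomp Require Import perm finmap measurable_realfun ring lra.
Import Order.TTheory GRing.Theory Num.Theory.
Import numFieldNormedType.Exports.
Local Open Scope classical_set_scope.
Local Open Scope ring_scope.
Set Implicit Arguments. Unset Strict Implicit. Unset Printing Implicit Defensive.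

(** * Lebesgue measure on matrices *)

(** Each risk is [s^2 (n delta_ij + s^2 (...))] with the same leading term for both priors, so the
    error must be [o(s^2)] after integration over all [z], although the posterior mean is a quotient
    whose denominator may be tiny for large [z]. Bounds in [z] are therefore powers of
    [M exp (|z|^2 / 32)]; products of two posterior means cost the eighth power, [exp (|z|^2 / 4)],
    still integrable against the Gaussian.

    The condition [gamma i <= p] keeps the prior integrable: in one column its singularity has total
    order at most [(n - p - 1) + p = n - 1], below the dimension [n]; spread evenly over the entries
    this is the exponent [(n - 1) / n].

    Two conventions matter. [mxint] iterates real integrals with a silent default value, so it is
    first identified with the integral against a measure, for functions with integrable absolute
    value. And [0] to a negative power is [0], so the prior vanishes on rank-deficient matrices:
    majorants are infinite there instead, and minorants hold almost everywhere. *)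

Definition mat_display : measure_display. Proof. exact: default_measure_display. Qed.

Section mat_measurable.
Context {R : realType} {n p : nat}.
Local Notation mat := 'M[R]_(n, p).

Definition mat_cylinder : set (set mat) :=
  [set B | exists k (D : set R), measurable D /\ B = (fun X : mat => X k.1 k.2) @^-1` D].

Let mat_set0 : <<s mat_cylinder >> set0.
Proof. exact: sigma_algebra0. Qed.

Let mat_setC A : <<s mat_cylinder >> A -> <<s mat_cylinder >> (~` A).
Proof. exact: sigma_algebraC. Qed.

Let mat_bigcup (F : _^nat) : (forall i, <<s mat_cylinder >> (F i)) ->
  <<s mat_cylinder >> (\bigcup_i (F i)).
Proof. exact: sigma_algebra_bigcup. Qed.

HB.instance Definition _ := @isMeasurable.Build mat_display mat
  <<s mat_cylinder >> mat_set0 mat_setC mat_bigcup.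

Lemma measurable_coord a i : measurable_fun setT (fun X : mat => X a i).
Proof.
move=> _ D mD; rewrite setTI; apply: sub_sigma_algebra.
by exists (a, i), D.
Qed.

Lemma measurable_fun_mat d (T : measurableType d) (f : T -> mat) :
  (forall a i, measurable_fun setT (fun t => f t a i)) -> measurable_fun setT f.
Proof.
move=> mf; apply: (@measurability _ _ _ _ _ f mat_cylinder) => //.
move=> _ [_ [[a i] [D [mD ->]]] <-]; rewrite setTI.
have := mf a i measurableT _ mD; rewrite setTI; exact.
Qed.

End mat_measurable.

Section iterated.
Context {R : realType} {n p : nat}.
Local Notation mat := 'M[R]_(n, p).
Local Notation idx := ('I_n * 'I_p)%type.
Local Notation leb := (@lebesgue_measure R).
Local Open Scope ereal_scope.

(** Extended-real twin of [iint]: on nonnegative functions, monotone convergence and Tonelli apply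
    at every level of the iteration without integrability conditions. *)
Fixpoint eiint (s : seq idx) (F : mat -> \bar R) (A : mat) : \bar R :=
  match s with
  | [::] => F A
  | k :: s' => \int[leb]_t eiint s' F (upd A k t)
  end.

Lemma measurable_upd d (T : measurableType d) (f : T -> mat) k (g : T -> R) :
  measurable_fun setT f -> measurable_fun setT g ->
  measurable_fun setT (fun t => upd (f t) k (g t)).
Proof.
move=> mf mg; apply: measurable_fun_mat => a i.
under eq_fun do rewrite mxE; case: ((a, i) == k) => //.
exact: (measurableT_comp (measurable_coord a i)).
Qed.

Lemma eiint_ge0 s F : (forall X, 0 <= F X) -> forall A, 0 <= eiint s F A.
Proof.
by move=> F0; elim: s => [|k s IH] A //=; apply: integral_ge0 => t _.
Qed.

(** Joint measurability in the parameter and the base matrix is what makes the induction work: each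
    level applies Tonelli to that pair and the new variable. The parameter is later the observation
    [z]. *)
Lemma measurable_eiint_param d (T : measurableType d) s (F : T * mat -> \bar R) :
  (forall u, 0 <= F u) -> measurable_fun [set: T * mat] F ->
  measurable_fun [set: T * mat] (fun u : T * mat => eiint s (fun X => F (u.1, X)) u.2).
Proof.
move=> F0 mF; elim: s => [|k s IH] /=.
  by apply: (eq_measurable_fun F) => // -[].
pose H (v : (T * mat) * R) := eiint s (fun X => F (v.1.1, X)) (upd v.1.2 k v.2).
have mH : measurable_fun setT H.
  pose G (v : (T * mat) * R) : T * mat := (v.1.1, upd v.1.2 k v.2).
  have mG : measurable_fun setT G.
    apply: measurable_fun_pair; first by apply: measurableT_comp => //.
    apply: measurable_upd => //.
    by apply: measurableT_comp => //.
  exact: (measurableT_comp IH mG).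
have H0 v : 0 <= H v by exact: eiint_ge0.
exact: (@measurable_fun_fubini_tonelli_F _ _ _ _ _ leb H mH H0).
Qed.

Lemma measurable_eiint s (F : mat -> \bar R) :
  (forall X, 0 <= F X) -> measurable_fun setT F -> measurable_fun setT (eiint s F).
Proof.
move=> F0 mF.
have m1 : measurable_fun setT (fun u : R * mat => F u.2).
  exact: measurableT_comp.
have m2 := measurable_eiint_param s (fun u => F0 u.2) m1.
have m3 : measurable_fun setT (fun X : mat => (0 : R, X)%R).
  by apply: measurable_fun_pair.
exact: (measurableT_comp m2 m3).
Qed.

Lemma measurable_eiint_upd s (F : mat -> \bar R) A k :
  (forall X, 0 <= F X) -> measurable_fun setT F ->
  measurable_fun setT (fun t => eiint s F (upd A k t)).
Proof.
move=> F0 mF; apply: (measurableT_comp (measurable_eiint s F0 mF)).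
by apply: measurable_upd.
Qed.

Lemma eq_eiint s F G : F =1 G -> eiint s F =1 eiint s G.
Proof. by move=> FG A; congr (eiint s _ A); apply/funext. Qed.

Lemma eiint_cat s s' F A : eiint (s ++ s') F A = eiint s (eiint s' F) A.
Proof. by elim: s A => [//|k s IH] A /=; apply: eq_integral => t _; rewrite IH. Qed.

Lemma le_eiint s F G : (forall X, 0 <= F X) -> measurable_fun setT F ->
  measurable_fun setT G -> (forall X, F X <= G X) -> forall A, eiint s F A <= eiint s G A.
Proof.
move=> F0 mF mG FG; have G0 X : 0 <= G X by exact: le_trans (FG X).
elim: s => [|k s IH] A //=; apply: ge0_le_integral => //.
- by move=> t _; exact: eiint_ge0.
- exact: measurable_eiint_upd.
- exact: measurable_eiint_upd.
Qed.

Lemma eiintZl s F (c : R) : (0 <= c)%R -> (forall X, 0 <= F X) -> measurable_fun setT F ->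
  forall A, eiint s (fun X => c%:E * F X) A = c%:E * eiint s F A.
Proof.
move=> c0 F0 mF; elim: s => [|k s IH] A //=.
under eq_integral do rewrite IH.
rewrite ge0_integralZl_EFin //.
- by move=> t _; exact: eiint_ge0.
- exact: measurable_eiint_upd.
Qed.

Lemma eiint_nneseries s (F : nat -> mat -> \bar R) : (forall i X, 0 <= F i X) ->
  (forall i, measurable_fun setT (F i)) ->
  forall A, eiint s (fun X => \sum_(i <oo) F i X) A = \sum_(i <oo) eiint s (F i) A.
Proof.
move=> F0 mF; elim: s => [|k s IH] A //=.
under eq_integral do rewrite IH.
rewrite integral_nneseries//.
- by move=> i; exact: measurable_eiint_upd.
- by move=> i t _; exact: eiint_ge0.
Qed.

Lemma eiint_fsum (I : Type) (r : seq I) s (F : I -> mat -> \bar R) :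
  (forall i X, 0 <= F i X) -> (forall i, measurable_fun setT (F i)) ->
  forall A, eiint s (fun X => \sum_(i <- r) F i X) A = \sum_(i <- r) eiint s (F i) A.
Proof.
move=> F0 mF; elim: s => [|k s IH] A //=.
under eq_integral do rewrite IH.
rewrite ge0_integral_sum//.
- by move=> i; exact: measurable_eiint_upd.
- by move=> i t _; exact: eiint_ge0.
Qed.

Lemma eiint_monotone s (g : nat -> mat -> \bar R) (F : mat -> \bar R) :
  (forall i X, 0 <= g i X) -> (forall i, measurable_fun setT (g i)) ->
  (forall X, nondecreasing_seq (g ^~ X)) ->
  (forall X, g ^~ X @ \oo --> F X) ->
  forall A, (fun i => eiint s (g i) A) @ \oo --> eiint s F A.
Proof.
move=> g0 mg ndg gF; have FE : F = (fun X => limn (g ^~ X)).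
  by apply/funext => X; apply/esym/cvg_lim.
have F0 X : 0 <= F X.
  by rewrite FE; apply: lime_ge; [apply/cvg_ex; exists (F X)|apply: nearW].
have mF : measurable_fun setT F.
  by apply: (emeasurable_fun_cvg g).
elim: s => [|k s IH] A //=.
have -> : (fun t => eiint s F (upd A k t)) = (fun t => limn (fun i => eiint s (g i) (upd A k t))).
  by apply/funext => t; apply/esym/cvg_lim.
apply: cvg_monotone_convergence => //.
- by move=> i; exact: measurable_eiint_upd.
- by move=> i t _; exact: eiint_ge0.
- move=> t _ i j ij; apply: le_eiint => // X; exact: ndg.
Qed.

(** Taking the iterated integral itself as the measure ties the integral of a nonnegative function
    to its iterated form by construction; countable additivity exchanges series and integral one
    variable at a time. *)
Definition mat_leb (S : set mat) : \bar R :=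
  eiint (enum [set: idx]) (fun X => (\1_S X)%:E) 0%R.

Let mat_leb0 : mat_leb set0 = 0.
Proof.
rewrite /mat_leb; under eq_eiint do rewrite indic0.
move: (enum _) (0%R : mat); elim=> [//|k s IH] A /=.
by under eq_integral do rewrite IH; rewrite integral0.
Qed.

Let mat_leb_ge0 S : 0 <= mat_leb S.
Proof. by apply: eiint_ge0 => X; rewrite lee_fin. Qed.

Let mat_leb_semi_sigma_additive : semi_sigma_additive mat_leb.
Proof.
move=> F mF tF mUF; rewrite /mat_leb.
have -> : (fun X => (\1_(\bigcup_i F i) X)%:E) = (fun X : mat => \sum_(i <oo) (\1_(F i) X)%:E :> \bar R).
  by apply/funext => X; rewrite indic_bigcup.
rewrite eiint_nneseries//.
  apply: is_cvg_nneseries => i _ _; exact: mat_leb_ge0.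
by move=> i; exact/measurable_EFinP/measurable_indic.
Qed.

HB.instance Definition _ := isMeasure.Build mat_display mat R mat_leb
  mat_leb0 mat_leb_ge0 mat_leb_semi_sigma_additive.

Import HBNNSimple.

Lemma ge0_integral_mat_leb (F : mat -> \bar R) : (forall X, 0 <= F X) ->
  measurable_fun setT F -> \int[mat_leb]_X F X = eiint (enum [set: idx]) F 0%R.
Proof.
move=> F0 mF; set s := enum _.
pose g := nnsfun_approx measurableT mF.
have E i : \int[mat_leb]_X (g i X)%:E = eiint s (fun X => (g i X)%:E) 0%R.
  rewrite integralT_nnsfun sintegralE.
  have -> : (fun X => (g i X)%:E) = (fun X : mat => \sum_(r \in range (g i)) (r%:E * (\1_(g i @^-1` [set r]) X)%:E)).
    by apply/funext => X; rewrite fimfunE -fsumEFin//; apply: eq_fsbigr => r _; rewrite EFinM.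
  have fin : finite_set (range (g i)) by [].
  rewrite fsbig_finite//=.
  (* [eiint_fsum] asks for nonnegativity at every index, also for reals outside the range of [g i];
     the absolute value provides it and changes nothing on the range. *)
  have -> : (fun X => \sum_(r \in range (g i)) (r%:E * (\1_(g i @^-1` [set r]) X)%:E)) =
    (fun X : mat => \sum_(r <- fset_set (range (g i))) (`|r|%:E * (\1_(g i @^-1` [set r]) X)%:E)).
    apply/funext => X; rewrite fsbig_finite//=; apply: eq_big_seq => r.
    by rewrite in_fset_set// => /set_mem[Y _ <-]; rewrite ger0_norm.
  rewrite eiint_fsum//=.
  - apply: eq_big_seq => r; rewrite in_fset_set// => /set_mem[Y _ <-].
    rewrite ger0_norm// eiintZl//.
    exact/measurable_EFinP/measurable_indic.
  - by move=> r; apply/measurable_EFinP/measurable_funM.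
have ndg X : nondecreasing_seq (fun i => (g i X)%:E).
  by move=> i j ij; rewrite lee_fin; exact/lefP/nd_nnsfun_approx.
have mg i : measurable_fun setT (fun X => (g i X)%:E) by exact/measurable_EFinP.
have g0 i X : 0 <= (g i X)%:E by rewrite lee_fin.
have gF X : (fun i => (g i X)%:E) @ \oo --> F X.
  exact: cvg_nnsfun_approx.
have c1 := @eiint_monotone s _ _ g0 mg ndg gF 0%R.
have c2 : (fun i => \int[mat_leb]_X (g i X)%:E) @ \oo --> \int[mat_leb]_X F X.
  have -> : \int[mat_leb]_X F X = \int[mat_leb]_X (limn (fun i => (g i X)%:E)).
    by apply: eq_integral => X _; apply/esym/cvg_lim.
  by apply: cvg_monotone_convergence.
move: c1; under eq_cvg do rewrite -E.
by move=> c1; exact: (cvg_unique _ c2 c1).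
Qed.

End iterated.

(** * Affine changes of variable in one dimension *)

Section affine.
Context {R : realType}.
Local Notation leb := (@lebesgue_measure R).
Local Open Scope ereal_scope.

(** Uniqueness of Lebesgue measure: [|c|] times its image under [t -> a + c t] gives half-open
    intervals their length. *)
Lemma ge0_integral_affine (f : R -> \bar R) (a c : R) : c != 0%R ->
  measurable_fun setT f -> (forall t, 0 <= f t) ->
  \int[leb]_t f (a + c * t)%R = (`|c|^-1)%:E * \int[leb]_t f t.
Proof.
move=> c0 mf f0; pose phi (t : R) : measurableTypeR R := (a + c * t)%R.
have mphi : measurable_fun (setT : set (measurableTypeR R)) phi.
  by apply: measurable_funD => //; apply: measurable_funM.
have nc0 : (0 < `|c|)%R by rewrite normr_gt0.
pose k : {nonneg R} := (NngNum (ltW nc0)).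
pose nu0 : {measure set (measurableTypeR R) -> \bar R} := measure_function_pushforward__canonical__measure_function_Measure leb mphi.
pose nu : {measure set (measurableTypeR R) -> \bar R} := mscale k nu0.
have E A : measurable A -> leb A = nu A.
  apply: (@lebesgue_measure_unique R nu) => // X.
  move=> /ocitvP[->|[[x y] /= xy ->]]; first by rewrite !measure0.
  rewrite /nu /nu0 /mscale /= /pushforward.
  have c0' : (0 < c \/ c < 0)%R by case: (ltgtP c 0%R) c0; auto.
  (* For [c < 0] the preimage is closed on the left and open on the right; the sides [b1] and [b2]
     are left existential because the length ignores them. *)
  have [b1 [b2 ->]] : exists b1 b2, phi @^-1` `]x, y]%classic =
      [set` Interval (BSide b1 (Num.min ((x - a) / c) ((y - a) / c))%R)
                     (BSide b2 (Num.max ((x - a) / c) ((y - a) / c))%R)].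
    case: c0' => hc.
      exists false, false; apply/seteqP; split => t /=; rewrite /phi !in_itv /=.
        move=> /andP[h1 h2].
        have h3 : ((x - a) / c < (y - a) / c)%R by rewrite ltr_pM2r ?invr_gt0// ltrD2r.
        rewrite min_l ?max_r ?(ltW h3)//.
        by rewrite ltr_pdivrMr// ler_pdivlMr//; apply/andP; split; lra.
      have h3 : ((x - a) / c < (y - a) / c)%R by rewrite ltr_pM2r ?invr_gt0// ltrD2r.
      rewrite min_l ?max_r ?(ltW h3)// ltr_pdivrMr// ler_pdivlMr// => /andP[h1 h2].
      by apply/andP; split; lra.
    exists true, true; apply/seteqP; split => t /=; rewrite /phi !in_itv /=.
      move=> /andP[h1 h2].
      have h3 : ((y - a) / c < (x - a) / c)%R by rewrite ltr_nM2r ?invr_lt0// ltrD2r.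
      rewrite min_r ?max_l ?(ltW h3)//.
      by rewrite ler_ndivrMr// ltr_ndivlMr//; apply/andP; split; lra.
    have h3 : ((y - a) / c < (x - a) / c)%R by rewrite ltr_nM2r ?invr_lt0// ltrD2r.
    rewrite min_r ?max_l ?(ltW h3)// ler_ndivrMr// ltr_ndivlMr// => /andP[h1 h2].
    by apply/andP; split; lra.
  rewrite !lebesgue_measure_itv /= !lte_fin xy.
  case: c0' => hc.
    have h3 : ((x - a) / c < (y - a) / c)%R by rewrite ltr_pM2r ?invr_gt0// ltrD2r.
    rewrite min_l ?max_r ?(ltW h3)// h3 -!EFinD -EFinM gtr0_norm//.
    by congr (_%:E); field.
  have h3 : ((y - a) / c < (x - a) / c)%R by rewrite ltr_nM2r ?invr_lt0// ltrD2r.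
  rewrite min_r ?max_l ?(ltW h3)// h3 -!EFinD -EFinM ltr0_norm//.
  by congr (_%:E); field.
rewrite (@eq_measure_integral _ _ _ setT nu leb f); last by move=> A mA _; exact: E.
rewrite /nu ge0_integral_mscale// /nu0 ge0_integral_pushforward//=.
rewrite muleA -EFinM mulVf ?mul1e//.
by rewrite gt_eqF.
Qed.

End affine.

Section iterated2.
Context {R : realType} {n p : nat}.
Local Notation mat := 'M[R]_(n, p).
Local Notation idx := ('I_n * 'I_p)%type.
Local Notation leb := (@lebesgue_measure R).
Local Open Scope ereal_scope.

Implicit Types (F : mat -> \bar R) (A B X th c : mat).

Lemma updE (A : mat) k t a i : upd A k t a i = if (a, i) == k then t else A a i.
Proof. by rewrite mxE. Qed.

Lemma upd_comm (A : mat) k l t u : k != l ->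
  upd (upd A k t) l u = upd (upd A l u) k t.
Proof.
move=> kl; apply/matrixP => a i; rewrite !updE.
case: eqP => [->|//]; case: eqP => // lk; by rewrite lk eqxx in kl.
Qed.

Lemma eiint_swap (k l : idx) s F A : k != l -> (forall X, 0 <= F X) ->
  measurable_fun [set: mat] F ->
  eiint (k :: l :: s) F A = eiint (l :: k :: s) F A.
Proof.
move=> kl F0 mF /=.
pose G (u : R * R) := eiint s F (upd (upd A k u.1) l u.2).
have mG : measurable_fun setT G.
  apply: (measurableT_comp (measurable_eiint s F0 mF)).
  by apply: measurable_upd => //; apply: measurable_upd.
have G0 u : 0 <= G u by exact: eiint_ge0.
rewrite (@fubini_tonelli _ _ _ _ _ leb leb G mG G0).
by apply: eq_integral => u _; apply: eq_integral => t _; rewrite /G/= upd_comm.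
Qed.

Lemma eiint_rem (k : idx) s F : k \in s -> uniq s -> (forall X, 0 <= F X) ->
  measurable_fun [set: mat] F -> eiint s F =1 eiint (k :: rem k s) F.
Proof.
move=> + + F0 mF; elim: s => [//|l s IH]; rewrite inE => /orP[/eqP ->|ks] /= /andP[ls us] A.
  by rewrite eqxx.
have lk : l != k by apply: contraNneq ls => ->.
rewrite (negbTE lk); transitivity (eiint (l :: k :: rem k s) F A).
  by apply: eq_integral => t _; exact: IH.
exact: eiint_swap.
Qed.

Lemma perm_eiint s s' F : perm_eq s s' -> uniq s -> (forall X, 0 <= F X) ->
  measurable_fun [set: mat] F -> eiint s F =1 eiint s' F.
Proof.
move=> + + F0 mF; elim: s s' => [|k s IH] s' pss' us A.
  by move: pss'; rewrite perm_sym => /perm_nilP ->.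
have ks' : k \in s' by rewrite -(perm_mem pss') mem_head.
have us' : uniq s' by rewrite -(perm_uniq pss').
rewrite (eiint_rem ks')//=; apply: eq_integral => t _; apply: IH.
  by rewrite -(perm_cons k); apply: (perm_trans pss'); exact: perm_to_rem.
by case/andP: us.
Qed.

Lemma eiint_base s (F : mat -> \bar R) (A B : mat) : (forall k, k \notin s -> A k.1 k.2 = B k.1 k.2) ->
  eiint s F A = eiint s F B.
Proof.
elim: s A B => [|k s IH] A B AB /=.
  by congr F; apply/matrixP => a i; exact: (AB (a, i)).
apply: eq_integral => t _; apply: IH => -[a i] l /=; rewrite !updE.
case: eqP => // /eqP kl; apply: (AB (a, i)).
by rewrite inE negb_or kl l.
Qed.

Lemma eiint_enum (F : mat -> \bar R) (A B : mat) :
  eiint (enum [set: idx]) F A = eiint (enum [set: idx]) F B.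
Proof. by apply: eiint_base => k; rewrite mem_enum in_setT. Qed.

Lemma ge0_integral_mat_perm s F A : perm_eq (enum [set: idx]) s ->
  (forall X, 0 <= F X) -> measurable_fun setT F ->
  \int[mat_leb]_X F X = eiint s F A.
Proof.
move=> ps F0 mF; rewrite ge0_integral_mat_leb// (eiint_enum _ _ A).
by apply: perm_eiint => //; exact: enum_uniq.
Qed.

Definition mat_affine (th c X : mat) : mat := \matrix_(a, i) (th a i + c a i * X a i)%R.

Lemma measurable_mat_affine th c : measurable_fun setT (mat_affine th c).
Proof.
apply: measurable_fun_mat => a i; under eq_fun do rewrite mxE.
apply: measurable_funD => //; apply: measurable_funM => //; exact: measurable_coord.
Qed.

Lemma eiint_affine s F th c A : (forall a i, c a i != 0%R) -> (forall X, 0 <= F X) ->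
  measurable_fun setT F ->
  eiint s (F \o mat_affine th c) A =
  (\prod_(k <- s) `|c k.1 k.2|^-1)%:E * eiint s F (mat_affine th c A).
Proof.
move=> c0 F0 mF; elim: s A => [|k s IH] A /=.
  by rewrite big_nil mul1e.
under eq_integral do rewrite IH.
have -> : (fun t => (\prod_(j <- s) `|c j.1 j.2|^-1)%:E * eiint s F (mat_affine th c (upd A k t)))
   = (fun t => (\prod_(j <- s) `|c j.1 j.2|^-1)%:E *
     (fun t => eiint s F (upd (mat_affine th c A) k t)) (th k.1 k.2 + c k.1 k.2 * t)%R).
  apply/funext => t; congr (_ * eiint _ _ _); apply/matrixP => a i; rewrite !mxE.
  by case: eqP => [<-|].
rewrite ge0_integralZl_EFin//; last 3 first.
- by move=> t _; exact: eiint_ge0.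
- apply: (measurableT_comp (measurable_eiint_upd s (mat_affine th c A) k F0 mF)).
  by apply: measurable_funD => //; apply: measurable_funM.
- by apply: prodr_ge0 => j _; rewrite invr_ge0.
rewrite (@ge0_integral_affine R (fun t => eiint s F (upd (mat_affine th c A) k t)))//.
- by rewrite big_cons EFinM muleA; congr (_ * _); rewrite muleC.
- exact: measurable_eiint_upd.
- by move=> t; exact: eiint_ge0.
Qed.

Lemma ge0_integral_mat_affine F th c : (forall a i, c a i != 0%R) -> (forall X, 0 <= F X) ->
  measurable_fun setT F ->
  \int[mat_leb]_X F (mat_affine th c X) =
  (\prod_(k : idx) `|c k.1 k.2|^-1)%:E * \int[mat_leb]_X F X.
Proof.
move=> c0 F0 mF; rewrite ge0_integral_mat_leb//; last first.
  exact: (measurableT_comp mF (measurable_mat_affine th c)).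
rewrite (@eiint_affine _ F)// -(eiint_enum _ 0%R) -ge0_integral_mat_leb//.
congr (_%:E * _); rewrite big_enum /=; by apply: eq_bigl => k; rewrite in_setT.
Qed.

Lemma eiint_prod s (f : idx -> R -> \bar R) A : uniq s -> (forall k t, 0 <= f k t) ->
  (forall k, measurable_fun setT (f k)) ->
  eiint s (fun X => \prod_(k <- s) f k (X k.1 k.2)) A =
  \prod_(k <- s) \int[leb]_t f k t.
Proof.
move=> + f0 mf; have mc k : measurable_fun setT (fun X : mat => f k (X k.1 k.2)).
  exact: (measurableT_comp (mf k) (measurable_coord _ _)).
have mp s' : measurable_fun setT (fun X : mat => \prod_(k <- s') f k (X k.1 k.2)).
  elim: s' => [|k s' IH]; first by (under eq_fun do rewrite big_nil); exact: measurable_cst.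
  under eq_fun do rewrite big_cons.
  exact: emeasurable_funM.
have p0 s' X : 0 <= \prod_(k <- s') f k (X k.1 k.2) by apply: prode_ge0 => ? _.
have loc k s' (G : mat -> \bar R) (B : mat) : measurable_fun setT G ->
    (forall X, 0 <= G X) -> k \notin s' ->
    eiint s' (fun X => f k (X k.1 k.2) * G X) B = f k (B k.1 k.2) * eiint s' G B.
  move=> mG G0; elim: s' B => [//|l s' IH] B; rewrite in_cons negb_or => /andP[kl ks'] /=.
  under eq_integral => t _ do rewrite IH// updE -surjective_pairing (negbTE kl).
  rewrite ge0_integralZl//.
  - exact: measurable_eiint_upd.
  - by move=> t _; exact: eiint_ge0.
elim: s A => [|k s IH] A /=; first by rewrite !big_nil.
move=> /andP[ks us].
have -> : (fun X : mat => \prod_(j <- k :: s) f j (X j.1 j.2)) =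
   (fun X : mat => f k (X k.1 k.2) * \prod_(j <- s) f j (X j.1 j.2)).
  by apply/funext => X; rewrite big_cons.
under eq_integral do rewrite loc// IH// updE -surjective_pairing eqxx.
rewrite big_cons ge0_integralZr//; first exact: mf.
by apply: prode_ge0 => j _; exact: integral_ge0.
Qed.

Lemma ge0_integral_mat_prod (f : idx -> R -> \bar R) : (forall k t, 0 <= f k t) ->
  (forall k, measurable_fun setT (f k)) ->
  \int[mat_leb]_(X in [set: mat]) \prod_(k : idx) f k (X k.1 k.2) =
  \prod_(k : idx) \int[leb]_t f k t.
Proof.
move=> f0 mf.
have E (h : idx -> \bar R) : \prod_(k : idx) h k = \prod_(k <- enum [set: idx]) h k.
  by rewrite big_enum /=; apply: eq_bigl => k; rewrite in_setT.
under eq_integral do rewrite E.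
rewrite E ge0_integral_mat_leb.
- by apply: eiint_prod => //; exact: enum_uniq.
- by move=> X; apply: prode_ge0.
- elim: (enum _) => [|k s IH]; first by (under eq_fun do rewrite big_nil); exact: measurable_cst.
  under eq_fun do rewrite big_cons.
  apply: emeasurable_funM => //.
  exact: (measurableT_comp (mf k) (measurable_coord _ _)).
Qed.

End iterated2.

(** * Signed iterated integrals as Lebesgue integrals *)

Section mxint_integral.
Context {R : realType} {n p : nat}.
Local Notation mat := 'M[R]_(n, p).
Local Notation idx := ('I_n * 'I_p)%type.
Local Notation leb := (@lebesgue_measure R).
Local Open Scope ereal_scope.
Implicit Types (F : mat -> R) (A B X th c : mat) (s : seq idx).

Lemma integrable_posneg d (T : measurableType d) (m : {measure set T -> \bar R}) (f : T -> R) :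
  m.-integrable setT (EFin \o f) ->
  Rintegral m setT f = (fine (\int[m]_x ((EFin \o f)^\+)%E x) - fine (\int[m]_x ((EFin \o f)^\-)%E x))%R.
Proof.
move=> fi; rewrite /Rintegral integralE fineB//.
- exact: integrable_pos_fin_num.
- exact: integrable_neg_fin_num.
Qed.

Lemma measurable_iint s F : measurable_fun setT F -> measurable_fun setT (iint s F).
Proof.
move=> mF; elim: s => [//|k s IH] /=.
pose H (v : mat * R) := (iint s F (upd v.1 k v.2))%:E.
have mH : measurable_fun setT H.
  apply/measurable_EFinP; apply: (measurableT_comp IH).
  by apply: measurable_upd.
rewrite /Rintegral; apply: measurableT_comp => //.
under eq_fun do rewrite integralE.
apply: emeasurable_funB.
- have h0 v : 0 <= H^\+ v by [].
  apply: eq_measurable_fun (@measurable_fun_fubini_tonelli_F _ _ _ _ _ leb _ (measurable_funepos mH) h0).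
  by move=> A _; apply: eq_integral => t _; rewrite !funeposE.
- have h0 v : 0 <= H^\- v by [].
  apply: eq_measurable_fun (@measurable_fun_fubini_tonelli_F _ _ _ _ _ leb _ (measurable_funeneg mH) h0).
  by move=> A _; apply: eq_integral => t _; rewrite !funenegE.
Qed.

Lemma integrable_fine d (T : measurableType d) (m : {measure set T -> \bar R}) (g : T -> \bar R) :
  m.-integrable setT g -> ae_eq m setT g (EFin \o (fine \o g)).
Proof.
move=> gi; apply: filterS (integrable_ae measurableT gi) => x h _ /=.
by rewrite fineK//; apply: h.
Qed.

(** Finiteness of the absolute integral is known only at [A], so an inner iterate may be infinite
    for some [t], where [iint] has a meaningless value. Integrability of the inner absolute iterate
    [g] confines this to a null set, and the induction hypothesis is applied almost everywhere. *)
Lemma iintE s F A : measurable_fun setT F ->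
  eiint s (fun X => `|F X|%:E) A < +oo ->
  iint s F A = (fine (eiint s ((EFin \o F)^\+)%E A) - fine (eiint s ((EFin \o F)^\-)%E A))%R.
Proof.
move=> mF; have meF : measurable_fun setT (EFin \o F) by exact/measurable_EFinP.
have mp := measurable_funepos meF; have mn := measurable_funeneg meF.
have ma : measurable_fun setT (fun X => `|F X|%:E).
  by apply/measurable_EFinP; apply: measurableT_comp.
have p0 X : 0 <= (EFin \o F)^\+ X by [].
have n0 X : 0 <= (EFin \o F)^\- X by [].
have a0 X : 0 <= `|F X|%:E by rewrite lee_fin.
have pa X : (EFin \o F)^\+ X <= `|F X|%:E.
  by rewrite funeposE /= -EFin_max lee_fin ge_max ler_norm normr_ge0.
have na X : (EFin \o F)^\- X <= `|F X|%:E.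
  by rewrite funenegE /= -EFin_max lee_fin ge_max -normrN ler_norm normr_ge0.
elim: s A => [|k s IH] A /=.
  move=> _; rewrite funeposE funenegE /= -!EFin_max /=.
  by rewrite /Order.max; case: ltP => h1; case: ltP => h2; lra.
set g := fun t => eiint s (fun X => `|F X|%:E) (upd A k t) => g_lty.
set gp := fun t => eiint s (EFin \o F)^\+ (upd A k t).
set gn := fun t => eiint s (EFin \o F)^\- (upd A k t).
have mg : measurable_fun setT g by exact: measurable_eiint_upd.
have mgp : measurable_fun setT gp by exact: measurable_eiint_upd.
have mgn : measurable_fun setT gn by exact: measurable_eiint_upd.
have gi : leb.-integrable setT g.
  apply/integrableP; split => //.
  by under eq_integral do rewrite gee0_abs ?eiint_ge0//.
have gpi : leb.-integrable setT gp.
  apply: (@le_integrable _ _ _ leb setT measurableT _ g mgp _ gi) => t _.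
  by rewrite !gee0_abs ?eiint_ge0// le_eiint.
have gni : leb.-integrable setT gn.
  apply: (@le_integrable _ _ _ leb setT measurableT _ g mgn _ gi) => t _.
  by rewrite !gee0_abs ?eiint_ge0// le_eiint.
have mfgp : measurable_fun setT (EFin \o (fine \o gp)).
  by apply/measurable_EFinP; apply: measurableT_comp.
have mfgn : measurable_fun setT (EFin \o (fine \o gn)).
  by apply/measurable_EFinP; apply: measurableT_comp.
(* [gp] may be infinite on a null set; its finite part has the same integral and is what [iint]
   sees. *)
have ep : \int[leb]_t gp t = \int[leb]_t (fine (gp t))%:E.
  apply: ae_eq_integral => //; exact: integrable_fine.
have en : \int[leb]_t gn t = \int[leb]_t (fine (gn t))%:E.
  apply: ae_eq_integral => //; exact: integrable_fine.
have ifp : leb.-integrable setT (EFin \o (fine \o gp)).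
  apply/integrableP; split => //; apply: le_lt_trans (integral_funepos_lt_pinfty measurableT gpi).
  have -> : gp^\+ = gp by apply/funext => t; rewrite funeposE; apply/max_idPl/eiint_ge0.
  rewrite ep; apply: ge0_le_integral => //.
  - exact: measurableT_comp.
  - by move=> t _ /=; rewrite lee_fin ger0_norm// fine_ge0// eiint_ge0.
have ifn : leb.-integrable setT (EFin \o (fine \o gn)).
  apply/integrableP; split => //; apply: le_lt_trans (integral_funepos_lt_pinfty measurableT gni).
  have -> : gn^\+ = gn by apply/funext => t; rewrite funeposE; apply/max_idPl/eiint_ge0.
  rewrite en; apply: ge0_le_integral => //.
  - exact: measurableT_comp.
  - by move=> t _ /=; rewrite lee_fin ger0_norm// fine_ge0// eiint_ge0.
rewrite /Rintegral.
have -> : \int[leb]_t (iint s F (upd A k t))%:E = \int[leb]_t ((fine (gp t) - fine (gn t))%R)%:E.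
  apply: ae_eq_integral => //.
  - apply/measurable_EFinP; apply: (measurableT_comp (measurable_iint s mF)).
    by apply: measurable_upd.
  - by apply/measurable_EFinP; apply: measurable_funB; apply: measurableT_comp.
  - apply: filterS (integrable_ae measurableT gi) => t /(_ I) h _ /=.
    by rewrite IH//; rewrite ltey_eq h.
have -> : \int[leb]_t ((fine (gp t) - fine (gn t))%R)%:E =
   \int[leb]_t (fine (gp t))%:E - \int[leb]_t (fine (gn t))%:E.
  exact: (integralB_EFin measurableT ifp ifn).
rewrite -ep -en fineB//; exact: integrable_fin_num.
Qed.

Lemma mxintE F : mat_leb.-integrable setT (EFin \o F) ->
  mxint F = (\int[mat_leb]_X F X)%R.
Proof.
move=> /[dup] Fi /integrableP[meF]; have mF : measurable_fun setT F by apply/measurable_EFinP.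
rewrite ge0_integral_mat_leb//; last by apply: measurableT_comp.
move=> h; rewrite /mxint iintE// integrable_posneg// !ge0_integral_mat_leb//.
- exact: measurable_funeneg.
- exact: measurable_funepos.
Qed.

Lemma integrable_mat_affine F th c : (forall a i, c a i != 0%R) ->
  mat_leb.-integrable setT (EFin \o F) ->
  mat_leb.-integrable setT (EFin \o (F \o mat_affine th c)).
Proof.
move=> c0 /integrableP[mF Foo]; apply/integrableP; split.
  exact: (measurableT_comp mF (measurable_mat_affine th c)).
rewrite (@ge0_integral_mat_affine _ _ _ (fun X => `|(EFin \o F) X|))//; last first.
  exact: measurableT_comp.
apply: lte_mul_pinfty => //; rewrite lee_fin.
by apply: prodr_ge0 => j _; rewrite invr_ge0.
Qed.

Lemma Rintegral_mat_affine F th c : (forall a i, c a i != 0%R) ->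
  mat_leb.-integrable setT (EFin \o F) ->
  (\int[mat_leb]_X F (mat_affine th c X) =
   (\prod_(k : idx) `|c k.1 k.2|^-1) * \int[mat_leb]_X F X)%R.
Proof.
move=> c0 Fi; have /integrableP[mF _] := Fi.
rewrite integrable_posneg; last exact: integrable_mat_affine.
rewrite integrable_posneg//.
have -> : (EFin \o (fun X => F (mat_affine th c X)))^\+ = (EFin \o F)^\+ \o mat_affine th c.
  by rewrite -funepos_comp.
have -> : (EFin \o (fun X => F (mat_affine th c X)))^\- = (EFin \o F)^\- \o mat_affine th c.
  by rewrite -funeneg_comp.
rewrite (@ge0_integral_mat_affine _ _ _ ((EFin \o F)^\+))//; last exact: measurable_funepos.
rewrite (@ge0_integral_mat_affine _ _ _ ((EFin \o F)^\-))//; last exact: measurable_funeneg.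
rewrite !fineM ?mulrBr//.
- exact: integrable_neg_fin_num.
- exact: integrable_pos_fin_num.
Qed.

End mxint_integral.

(** * Gram determinants *)

Section gram.
Context {R : realFieldType}.
Implicit Types (n q : nat).

Lemma sqnorm_ge0 n (y : 'cV[R]_n) : 0 <= (y^T *m y) 0 0.
Proof. by rewrite mxE sumr_ge0// => i _; rewrite mxE -expr2 sqr_ge0. Qed.

Lemma sqnorm_entry n (y : 'cV[R]_n) j : (y j 0) ^+ 2 <= (y^T *m y) 0 0.
Proof.
rewrite mxE (bigD1 j)//= mxE -expr2 lerDl sumr_ge0// => i _.
by rewrite mxE -expr2 sqr_ge0.
Qed.

Lemma sqnorm_eq0 n (y : 'cV[R]_n) : (y^T *m y) 0 0 = 0 -> y = 0.
Proof.
move=> y0; apply/matrixP => j k; rewrite ord1 mxE.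
by apply/eqP; rewrite -sqrf_eq0 eq_le sqr_ge0 andbT -y0 sqnorm_entry.
Qed.

(** [M *m w] is the orthogonal projection of [x] on the column span. The unipotent [T] removes it,
    and orthogonality makes the remaining Gram matrix block diagonal. *)
Lemma det_gram_row_mx n q (M : 'M[R]_(n, q)) (x : 'cV[R]_n) : M^T *m M \in unitmx ->
  exists y w, [/\ M^T *m y = 0, x = y + M *m w &
    \det ((row_mx x M)^T *m row_mx x M) = (y^T *m y) 0 0 * \det (M^T *m M)].
Proof.
move=> uG; pose w := invmx (M^T *m M) *m (M^T *m x); pose y := x - M *m w.
have My : M^T *m y = 0.
  by rewrite mulmxBr /w !mulmxA mulmxV// mul1mx subrr.
exists y, w; split => //; first by rewrite subrK.
pose T : 'M[R]_(1 + q) := block_mx 1%:M 0 w 1%:M.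
have -> : row_mx x M = row_mx y M *m T.
  by rewrite /T mul_row_block !mulmx1 mulmx0 add0r subrK.
have yM : y^T *m M = 0 by rewrite -[LHS]trmxK trmx_mul trmxK My trmx0.
rewrite trmx_mul -!mulmxA (mulmxA _ _ T) det_mulmx det_tr.
rewrite det_mulmx [\det T]det_lblock !det1 !mul1r mulr1.
rewrite tr_row_mx mul_col_row My yM.
by rewrite det_ublock [X in \det X * _]mx11_scalar det_scalar1.
Qed.

Lemma det_gram_ge0 n q (M : 'M[R]_(n, q)) : 0 <= \det (M^T *m M).
Proof.
elim: q M => [|q IH] M; first by rewrite det_mx00.
have -> : M = row_mx (lsubmx (M : 'M[R]_(n, 1 + q))) (rsubmx (M : 'M[R]_(n, 1 + q))) by rewrite hsubmxK.
set x := (lsubmx _); set M' := rsubmx _.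
have [u|nu] := boolP ((M'^T *m M') \in unitmx).
  have [y [w [_ _ ->]]] := det_gram_row_mx x u.
  by rewrite mulr_ge0// sqnorm_ge0.
suff -> : \det ((row_mx x M')^T *m row_mx x M') = 0 by [].
have := nu; rewrite unitmxE unitfE negbK => /eqP/eqP/det0P[v v0 vG].
(* A kernel vector [v] of the smaller Gram matrix [G] has [M' *m v^T = 0], whose squared norm is
   [v G v^T]; padded with [0] it becomes a kernel vector of the larger one. *)
apply/eqP/det0P; exists (row_mx 0 v).
  by apply: contraNneq v0 => h; have := congr1 rsubmx h; rewrite row_mxKr linear0 => ->.
have -> : (row_mx 0 v : 'rV[R]_(1 + q)) *m ((row_mx x M')^T *m row_mx x M') = v *m M'^T *m row_mx x M'.
  by rewrite mulmxA tr_row_mx mul_row_col mul0mx add0r.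
suff -> : v *m M'^T = 0 by rewrite mul0mx.
suff : M' *m v^T = 0 by move/(congr1 trmx); rewrite trmx_mul trmxK trmx0.
apply: sqnorm_eq0.
by rewrite trmx_mul trmxK -!mulmxA (mulmxA _ _ v^T) mulmxA vG mul0mx mxE.
Qed.

Lemma det_gram_gt0 n q (M : 'M[R]_(n, q)) : M^T *m M \in unitmx -> 0 < \det (M^T *m M).
Proof. by rewrite unitmxE unitfE lt_neqAle det_gram_ge0 andbT eq_sym. Qed.

(** Column [i] has a single nonzero entry. This determinant is the one behind Cramer's rule, and
    also that of an elementary column operation. *)
Lemma det_row_subst q (i : 'I_q) (r : 'I_q -> R) :
  \det (\matrix_(a, b) if a == i then r b else (a == b)%:R) = r i.
Proof.
rewrite (expand_det_col _ i) (bigD1 i)//= big1 ?addr0.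
  rewrite mxE eqxx /cofactor -signr_odd oddD addbb expr0 mul1r.
  rewrite (_ : row' _ _ = 1%:M) ?det1 ?mulr1//.
  apply/matrixP => a b; rewrite !mxE eq_sym (negbTE (neq_lift _ _)).
  by rewrite (inj_eq lift_inj).
by move=> j ji; rewrite mxE (negbTE ji) mul0r.
Qed.

(* Cramer's rule against a maximal minor bounds the coefficients by 1. *)
Lemma maximal_minor n q (M : 'M[R]_(n, q)) : M^T *m M \in unitmx ->
  exists (f : 'I_q -> 'I_n) (B : 'M[R]_(n, q)),
    [/\ injective f, M = B *m rowsub f M & forall j i, `|B j i| <= 1].
Proof.
move=> uG.
have fM : row_full M.
  rewrite -col_leq_rank; have := mxrankM_maxr M^T M.
  by rewrite mxrank_unit.
pose minor (f : {ffun 'I_q -> 'I_n}) := `|\det (rowsub f M)|.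
pose f0 : {ffun 'I_q -> 'I_n} := [ffun i => fullrankfun fM i].
have m0 : 0 < minor f0.
  rewrite normr_gt0 -unitfE -unitmxE.
  rewrite (_ : rowsub f0 M = rowsub (fullrankfun fM) M).
    by apply: fullrowsub_unit.
  by apply/matrixP => a b; rewrite !mxE ffunE.
pose f := [arg max_(f > f0) minor f]%O.
have fmax g : minor g <= minor f.
  by rewrite /f; case: arg_maxP => // h _ hmax; apply: hmax.
have uf : rowsub f M \in unitmx.
  by rewrite unitmxE unitfE -normr_gt0 (lt_le_trans m0).
have detf : \det (rowsub f M) != 0 by rewrite -unitfE -unitmxE.
exists f, (M *m invmx (rowsub f M)); split.
- move=> a b fab; apply/eqP; apply: contraNT detf => ab.
  apply/eqP; apply: (determinant_alternate ab) => c.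
  by rewrite !mxE fab.
- by rewrite mulmxKV.
- move=> j i; set B := M *m _.
  pose g : {ffun 'I_q -> 'I_n} := [ffun a => if a == i then j else f a].
  have Eg : rowsub g M = (\matrix_(a, b) if a == i then B j b else (a == b)%:R) *m rowsub f M.
    apply/matrixP => a b; rewrite !mxE ffunE; have [ai|/negbTE ai'] := eqVneq a i.
      transitivity ((B *m rowsub f M) j b); first by rewrite mulmxKV.
      by rewrite mxE; apply: eq_bigr => c _; rewrite !mxE ai eqxx.
    rewrite (bigD1 a)//= !mxE ?ai' eqxx mul1r big1 ?addr0//.
    by move=> c ca; rewrite !mxE ?ai' eq_sym (negbTE ca) mul0r.
  have := fmax g; rewrite /minor Eg det_mulmx det_row_subst normrM.
  by rewrite ger_pMl ?normr_gt0.
Qed.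

(** Since [M = B *m rowsub f M], the combination of pivot entries cancels the component of [x] in
    the span of [M]. What is left involves the orthogonal residual [y] alone: [1 + q] terms with
    coefficients at most 1, each bounded by the norm of [y], and [|y|^2] is the ratio of the two
    Gram determinants. *)
Lemma gram_pivot n q (M : 'M[R]_(n, q)) : M^T *m M \in unitmx ->
  exists (f : 'I_q -> 'I_n) (B : 'M[R]_(n, q)),
    [/\ injective f, (forall j i, `|B j i| <= 1) &
     forall (x : 'cV[R]_n) j, \det (M^T *m M) * (x j 0 - \sum_i B j i * x (f i) 0) ^+ 2 <=
       (1 + q)%:R ^+ 2 * \det ((row_mx x M)^T *m row_mx x M)].
Proof.
move=> uG; have [f [B [finj MB B1]]] := maximal_minor uG.
exists f, B; split => // x j.
have [y [w [_ xE ->]]] := det_gram_row_mx x uG.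
rewrite [leRHS]mulrA [leRHS]mulrC ler_pM2l ?det_gram_gt0//.
have -> : x j 0 - \sum_i B j i * x (f i) 0 = y j 0 - \sum_i B j i * y (f i) 0.
  have E (a : 'I_n) : x a 0 = y a 0 + (M *m w) a 0 by rewrite xE mxE.
  rewrite E; under eq_bigr do rewrite E mulrDr.
  rewrite big_split /= opprD addrACA -[RHS]addr0; congr (_ + _).
  rewrite {1}MB -mulmxA mxE -sumrB big1// => i _.
  suff -> : (rowsub f M *m w) i 0 = (M *m w) (f i) 0 by rewrite subrr.
  by rewrite !mxE; apply: eq_bigr => c _; rewrite mxE.
set s := (y^T *m y) 0 0; have s0 : 0 <= s by exact: sqnorm_ge0.
have ys a : `|y a 0| ^+ 2 <= s by rewrite real_normK ?num_real// sqnorm_entry.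
have [m [m0 ms my]] : exists m, [/\ 0 <= m, m ^+ 2 <= s & forall a, `|y a 0| <= m].
  pose m := `|y [arg max_(a > j) `|y a 0|]%O 0|.
  exists m; split; rewrite /m ?ys//; case: arg_maxP => // a _ h b; exact: h.
have h : `|y j 0 - \sum_i B j i * y (f i) 0| <= (1 + q)%:R * m.
  apply: (le_trans (ler_normB _ _)); rewrite natrD mulrDl mul1r lerD//.
  apply: (le_trans (ler_norm_sum _ _ _)).
  have -> : q%:R * m = \sum_(i < q) m by rewrite sumr_const card_ord mulr_natl.
  by apply: ler_sum => i _; rewrite normrM -[leRHS]mul1r ler_pM.
rewrite -[X in X <= _]real_normK ?num_real//.
apply: (le_trans (_ : _ <= ((1 + q)%:R * m) ^+ 2)).
  by rewrite ler_sqr ?nnegrE// mulr_ge0.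
by rewrite exprMn ler_wpM2l// sqr_ge0.
Qed.

End gram.

(** * Second-order jets *)

Section jet1.
Context {R : realType}.
Definition jet1 (g : R -> R) (c g0 g1 g2 : R) := forall e, 0 < e -> exists2 d, 0 < d &
  forall u, `|u| <= d -> `|g (c + u) - (g0 + g1 * u + g2 / 2 * u ^+ 2)| <= e * u ^+ 2.

Lemma is_derive_lin (g : R -> R) (c b : R) : is_derive c (1 : R) g b ->
  forall e, 0 < e -> exists2 d, 0 < d &
    forall u, `|u| <= d -> `|g (c + u) - g c - b * u| <= e * `|u|.
Proof.
move=> [dg <-] e e0; have : (fun h => h^-1 *: ((g \o shift c) (h *: (1 : R)) - g c)) @ 0^' --> 'D_1 g c.
  exact: dg.
move=> /cvgrPdist_le/(_ _ e0); rewrite near_withinE => /nbhs_ballP[d /= d0 H].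
exists (d / 2); first by rewrite divr_gt0.
move=> u ud; have [->|u0] := eqVneq u 0.
  by rewrite addr0 subrr mulr0 subr0 normr0 mulr0.
have := H u; rewrite /ball /= sub0r normrN => /(_ _ u0).
have -> : `|u| < d by lra.
move=> /(_ isT); rewrite /shift /= [u *: _]mulr1 [u + c]addrC -[X in X <= _]normrN opprB => h.
have -> : g (c + u) - g c - 'D_1 g c * u = (u^-1 *: (g (c + u) - g c) - 'D_1 g c) * u.
  by rewrite mulrBl [_ *: _]mulrC mulfVK.
by rewrite normrM ler_wpM2r.
Qed.

(** The mean value theorem applied to the remainder [phi]: its derivative is [o(t)] because [g'] is
    differentiable at [c], and one more factor [u] gives [o(u^2)]. *)
Lemma jet1_derive (g g' : R -> R) (c r g2 : R) : 0 < r ->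
  (forall x, `|x - c| < r -> is_derive x (1 : R) g (g' x)) ->
  is_derive c (1 : R) g' g2 -> jet1 g c (g c) (g' c) g2.
Proof.
move=> r0 dg /is_derive_lin dg' e e0; have [d d0 Hd] := dg' _ e0.
exists (Num.min d (r / 2)); first by rewrite lt_min d0 divr_gt0.
move=> u; rewrite le_min => /andP[ud ur].
pose phi t := g (c + t) - (g' c * t + g2 / 2 * t ^+ 2).
pose phi' t := g' (c + t) - (g' c + g2 * t).
have dphi t : `|t| < r -> is_derive t (1 : R) phi (phi' t).
  move=> tr; have H1 : is_derive (shift c t) (1 : R) g (g' (c + t)).
    have -> : shift c t = c + t by rewrite /shift /= addrC.
    by apply: dg; rewrite addrC addKr.
  have H3 := is_derive1_comp H1 (is_derive_shift t (1 : R) c).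
  have H4 := is_deriveZ (g' c) (is_derive_id t (1 : R)).
  have H5 := is_deriveZ (g2 / 2) (is_deriveX 2 (is_derive_id t (1 : R))).
  have H6 := is_deriveB H3 (is_deriveD H4 H5).
  have -> : phi = g \o shift c - (g' c \*: id + (g2 / 2) \*: (id ^+ 2)).
    by apply/funext => x; rewrite /phi /= !fctE /= /shift /= addrC [x + c]addrC addrC.
  apply: (is_derive_eq H6); rewrite /phi' /= mulr1 /GRing.scale /= !mulr1 expr1.
  by field.
have bphi t : `|t| <= `|u| -> `|phi' t| <= e * `|u|.
  move=> tu; rewrite /phi' opprD addrA; apply: le_trans (Hd _ (le_trans tu ud)) _.
  by rewrite ler_wpM2l// ltW.
have cphi a b : `|a| < r -> `|b| < r -> {within `[a, b], continuous phi}.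
  move=> ar br; apply: derivable_within_continuous => x; rewrite in_itv/= => /andP[ax xb].
  apply: ex_derive; apply: dphi; rewrite ltr_norml; move: ar br; rewrite !ltr_norml.
  by move=> /andP[? ?] /andP[? ?]; apply/andP; split; lra.
have E : g (c + u) - (g c + g' c * u + g2 / 2 * u ^+ 2) = phi u - phi 0.
  by rewrite /phi addr0; ring.
have ru : `|u| < r by lra.
have r0' : `|0 : R| < r by rewrite normr0.
have itv t : (u < t < 0) || (0 < t < u) -> is_derive t (1 : R) phi (phi' t).
  move=> h; apply: dphi; move: ru; rewrite !ltr_norml => /andP[? ?].
  by case/orP: h => /andP[? ?]; apply/andP; split; lra.
rewrite E; case: (ltgtP u 0) => u0.
- have h0 t : t \in `]u, 0[%R -> is_derive t (1 : R) phi (phi' t).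
    by rewrite in_itv/= => h; apply: itv; rewrite h.
  have [x] := MVT u0 h0 (cphi _ _ ru r0').
  rewrite in_itv/= => /andP[ux x0]; rewrite sub0r distrC => ->.
  rewrite normrM normrN; have := bphi x.
  rewrite (ltr0_norm x0) (ltr0_norm u0) lerN2 (ltW ux) => /(_ isT) h.
  by apply: le_trans (ler_wpM2r _ h) _; [lra|rewrite expr2; lra].
- have h0 t : t \in `]0, u[%R -> is_derive t (1 : R) phi (phi' t).
    by rewrite in_itv/= => h; apply: itv; rewrite h orbT.
  have [x] := MVT u0 h0 (cphi _ _ r0' ru).
  rewrite in_itv/= => /andP[ux x0]; rewrite subr0 => ->.
  rewrite normrM; have := bphi x.
  rewrite (gtr0_norm ux) (gtr0_norm u0) (ltW x0) => /(_ isT) h.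
  by apply: le_trans (ler_wpM2r _ h) _; [lra|rewrite expr2; lra].
- by rewrite u0 subrr normr0 expr0n mulr0.
Qed.

Lemma jet1_expR (c : R) : jet1 expR c (expR c) (expR c) (expR c).
Proof. by apply: (@jet1_derive _ expR c 1) => // x _; exact: is_derive_expR. Qed.

Lemma jet1_ln (c : R) : 0 < c -> jet1 (@ln R) c (ln c) c^-1 (- (c ^- 2)).
Proof.
move=> c0; apply: (@jet1_derive _ (fun x => x^-1) c c) => //.
  move=> x xc; apply: is_derive1_ln; move: xc; rewrite ltr_norml => /andP[]; lra.
have := @is_deriveV R id c 1 1; rewrite /= gt_eqF// => /(_ isT (is_derive_id _ _)) h.
by apply: is_derive_eq; rewrite [LHS]mulr1.
Qed.

End jet1.

Section jets.
Context {R : realType} {n p : nat}.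
Local Notation mat := 'M[R]_(n, p).
Local Notation idx := ('I_n * 'I_p)%type.
Implicit Types (X h : mat) (L : idx -> R) (H : idx -> idx -> R).

Definition sq (X : mat) : R := \sum_(k : idx) X k.1 k.2 ^+ 2.
Definition nm (X : mat) : R := Num.sqrt (sq X).

Lemma sq_ge0 X : 0 <= sq X.
Proof. by apply: sumr_ge0 => k _; rewrite sqr_ge0. Qed.

Lemma nm_ge0 X : 0 <= nm X. Proof. exact: sqrtr_ge0. Qed.

Lemma nm_sqr X : nm X ^+ 2 = sq X. Proof. by rewrite sqr_sqrtr// sq_ge0. Qed.

Lemma sq_entry X (k : idx) : X k.1 k.2 ^+ 2 <= sq X.
Proof.
by rewrite /sq (bigD1 k)//= lerDl sumr_ge0// => j _; rewrite sqr_ge0.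
Qed.

Lemma nm_entry X (k : idx) : `|X k.1 k.2| <= nm X.
Proof. by rewrite -sqrtr_sqr ler_wsqrtr// sq_entry. Qed.

Lemma sqZ (a : R) X : sq (a *: X) = a ^+ 2 * sq X.
Proof. by rewrite /sq mulr_sumr; apply: eq_bigr => k _; rewrite mxE exprMn. Qed.

Lemma nmZ (a : R) X : nm (a *: X) = `|a| * nm X.
Proof. by rewrite /nm sqZ sqrtrM ?sqr_ge0// sqrtr_sqr. Qed.

Lemma sqN X : sq (- X) = sq X.
Proof. by rewrite -scaleN1r sqZ sqrrN expr1n mul1r. Qed.

Definition lin (L : idx -> R) (h : mat) : R := \sum_k L k * h k.1 k.2.
Definition quad (H : idx -> idx -> R) (h : mat) : R :=
  \sum_k \sum_l H k l * (h k.1 k.2 * h l.1 l.2).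

Lemma lin_bound L : exists2 K, 0 <= K & forall h, `|lin L h| <= K * nm h.
Proof.
exists (\sum_k `|L k|); first by apply: sumr_ge0.
move=> h; rewrite mulr_suml; apply: le_trans (ler_norm_sum _ _ _) _.
by apply: ler_sum => k _; rewrite normrM ler_wpM2l// nm_entry.
Qed.

Lemma quad_bound H : exists2 K, 0 <= K & forall h, `|quad H h| <= K * nm h ^+ 2.
Proof.
exists (\sum_k \sum_l `|H k l|); first by apply: sumr_ge0 => k _; apply: sumr_ge0.
move=> h; rewrite mulr_suml; apply: le_trans (ler_norm_sum _ _ _) _.
apply: ler_sum => k _; rewrite mulr_suml; apply: le_trans (ler_norm_sum _ _ _) _.
apply: ler_sum => l _; rewrite normrM ler_wpM2l// normrM expr2.
by rewrite ler_pM// nm_entry.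
Qed.

Lemma linZ L a h : lin L (a *: h) = a * lin L h.
Proof. by rewrite /lin mulr_sumr; apply: eq_bigr => k _; rewrite mxE; ring. Qed.

Lemma quadZ H a h : quad H (a *: h) = a ^+ 2 * quad H h.
Proof.
rewrite /quad mulr_sumr; apply: eq_bigr => k _; rewrite mulr_sumr.
by apply: eq_bigr => l _; rewrite !mxE; ring.
Qed.

Lemma linD L L' h : lin (fun k => L k + L' k) h = lin L h + lin L' h.
Proof. by rewrite /lin -big_split; apply: eq_bigr => k _ /=; ring. Qed.

Lemma linZl L a h : lin (fun k => a * L k) h = a * lin L h.
Proof. by rewrite /lin mulr_sumr; apply: eq_bigr => k _ /=; ring. Qed.

Lemma quadD H H' h : quad (fun k l => H k l + H' k l) h = quad H h + quad H' h.
Proof.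
rewrite /quad -big_split; apply: eq_bigr => k _ /=.
by rewrite -big_split; apply: eq_bigr => l _ /=; ring.
Qed.

Lemma quadZl H a h : quad (fun k l => a * H k l) h = a * quad H h.
Proof.
rewrite /quad mulr_sumr; apply: eq_bigr => k _ /=.
by rewrite mulr_sumr; apply: eq_bigr => l _ /=; ring.
Qed.

Lemma quad_tensor L L' h : quad (fun k l => L k * L' l) h = lin L h * lin L' h.
Proof.
rewrite /quad /lin mulr_suml; apply: eq_bigr => k _.
by rewrite mulr_sumr; apply: eq_bigr => l _; ring.
Qed.

Definition bigO (m : nat) (f : mat -> R) := exists K d, [/\ 0 <= K, 0 < d &
  forall h, nm h <= d -> `|f h| <= K * nm h ^+ m].

Definition o2 (f : mat -> R) := forall e, 0 < e -> exists2 d, 0 < d &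
  forall h, nm h <= d -> `|f h| <= e * nm h ^+ 2.

Lemma bigOD m f g : bigO m f -> bigO m g -> bigO m (fun h => f h + g h).
Proof.
move=> [K [d [K0 d0 Hf]]] [K' [d' [K'0 d'0 Hg]]].
exists (K + K'), (Num.min d d'); split; rewrite ?addr_ge0 ?lt_min ?d0//.
move=> h; rewrite le_min => /andP[hd hd']; rewrite mulrDl.
by apply: le_trans (ler_normD _ _) _; rewrite lerD ?Hf ?Hg.
Qed.

Lemma bigOM m m' f g : bigO m f -> bigO m' g -> bigO (m + m') (fun h => f h * g h).
Proof.
move=> [K [d [K0 d0 Hf]]] [K' [d' [K'0 d'0 Hg]]].
exists (K * K'), (Num.min d d'); split; rewrite ?mulr_ge0 ?lt_min ?d0//.
move=> h; rewrite le_min => /andP[hd hd']; rewrite normrM exprD mulrACA.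
by rewrite ler_pM ?Hf ?Hg.
Qed.

Lemma bigOS m f : bigO m.+1 f -> bigO m f.
Proof.
move=> [K [d [K0 d0 Hf]]]; exists (K * d), d; split; rewrite ?mulr_ge0 ?(ltW d0)//.
move=> h hd; apply: le_trans (Hf _ hd) _; rewrite exprS mulrA ler_wpM2r ?exprn_ge0 ?nm_ge0//.
by rewrite ler_wpM2l.
Qed.

Lemma bigO_cst (c : R) : bigO 0 (fun=> c).
Proof. by exists `|c|, 1; split => // h _; rewrite expr0 mulr1. Qed.

Lemma bigO_lin L : bigO 1 (lin L).
Proof. by have [K K0 HK] := lin_bound L; exists K, 1; split. Qed.

Lemma bigO_quad H : bigO 2 (quad H).
Proof. by have [K K0 HK] := quad_bound H; exists K, 1; split. Qed.

Lemma o2_bigO f : o2 f -> bigO 2 f.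
Proof. by move=> /(_ 1 ltr01)[d d0 Hd]; exists 1, d; split. Qed.

Lemma bigO_o2 f : bigO 3 f -> o2 f.
Proof.
move=> [K [d [K0 d0 Hf]]] e e0; have K1 : 0 < K + 1 by lra.
exists (Num.min d (e / (K + 1))); first by rewrite lt_min d0 divr_gt0.
move=> h; rewrite le_min => /andP[hd he]; apply: le_trans (Hf _ hd) _.
rewrite exprS mulrA ler_wpM2r ?exprn_ge0 ?nm_ge0//.
move: he; rewrite ler_pdivlMr// mulrC => he; apply: le_trans he.
by rewrite ler_wpM2r ?nm_ge0//; lra.
Qed.

Lemma o2D f g : o2 f -> o2 g -> o2 (fun h => f h + g h).
Proof.
move=> Hf Hg e e0; have e2 : 0 < e / 2 by lra.
have [d d0 Hd] := Hf _ e2; have [d' d'0 Hd'] := Hg _ e2.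
exists (Num.min d d'); first by rewrite lt_min d0.
move=> h; rewrite le_min => /andP[hd hd']; apply: le_trans (ler_normD _ _) _.
by have := Hd _ hd; have := Hd' _ hd'; lra.
Qed.

Lemma o2M f g : o2 f -> bigO 0 g -> o2 (fun h => f h * g h).
Proof.
move=> Hf [K [d [K0 d0 Hg]]] e e0; have K1 : 0 < K + 1 by lra.
have [d' d'0 Hd'] := Hf _ (divr_gt0 e0 K1).
exists (Num.min d d'); first by rewrite lt_min d0.
move=> h; rewrite le_min => /andP[hd hd']; rewrite normrM.
have -> : e * nm h ^+ 2 = e / (K + 1) * nm h ^+ 2 * (K + 1).
  by rewrite [in RHS]mulrAC divfK// gt_eqF.
rewrite ler_pM ?Hd'//; have := Hg _ hd; rewrite expr0; lra.
Qed.

Lemma eq_o2 f g : f =1 g -> o2 f -> o2 g.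
Proof. by move=> /funext ->. Qed.

Lemma o2_0 : o2 (fun=> 0).
Proof.
move=> e e0; exists 1 => // h _; rewrite normr0 mulr_ge0 ?exprn_ge0 ?nm_ge0//; exact: ltW.
Qed.

(* Only the symmetric part of [H] matters; it is not required to be symmetric. *)
Definition jet (f : mat -> R) (th : mat) (c : R) L H :=
  o2 (fun h => f (th + h) - (c + lin L h + quad H h / 2)).

Lemma jet_value f th c L H : jet f th c L H -> c = f th.
Proof.
move=> /(_ 1 ltr01)[d d0 /(_ 0)].
have n0 : nm (0 : mat) = 0.
  by rewrite /nm /sq big1 ?sqrtr0// => k _; rewrite mxE expr0n.
rewrite n0 (ltW d0) => /(_ isT).
have -> : lin L 0 = 0 by rewrite /lin big1// => k _; rewrite mxE mulr0.
have -> : quad H 0 = 0.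
  by rewrite /quad big1// => k _; rewrite big1// => l _; rewrite !mxE !mulr0.
rewrite addr0 expr0n mulr0 mul0r !addr0 normr_le0 subr_eq0 => /eqP ->.
by [].
Qed.

Lemma eq_jet_near f g th c L H : (exists2 d, 0 < d & forall h, nm h <= d -> f (th + h) = g (th + h)) ->
  jet f th c L H -> jet g th c L H.
Proof.
move=> [d d0 fg] Hf e e0; have [d' d'0 Hd'] := Hf _ e0.
exists (Num.min d d'); first by rewrite lt_min d0.
by move=> h; rewrite le_min => /andP[hd hd']; rewrite -fg// Hd'.
Qed.

Lemma eq_jet f th c c' L L' H H' : c = c' -> L =1 L' -> H =2 H' ->
  jet f th c L H -> jet f th c' L' H'.
Proof.
move=> -> /funext -> HH; suff -> : H = H' by [].
by apply/funext => k; apply/funext => l; exact: HH.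
Qed.

Lemma jet_cst (c : R) th : jet (fun=> c) th c (fun=> 0) (fun _ _ => 0).
Proof.
apply: (eq_o2 _ o2_0) => h; rewrite /lin /quad.
rewrite big1 => [|k _]; last by rewrite mul0r.
rewrite big1 => [|k _]; last by rewrite big1// => l _; rewrite mul0r.
by rewrite mul0r !addr0 subrr.
Qed.

Lemma jet_coord (j : idx) th :
  jet (fun X => X j.1 j.2) th (th j.1 j.2) (fun k => (k == j)%:R) (fun _ _ => 0).
Proof.
apply: (eq_o2 _ o2_0) => h; rewrite /lin /quad (bigD1 j)//= eqxx mul1r.
rewrite big1 => [|k /negbTE ->]; last by rewrite mul0r.
rewrite big1 => [|k _]; last by rewrite big1// => l _; rewrite mul0r.
by rewrite mxE; ring.
Qed.

Lemma jetD f g th c c' L L' H H' : jet f th c L H -> jet g th c' L' H' ->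
  jet (fun X => f X + g X) th (c + c') (fun k => L k + L' k) (fun k l => H k l + H' k l).
Proof.
move=> Hf Hg; apply: eq_o2 (o2D Hf Hg) => h.
by rewrite linD quadD; field.
Qed.

Lemma jetM f g th c c' L L' H H' : jet f th c L H -> jet g th c' L' H' ->
  jet (fun X => f X * g X) th (c * c') (fun k => c * L' k + c' * L k)
   (fun k l => c * H' k l + c' * H k l + (L k * L' l + L' k * L l)).
Proof.
move=> Hf Hg; pose P h := c + lin L h + quad H h / 2; pose P' h := c' + lin L' h + quad H' h / 2.
pose r h := f (th + h) - P h; pose r' h := g (th + h) - P' h.
have O1 L0 : bigO 0 (lin L0) by apply/bigOS/bigO_lin.
have O2 H0 : bigO 0 (quad H0) by do 2 apply/bigOS; exact: bigO_quad.
have OP : bigO 0 P.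
  apply: bigOD; first by apply: bigOD; [exact: bigO_cst|].
  exact: (bigOM (O2 H) (bigO_cst _)).
have OP' : bigO 0 P'.
  apply: bigOD; first by apply: bigOD; [exact: bigO_cst|].
  exact: (bigOM (O2 H') (bigO_cst _)).
have Or' : bigO 0 r' by do 2 apply/bigOS; exact: o2_bigO.
(* The product minus its jet is [r (P' + r') + r' P] plus the terms of degree three and four in
   [P P']. *)
have A1 : o2 (fun h => r h * (P' h + r' h)) by apply: o2M => //; exact: bigOD.
have A2 : o2 (fun h => r' h * P h) by apply: o2M.
have A3 : o2 (fun h => lin L h * (quad H' h * 2^-1)).
  apply/bigO_o2/(@bigOM 1 2); first exact: bigO_lin.
  exact: (@bigOM 2 0 _ _ (bigO_quad _) (bigO_cst _)).
have A4 : o2 (fun h => lin L' h * (quad H h * 2^-1)).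
  apply/bigO_o2/(@bigOM 1 2); first exact: bigO_lin.
  exact: (@bigOM 2 0 _ _ (bigO_quad _) (bigO_cst _)).
have A5 : o2 (fun h => quad H h * (quad H' h * 4^-1)).
  apply/bigO_o2/bigOS/(@bigOM 2 2); first exact: bigO_quad.
  exact: (@bigOM 2 0 _ _ (bigO_quad _) (bigO_cst _)).
apply: eq_o2 (o2D (o2D (o2D A1 A2) (o2D A3 A4)) A5) => h.
rewrite linD !linZl !quadD !quadZl !quad_tensor.
by rewrite /r /r' /P /P'; field.
Qed.

Lemma jet_comp g f th c L H g0 g1 g2 : jet f th c L H -> jet1 g c g0 g1 g2 ->
  jet (g \o f) th g0 (fun k => g1 * L k) (fun k l => g1 * H k l + g2 * (L k * L l)).
Proof.
move=> Hf Hg; pose u h := f (th + h) - c.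
pose r h := f (th + h) - (c + lin L h + quad H h / 2).
have Or : o2 r by [].
have OH : bigO 2 (fun h => quad H h * 2^-1).
  exact: (@bigOM 2 0 _ _ (bigO_quad _) (bigO_cst _)).
have Ov : bigO 2 (fun h => quad H h * 2^-1 + r h) by apply: bigOD => //; exact: o2_bigO.
have Ou : bigO 1 u.
  have := bigOD (bigO_lin L) (bigOS Ov); congr (bigO 1); apply/funext => h.
  by rewrite /u /r; ring.
have A1 : o2 (fun h => g (c + u h) - (g0 + g1 * u h + g2 / 2 * u h ^+ 2)).
  move=> e e0; have [K [d [K0 d0 HK]]] := Ou.
  have K1 : 0 < K + 1 by lra.
  have [d' d'0 Hd'] := Hg _ (divr_gt0 e0 (exprn_gt0 2 K1)).
  exists (Num.min d (d' / (K + 1))); first by rewrite lt_min d0 divr_gt0.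
  move=> h; rewrite le_min ler_pdivlMr// => /andP[hd hd'].
  have uK : `|u h| <= (K + 1) * nm h.
    apply: le_trans (HK _ hd) _; rewrite expr1 ler_wpM2r ?nm_ge0//; lra.
  have ud : `|u h| <= d' by apply: le_trans uK _; rewrite mulrC.
  apply: le_trans (Hd' _ ud) _.
  have usq : u h ^+ 2 <= ((K + 1) * nm h) ^+ 2.
    rewrite -[X in X <= _]real_normK ?num_real//.
    by rewrite ler_sqr ?nnegrE ?mulr_ge0 ?nm_ge0// ltW.
  have -> : e * nm h ^+ 2 = e / (K + 1) ^+ 2 * ((K + 1) * nm h) ^+ 2.
    by field; rewrite gt_eqF.
  by rewrite ler_wpM2l// divr_ge0 ?exprn_ge0 ?ltW.
have A2 : o2 (fun h => r h * g1) by apply: o2M => //; exact: bigO_cst.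
(* The second derivative contributes [u^2 - (lin L)^2 = (u - lin L) (u + lin L)], with a first
   factor of order two and a second of order one. *)
have A3 : o2 (fun h => (quad H h * 2^-1 + r h) * ((u h + lin L h) * (g2 / 2))).
  apply/bigO_o2/(@bigOM 2 1) => //; apply: (@bigOM 1 0); last exact: bigO_cst.
  by apply: bigOD => //; exact: bigO_lin.
apply: eq_o2 (o2D A1 (o2D A2 A3)) => h /=.
rewrite linZl quadD !quadZl quad_tensor.
have -> : f (th + h) = c + u h by rewrite /u; ring.
have -> : r h = u h - lin L h - quad H h / 2 by rewrite /r /u; ring.
by field.
Qed.

Lemma jet_sum (I : Type) (s : seq I) (f : I -> mat -> R) th (c : I -> R)
    (L : I -> idx -> R) (H : I -> idx -> idx -> R) :
  (forall i, jet (f i) th (c i) (L i) (H i)) ->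
  jet (fun X => \sum_(i <- s) f i X) th (\sum_(i <- s) c i)
    (fun k => \sum_(i <- s) L i k) (fun k l => \sum_(i <- s) H i k l).
Proof.
move=> Hf; elim: s => [|i s IH].
  have := jet_cst 0 th; congr jet; try apply/funext => X; rewrite ?big_nil//.
  by apply/funext => l; rewrite big_nil.
have := jetD (Hf i) IH; congr jet; try apply/funext => X; rewrite ?big_cons//.
by apply/funext => l; rewrite big_cons.
Qed.

Definition has_jet f th := exists c L H, jet f th c L H.

Lemma has_jet_sum (I : Type) (s : seq I) (f : I -> mat -> R) th :
  (forall i, has_jet (f i) th) -> has_jet (fun X => \sum_(i <- s) f i X) th.
Proof.
move=> hf; elim: s => [|i s [c [L [H Hs]]]].
  exists 0, (fun=> 0), (fun _ _ => 0); under eq_fun do rewrite big_nil; exact: jet_cst.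
have [c' [L' [H' Hi]]] := hf i; under eq_fun do rewrite big_cons.
by do 3 eexists; exact: (jetD Hi Hs).
Qed.

Lemma has_jetM f g th : has_jet f th -> has_jet g th -> has_jet (fun X => f X * g X) th.
Proof.
by move=> [? [? [? Hf]]] [? [? [? Hg]]]; do 3 eexists; exact: (jetM Hf Hg).
Qed.

Lemma has_jet_prod (I : Type) (s : seq I) (f : I -> mat -> R) th :
  (forall i, has_jet (f i) th) -> has_jet (fun X => \prod_(i <- s) f i X) th.
Proof.
move=> hf; elim: s => [|i s IH].
  exists 1, (fun=> 0), (fun _ _ => 0); under eq_fun do rewrite big_nil; exact: jet_cst.
by under eq_fun do rewrite big_cons; exact: has_jetM.
Qed.

(** A jet with unknown coefficients is pinned down along [E] by any expansion with quadratic error: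
    comparing the two, the gap between [lin L E] and [b] is at most a fixed multiple of every small
    [t > 0]. This replaces differentiating the determinant. *)
Lemma jet_dir f th c L H (E : mat) (b K : R) : jet f th c L H ->
  (forall t, `|t| <= 1 -> `|f (th + t *: E) - (f th + b * t)| <= K * t ^+ 2) ->
  lin L E = b.
Proof.
move=> Hf HE; have cE := jet_value Hf.
have [d d0 Hd] := Hf 1 ltr01; have [K' K'0 HK'] := quad_bound H.
pose D := lin L E - b; pose M := `|K| + nm E ^+ 2 + K' * nm E ^+ 2.
have M0 : 0 <= M by rewrite !addr_ge0 ?mulr_ge0 ?exprn_ge0 ?nm_ge0.
have small t : 0 < t -> t <= 1 -> t * nm E <= d -> `|D| <= M * t.
  move=> t0 t1 td; have ta : `|t| = t by rewrite gtr0_norm.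
  have h1 := HE t; rewrite ta t1 in h1; have {}h1 := h1 isT.
  have h2 := Hd (t *: E); rewrite nmZ ta td in h2; have {}h2 := h2 isT.
  rewrite linZ quadZ exprMn mul1r in h2.
  rewrite -(ler_pM2l t0).
  have h3 := HK' E.
  have -> : t * `|D| = `|t * D| by rewrite normrM ta.
  have -> : t * D = (f (th + t *: E) - (f th + b * t))
      - (f (th + t *: E) - (c + t * lin L E + t ^+ 2 * quad H E / 2)) - t ^+ 2 * quad H E / 2.
    by rewrite /D cE; ring.
  apply: le_trans (ler_normB _ _) _.
  have h4 : `|t ^+ 2 * quad H E / 2| <= t ^+ 2 * (K' * nm E ^+ 2).
    rewrite -mulrA normrM ger0_norm ?sqr_ge0// ler_wpM2l ?sqr_ge0//.
    rewrite normrM; apply: le_trans h3; rewrite -[leRHS]mulr1 ler_wpM2l//.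
    by rewrite ger0_norm; lra.
  have h5 := ler_normB (f (th + t *: E) - (f th + b * t))
      (f (th + t *: E) - (c + t * lin L E + t ^+ 2 * quad H E / 2)).
  have h6 : K * t ^+ 2 <= `|K| * t ^+ 2 by rewrite ler_wpM2r ?sqr_ge0// ler_norm.
  rewrite /M (_ : t * (_ * t) = t ^+ 2 * (`|K| + nm E ^+ 2 + K' * nm E ^+ 2)); last by ring.
  rewrite !mulrDr; move: h1 h2 h4 h5 h6; rewrite (mulrC (`|K|)) (mulrC K); lra.
apply/eqP; rewrite -subr_eq0 -normr_eq0; apply/eqP/le_anti; rewrite normr_ge0 andbT -/D.
rewrite leNgt; apply/negP => Dpos.
(* [t] meets three demands: [t <= 1], [t *: E] within the range of the jet, and [M t <= |D| / 2].
   The added ones keep the denominators positive. *)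
pose t := Num.min 1 (Num.min (d / (nm E + 1)) (`|D| / (2 * (M + 1)))).
have nE := nm_ge0 E; have nE1 : 0 < nm E + 1 by lra.
have M1 : 0 < 2 * (M + 1) by lra.
have t0 : 0 < t by rewrite !lt_min ltr01 !divr_gt0.
have t1 : t <= 1 by rewrite ge_min lexx.
have t2 : t * (nm E + 1) <= d.
  by rewrite -ler_pdivlMr// !ge_min lexx orbT.
have t3 : t * (2 * (M + 1)) <= `|D|.
  by rewrite -ler_pdivlMr// !ge_min lexx !orbT.
have := small t t0 t1; have -> : t * nm E <= d by apply: le_trans t2; rewrite ler_wpM2l ?ltW//; lra.
move=> /(_ isT) h; have := mulr_ge0 M0 (ltW t0); move: t3 h Dpos; nra.
Qed.

End jets.

(** * Jets of the priors and the limit matrix *)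

Section prior_jets.
Context {R : realType} {n p : nat}.
Local Notation mat := 'M[R]_(n, p).
Local Notation idx := ('I_n * 'I_p)%type.
Implicit Types (X h : mat) (i j : 'I_p) (gamma : 'I_p -> R).

Definition colsq (i : 'I_p) X : R := \sum_a X a i ^+ 2.
Definition logdet X : R := ln (\det (X^T *m X)).
Let kk : R := (n - p - 1)%N%:R.

Lemma jetZ (a : R) f (th : mat) c L H : jet f th c L H ->
  jet (fun X => a * f X) th (a * c) (fun k => a * L k) (fun k l => a * H k l).
Proof.
move=> Hf; have := o2M Hf (bigO_cst a); apply: eq_o2 => h.
by rewrite linZl quadZl; ring.
Qed.

Lemma jet_near_gt0 f (th : mat) (c : R) L H : jet f th c L H -> 0 < c ->
  exists2 d, 0 < d & forall h, nm h <= d -> 0 < f (th + h).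
Proof.
move=> Hf c0.
have OH : bigO 2 (fun h => quad H h * 2^-1).
  exact: (@bigOM _ _ _ 2 0 _ _ (bigO_quad _) (bigO_cst _)).
have Ov : bigO 1 (fun h => f (th + h) - c).
  have := bigOD (bigO_lin L) (bigOS (bigOD OH (o2_bigO Hf))).
  by congr (bigO 1); apply/funext => h; ring.
have [K [d [K0 d0 HK]]] := Ov; have K1 : 0 < K + 1 by lra.
exists (Num.min d (c / (2 * (K + 1)))); first by rewrite lt_min d0 divr_gt0// mulr_gt0.
move=> h; rewrite le_min ler_pdivlMr ?mulr_gt0// => /andP[hd hc].
have := HK _ hd; rewrite expr1 ler_norml => /andP[h1 _].
have := nm_ge0 h; nra.
Qed.

(** The Leibniz formula makes the determinant a polynomial, so some jet exists. Its gradient is then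
    read off from column operations, and its Hessian cancels between the two priors. *)
Lemma has_jet_det (th : mat) : has_jet (fun X : mat => \det (X^T *m X)) th.
Proof.
apply: has_jet_sum => s; apply: has_jetM.
  by do 3 eexists; exact: jet_cst.
apply: has_jet_prod => i.
rewrite (_ : (fun X : mat => _) = (fun X : mat => \sum_a X a i * X a (s i))).
  apply: has_jet_sum => a; apply: has_jetM.
    by do 3 eexists; exact: (jet_coord (a, i)).
  by do 3 eexists; exact: (jet_coord (a, s i)).
by apply/funext => X; rewrite mxE; apply: eq_bigr => a _; rewrite mxE.
Qed.

Lemma sum_col i (F : idx -> R) : \sum_(k : idx) (k.2 == i)%:R * F k = \sum_a F (a, i).
Proof.
transitivity (\sum_(k : idx) (k.2 == i)%:R * F (k.1, k.2)); first by apply: eq_bigr => -[].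
rewrite -(pair_bigA _ (fun a j => (j == i)%:R * F (a, j)))/=; apply: eq_bigr => a _.
rewrite (bigD1 i)//= eqxx mul1r big1 ?addr0// => j /negbTE ->.
by rewrite mul0r.
Qed.

Lemma jet_colsq i (th : mat) : jet (colsq i) th (colsq i th)
  (fun k => (k.2 == i)%:R * (2 * th k.1 k.2)) (fun k l => (k.2 == i)%:R * (2 * (k == l)%:R)).
Proof.
apply: (eq_o2 _ o2_0) => h.
have -> : lin (fun k => (k.2 == i)%:R * (2 * th k.1 k.2)) h = \sum_a 2 * th a i * h a i.
  by rewrite -(sum_col i (fun k => 2 * th k.1 k.2 * h k.1 k.2)); apply: eq_bigr => k _ /=; ring.
have -> : quad (fun k l => (k.2 == i)%:R * (2 * (k == l)%:R)) h = \sum_a 2 * h a i ^+ 2.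
  rewrite -(sum_col i (fun k => 2 * h k.1 k.2 ^+ 2)); apply: eq_bigr => k _.
  rewrite (bigD1 k)//= big1 => [|l /negbTE kl]; last by rewrite [k == l]eq_sym kl !mulr0 mul0r.
  by rewrite eqxx /=; ring.
rewrite /colsq mulr_suml -!big_split /= -sumrB big1// => a _.
by rewrite mxE; field.
Qed.

(** Gradient at [th] of [\sum_i - (gamma i / 2) * ln (colsq i X)], the logarithm of the column-norm
    factor; [etaH] is its Hessian. *)
Definition etaL gamma (th : mat) (k : idx) : R :=
  - (gamma k.2 / colsq k.2 th) * th k.1 k.2.

Definition etaH gamma (th : mat) (k l : idx) : R :=
  - (gamma k.2 / colsq k.2 th) * (k == l)%:R +
  (k.2 == l.2)%:R * (2 * gamma k.2 / colsq k.2 th ^+ 2 * (th k.1 k.2 * th l.1 l.2)).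

Lemma jet_eta gamma (th : mat) : (forall i, 0 < colsq i th) ->
  jet (fun X => \sum_i - (gamma i / 2) * ln (colsq i X)) th
   (\sum_i - (gamma i / 2) * ln (colsq i th)) (etaL gamma th) (etaH gamma th).
Proof.
move=> S0.
have J i := jetZ (- (gamma i / 2)) (jet_comp (jet_colsq i th) (jet1_ln (S0 i))).
apply: eq_jet (jet_sum (index_enum _) J) => //.
- move=> [a i]; rewrite (bigD1 i)//= eqxx big1 => [|j /negbTE]; last first.
    by rewrite eq_sym => ->; rewrite !(mul0r, mulr0).
  by rewrite /etaL /=; field; rewrite gt_eqF.
- move=> [a i] [b j]; rewrite (bigD1 i)//= eqxx big1 => [|l /negbTE]; last first.
    by rewrite eq_sym => ->; rewrite !(mul0r, mulr0, addr0).
  rewrite /etaH /= [j == i]eq_sym; case: ((a, i) == (b, j)); case: (i == j);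
    by field; rewrite gt_eqF.
Qed.

(** Adding [t] times column [j] to column [i] multiplies [th] on the right by an elementary matrix
    of determinant [1 + t delta_ij]. *)
Lemma det_col_op i j (t : R) (th : mat) :
  \det ((th + t *: (th *m delta_mx j i))^T *m (th + t *: (th *m delta_mx j i))) =
  (1 + t * (i == j)%:R) ^+ 2 * \det (th^T *m th).
Proof.
have -> : th + t *: (th *m delta_mx j i) = th *m (1%:M + t *: delta_mx j i).
  by rewrite mulmxDr mulmx1 scalemxAr.
rewrite trmx_mul -mulmxA (mulmxA th^T) !det_mulmx det_tr.
suff -> : \det (1%:M + t *: delta_mx j i) = 1 + t * (i == j)%:R :> R by ring.
transitivity (\det (\matrix_(a, b) if a == j then (j == b)%:R + t * (b == i)%:R else (a == b)%:R) : R).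
  2: by rewrite det_row_subst eqxx eq_sym.
congr (\det _); apply/matrixP => a b; rewrite !mxE.
have [->|ab] := eqVneq a j; first by [].
by rewrite /= mulr0 addr0.
Qed.

Lemma prior_expR gamma X : 0 < \det (X^T *m X) -> (forall i, 0 < colsq i X) ->
  piMSVS2 gamma X = expR (- (kk / 2) * logdet X + \sum_i - (gamma i / 2) * ln (colsq i X)).
Proof.
move=> d0 S0; rewrite expRD expR_sum /piMSVS2 /piSVS /powR gt_eqF//; congr (_ * _).
apply: eq_bigr => i _; rewrite -/(powR _ _) /colnorm -powR12_sqrt ?sumr_ge0//; last first.
  by move=> a _; rewrite sqr_ge0.
rewrite -powRrM /powR gt_eqF ?S0//; by congr expR; rewrite -/(colsq i X); field.
Qed.

Lemma colsq_gt0 X i : X^T *m X \in unitmx -> 0 < colsq i X.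
Proof.
move=> u; rewrite lt_neqAle sumr_ge0 ?andbT; last by move=> a _; rewrite sqr_ge0.
apply/negP => /eqP/esym S0; move: u; rewrite unitmxE unitfE => /negP; apply.
have X0 a : X a i = 0.
  by apply/eqP; rewrite -sqrf_eq0; apply/eqP/(psumr_eq0P _ S0) => // b _; rewrite sqr_ge0.
rewrite (expand_det_row _ i) big1// => j _; rewrite mxE big1 ?mul0r// => a _.
by rewrite mxE X0 mul0r.
Qed.

Lemma near_all (I : finType) (P : I -> mat -> Prop) :
  (forall i : I, exists2 d, 0 < d & forall h, nm h <= d -> P i h) ->
  exists2 d : R, 0 < d & forall h, nm h <= d -> forall i : I, P i h.
Proof.
move=> HP; suff [d d0 Hd] : exists2 d : R, 0 < d &
    forall h, nm h <= d -> forall i : I, i \in enum I -> P i h.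
  by exists d => // h hd i; apply: Hd => //; rewrite mem_enum.
elim: (enum I) => [|i s [d d0 Hd]]; first by exists 1.
have [d' d'0 Hd'] := HP i; exists (Num.min d d'); first by rewrite lt_min d0.
move=> h; rewrite le_min => /andP[hd hd'] l; rewrite in_cons => /orP[/eqP ->|ls].
  exact: Hd'.
exact: Hd.
Qed.

(* The log-gradient [l0] of the SVS prior is only needed through its inner
   products with the columns of [th], which come from the invariance of the
   determinant under column operations. *)
Lemma prior_jets (th : mat) : th^T *m th \in unitmx ->
  exists (l0 : idx -> R) (k0 : idx -> idx -> R),
   (forall i j, \sum_a l0 (a, i) * th a j = - kk * (i == j)%:R) /\
   forall gamma, 0 < piMSVS2 gamma th /\
    jet (piMSVS2 gamma) th (piMSVS2 gamma th)
     (fun k => piMSVS2 gamma th * (l0 k + etaL gamma th k))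
     (fun k l => piMSVS2 gamma th * (k0 k l + etaH gamma th k l +
         (l0 k + etaL gamma th k) * (l0 l + etaL gamma th l))).
Proof.
move=> u; have d0 := det_gram_gt0 u; have S0 i := colsq_gt0 i u.
have [c [L [H Jd]]] := has_jet_det th; have cE := jet_value Jd; rewrite /= in cE.
have c0 : 0 < c by rewrite cE.
have Jl := jetZ (- (kk / 2)) (jet_comp Jd (jet1_ln c0)).
eexists; eexists; split; last first.
  move=> gamma; have p0 : 0 < piMSVS2 gamma th by rewrite prior_expR// expR_gt0.
  split => //; have J := jet_comp (jetD Jl (jet_eta gamma S0)) (jet1_expR _).
  have [d1 d10 Hd1] := jet_near_gt0 Jd c0.
  have [d2 d20 Hd2] := near_all (fun i => jet_near_gt0 (jet_colsq i th) (S0 i)).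
  apply: eq_jet_near (eq_jet _ _ _ J).
  - exists (Num.min d1 d2); first by rewrite lt_min d10.
    by move=> h; rewrite le_min => /andP[h1 h2]; rewrite prior_expR//; [exact: Hd1|exact: Hd2].
  - by rewrite prior_expR// /logdet cE.
  - by move=> k; rewrite prior_expR// /logdet -cE.
  - by move=> k l; rewrite prior_expR// /logdet -cE -mulrDr.
move=> i j /=; under eq_bigr do rewrite -!mulrA.
rewrite -!mulr_sumr.
have -> : \sum_a L (a, i) * th a j = 2 * (i == j)%:R * c.
  (* The sum is the derivative of the determinant when column [i] moves in the direction of column
     [j]; the exact formula for that move has a quadratic term with coefficient at most [c]. *)
  have <- : lin L (th *m delta_mx j i) = \sum_a L (a, i) * th a j.
    rewrite -(sum_col i (fun k => L k * th k.1 j)); apply: eq_bigr => -[a b] _ /=.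
    rewrite mxE (bigD1 j)//= mxE eqxx /= big1 => [|l /negbTE lj]; last by rewrite mxE lj mulr0.
    by case: (b == i); rewrite ?mulr1 ?mulr0 ?addr0 ?mul1r ?mul0r// ?mulr0.
  apply: (jet_dir (K := c) Jd) => t _; rewrite det_col_op -cE.
  have -> : (1 + t * (i == j)%:R) ^+ 2 * c - (c + 2 * (i == j)%:R * c * t) =
     (i == j)%:R ^+ 2 * (c * t ^+ 2) by ring.
  have ct0 : 0 <= c * t ^+ 2 by exact: mulr_ge0 (ltW c0) (sqr_ge0 t).
  rewrite ger0_norm; last exact: mulr_ge0 (sqr_ge0 _) ct0.
  by case: (i == j); rewrite ?expr1n ?mul1r// expr0n mul0r.
by field; rewrite gt_eqF.
Qed.

End prior_jets.

(** * The limit matrix: identification and sign *)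

Section limit_matrix.
Context {R : realType} {n p : nat}.
Local Notation mat := 'M[R]_(n, p).
Local Notation idx := ('I_n * 'I_p)%type.
Implicit Types (X th : mat) (i j : 'I_p) (gamma : 'I_p -> R).

Lemma colnorm_sqr X i : colnorm X i ^+ 2 = colsq i X.
Proof. by rewrite sqr_sqrtr// sumr_ge0// => a _; rewrite sqr_ge0. Qed.

Lemma limit_mxE gamma th i j : limit_mx gamma th i j =
  - (2 * (p - 1)%N%:R) * (gamma i / colsq i th) * (i == j)%:R +
  gamma i / colsq i th * (gamma j / colsq j th) * \sum_a th a i * th a j.
Proof.
rewrite /limit_mx /Dmat -mulmxA mul_mx_diag -mulmxA mul_diag_mx !mxE.
rewrite colnorm_sqr mulr_natr; congr (_ + _); first by rewrite -mulr_natr; ring.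
rewrite -[RHS]mulrA; congr (_ * _); rewrite mulr_sumr.
by apply: eq_bigr => a _; rewrite !mxE colnorm_sqr; ring.
Qed.

(** On the diagonal, in units of [gamma i / colsq i th], the Hessian terms sum to [2 (2 - n)] and
    the two cross terms to [2 (n - p - 1)], in total [- 2 (p - 1)]. Off the diagonal only the
    product of the two [etaL] survives. *)
Lemma limit_mx_log_jets gamma th (l0 : idx -> R) i j : (p.+1 < n)%N -> (0 < p)%N ->
  (forall i, 0 < colsq i th) ->
  (forall i j, \sum_a l0 (a, i) * th a j = - (n - p - 1)%N%:R * (i == j)%:R) ->
  \sum_a (2 * etaH gamma th (a, i) (a, j) + l0 (a, i) * etaL gamma th (a, j) +
     etaL gamma th (a, i) * l0 (a, j) + etaL gamma th (a, i) * etaL gamma th (a, j)) =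
  limit_mx gamma th i j.
Proof.
move=> pn p0 S0 h0; rewrite limit_mxE.
have e1 : \sum_a l0 (a, i) * etaL gamma th (a, j) =
    gamma j / colsq j th * (n - p - 1)%N%:R * (i == j)%:R.
  transitivity (- (gamma j / colsq j th) * \sum_a l0 (a, i) * th a j).
    by rewrite mulr_sumr; apply: eq_bigr => a _; rewrite /etaL /=; ring.
  by rewrite h0; ring.
have e2 : \sum_a etaL gamma th (a, i) * l0 (a, j) =
    gamma i / colsq i th * (n - p - 1)%N%:R * (i == j)%:R.
  transitivity (- (gamma i / colsq i th) * \sum_a l0 (a, j) * th a i).
    by rewrite mulr_sumr; apply: eq_bigr => a _; rewrite /etaL /=; ring.
  by rewrite h0 eq_sym; ring.
have e3 : \sum_a etaL gamma th (a, i) * etaL gamma th (a, j) =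
    gamma i / colsq i th * (gamma j / colsq j th) * \sum_a th a i * th a j.
  by rewrite mulr_sumr; apply: eq_bigr => a _; rewrite /etaL /=; ring.
have e4 : \sum_a 2 * etaH gamma th (a, i) (a, j) =
    2 * (gamma i / colsq i th) * (2 - n%:R) * (i == j)%:R.
  have [<-|ij] := eqVneq i j; last first.
    rewrite big1 ?mulr0// => a _; rewrite /etaH /= (negbTE ij).
    by rewrite xpair_eqE eqxx (negbTE ij) /= mulr0 mul0r addr0 mulr0.
  transitivity (\sum_(a < n) (- (2 * (gamma i / colsq i th)) + 4 * gamma i / colsq i th ^+ 2 * th a i ^+ 2)).
    by apply: eq_bigr => a _; rewrite /etaH /= !eqxx /=; ring.
  rewrite big_split /= sumr_const card_ord -mulr_sumr -/(colsq i th) -mulr_natr.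
  by field; rewrite gt_eqF.
rewrite !big_split /= e1 e2 e3 e4.
have -> : (n - p - 1)%N%:R = n%:R - p%:R - 1 :> R.
  rewrite natrB ?natrB//; [by rewrite ltnW// ltnW|].
  by rewrite leq_subRL ?addn1 ltnW// ltnW.
have -> : (p - 1)%N%:R = p%:R - 1 :> R by rewrite natrB.
have [->|ij] := eqVneq i j; last by rewrite !mulr0 !add0r.
by ring.
Qed.

(** With [w = D v] the form is [|th w|^2 - 2 (p - 1) / g * \sum_i w_i^2 |th_i|^2]. Cauchy-Schwarz
    over the [p] columns bounds the first term by [p * \sum_i w_i^2 |th_i|^2], and [g < 2 - 2 / p]
    says exactly that [p < 2 (p - 1) / g]. *)
Lemma limit_mx_neg gamma (g : R) th (v : 'cV[R]_p) : (1 < p)%N ->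
  0 < g < 2 - 2 / p%:R -> (forall i, gamma i = g) -> (forall i, 0 < colsq i th) ->
  v != 0 -> (v^T *m limit_mx gamma th *m v) 0 0 < 0.
Proof.
move=> p1 /andP[g0 g2] gE S0 v0.
pose w i := v i 0 * (g / colsq i th).
have p0 : 0 < p%:R :> R by rewrite ltr0n ltnW.
have -> : (v^T *m limit_mx gamma th *m v) 0 0 =
   - (2 * (p%:R - 1) / g) * (\sum_i w i ^+ 2 * colsq i th) + \sum_a (\sum_i w i * th a i) ^+ 2.
  transitivity (\sum_i \sum_j (- (2 * (p%:R - 1) / g) * ((i == j)%:R * (w i * w j * colsq i th)) +
      \sum_a (w i * th a i) * (w j * th a j))).
    rewrite mxE exchange_big /=; apply: eq_bigr => j _; rewrite mxE mulr_suml.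
    apply: eq_bigr => i _; rewrite mxE limit_mxE !gE natrB ?(ltnW p1)//.
    under [in RHS]eq_bigr => a _ do rewrite mulrACA.
    rewrite -mulr_sumr /w; have [->|ij] := eqVneq i j.
      by field; rewrite !gt_eqF.
    by rewrite mul0r !mulr0 !add0r; ring.
  under eq_bigr do rewrite big_split /=.
  rewrite big_split /=; congr (_ + _).
    rewrite mulr_sumr; apply: eq_bigr => i _; rewrite -mulr_sumr (bigD1 i)//= eqxx big1 ?addr0.
      rewrite mul1r; ring.
    by move=> j ji; rewrite eq_sym (negbTE ji) mul0r.
  under eq_bigr do rewrite exchange_big /=.
  rewrite exchange_big; apply: eq_bigr => a _ /=.
  by rewrite expr2 mulr_suml; apply: eq_bigr => i _; rewrite mulr_sumr.
have W0 : 0 < \sum_i w i ^+ 2 * colsq i th.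
  have [i vi] : exists i, v i 0 != 0.
    apply/existsP; apply: contraNT v0 => /existsPn h; apply/eqP/matrixP => i j.
    by rewrite ord1 mxE; apply/eqP; rewrite -[_ == _]negbK h.
  rewrite (bigD1 i)//= ltr_pwDl//; last first.
    by apply: sumr_ge0 => j _; rewrite mulr_ge0 ?sqr_ge0// ltW.
  rewrite mulr_gt0// lt_neqAle sqr_ge0 andbT eq_sym sqrf_eq0 mulf_neq0//.
  by rewrite gt_eqF// divr_gt0.
have CS : \sum_a (\sum_i w i * th a i) ^+ 2 <= p%:R * \sum_i w i ^+ 2 * colsq i th.
  have cs (x : 'I_p -> R) : (\sum_i x i) ^+ 2 <= p%:R * \sum_i x i ^+ 2.
    rewrite -subr_ge0.
    suff -> : p%:R * \sum_i x i ^+ 2 - (\sum_i x i) ^+ 2 = 2^-1 * \sum_i \sum_j (x i - x j) ^+ 2.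
      by rewrite mulr_ge0// sumr_ge0// => i _; rewrite sumr_ge0// => j _; rewrite sqr_ge0.
    have -> : \sum_i \sum_j (x i - x j) ^+ 2 =
       \sum_i (p%:R * x i ^+ 2 + \sum_j x j ^+ 2 - 2 * (x i * \sum_j x j)).
      apply: eq_bigr => i _.
      have -> : p%:R * x i ^+ 2 = \sum_(j < p) x i ^+ 2 by rewrite sumr_const card_ord mulr_natl.
      rewrite !mulr_sumr -big_split -sumrB; apply: eq_bigr => j _ /=; ring.
    rewrite sumrB big_split /= -!mulr_sumr -mulr_suml sumr_const card_ord -mulr_natl.
    by field.
  apply: le_trans (ler_sum _ (fun a _ => cs _)) _.
  rewrite -mulr_sumr exchange_big /=.
  suff -> : \sum_i \sum_a (w i * th a i) ^+ 2 = \sum_i w i ^+ 2 * colsq i th by [].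
  by apply: eq_bigr => i _; rewrite mulr_sumr; apply: eq_bigr => a _; rewrite exprMn.
set W := \sum_i w i ^+ 2 * colsq i th in W0 CS *.
apply: le_lt_trans (lerD (lexx _) CS) _.
rewrite -mulrDl nmulr_rlt0//.
rewrite addrC subr_lt0 ltr_pdivlMr//.
have : p%:R * g < p%:R * (2 - 2 / p%:R) by rewrite ltr_pM2l.
have -> : p%:R * (2 - 2 / p%:R) = 2 * (p%:R - 1) :> R by field; rewrite gt_eqF.
by [].
Qed.

End limit_matrix.

(** * Integrability of the priors *)

Section singular_1d.
Context {R : realType}.
Local Notation leb := (@lebesgue_measure R).
Local Open Scope ereal_scope.

(* Unlike [powR], which gives [0 `^ (- r) = 0], this is infinite at the singularity. *)
Definition epow (r t : R) : \bar R := if t == 0%R then +oo else (`|t| `^ (- r))%:E.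

Lemma epow_gt0 r t : 0 < epow r t.
Proof.
by rewrite /epow; case: eqVneq => // t0; rewrite lte_fin powR_gt0// normr_gt0.
Qed.

Lemma epow_ge0 r t : 0 <= epow r t. Proof. exact/ltW/epow_gt0. Qed.

Lemma measurable_epow r : measurable_fun setT (epow r).
Proof.
apply: measurable_fun_ifT => //; first exact: measurable_fun_eqr.
apply/measurable_EFinP; apply: (measurableT_comp (measurable_powR (- r))).
exact: normr_measurable.
Qed.

(** The fundamental theorem of calculus on [[1 / (k + 1), 1]], then monotone convergence. The
    endpoint [0], where [epow] is infinite, is first removed as a null set. *)
Lemma integral_powR01 (e : R) : (0 <= e < 1)%R ->
  \int[leb]_(t in `[0%R, 1%R]) epow e t <= ((1 - e)^-1)%:E.
Proof.
move=> /andP[e0 e1].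
have -> : \int[leb]_(t in `[0%R, 1%R]) epow e t = \int[leb]_(t in `]0%R, 1%R]) epow e t.
  by rewrite -integral_itv_obnd_cbnd//; apply: measurable_funTS; exact: measurable_epow.
pose I k : set R := `[(0 + k.+1%:R^-1)%R, 1%R]%classic.
have -> : `]0%R, 1%R]%classic = \bigcup_k I k by exact: itv_open_bnd_bigcup.
have ndI : nondecreasing_seq I.
  move=> i j ij; apply/subsetPset => t; rewrite /I /= !in_itv /= => /andP[h ->].
  by rewrite andbT; apply: le_trans h; rewrite lerD2l lef_pV2 ?posrE// ler_nat.
have cv : \int[leb]_(x in I i) epow e x @[i --> \oo] --> \int[leb]_(x in \bigcup_i I i) epow e x.
  apply: ge0_nondecreasing_set_cvg_integral => // [i|i|i x _].
  - exact: measurable_itv.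
  - by apply: measurable_funTS; exact: measurable_epow.
  - exact: epow_ge0.
rewrite -(cvg_lim _ cv)//; apply: lime_le; first by apply/cvg_ex; eexists; exact: cv.
apply: nearW => k; rewrite /I; set a := (0 + k.+1%:R^-1)%R.
have a0 : (0 < a)%R by rewrite /a add0r.
have a1 : (a <= 1)%R by rewrite /a add0r invf_le1// ler1n.
(* For [k = 0] the interval is a single point. *)
have [->|a1'] := eqVneq a 1%R.
  by rewrite set_itv1 integral_set1 lee_fin invr_ge0 subr_ge0 ltW.
have {a1'}a1 : (a < 1)%R by rewrite lt_neqAle a1'.
pose F (t : R) : R := ((1 - e)^-1 * (t `^ (1 - e)))%R.
have e1' : (0 < 1 - e)%R by rewrite subr_gt0.
have dF (t : R) : (0 < t)%R -> is_derive t (1 : R)%R F (t `^ (- e))%R.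
  move=> t0; have h := @is_derive1_powR R (1 - e)%R t t0.
  apply: (is_derive_eq (is_deriveZ (1 - e)^-1 h)).
  rewrite /GRing.scale /= mulrA mulVf ?mul1r ?gt_eqF//.
  by congr (_ `^ _)%R; lra.
have cF : {in `[a, 1%R], continuous F}%R.
  move=> t; rewrite in_itv /= => /andP[at_ _].
  apply/differentiable_continuous/derivable1_diffP.
  by apply: ex_derive; apply: dF; exact: lt_le_trans at_.
have cf : {within `[a, 1%R], continuous (fun t : R => t `^ (- e))}%R.
  apply: derivable_within_continuous => t; rewrite in_itv /= => /andP[at_ _].
  by apply: derivable_powR; rewrite in_itv /= andbT; exact: lt_le_trans at_.
have -> : \int[leb]_(t in `[a, 1%R]) epow e t = \int[leb]_(t in `[a, 1%R]) (t `^ (- e))%:E.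
  apply: eq_integral => t /set_mem; rewrite /= in_itv /= => /andP[at_ _].
  have t0 : (0 < t)%R by exact: lt_le_trans at_.
  by rewrite /epow gt_eqF// gtr0_norm.
rewrite (@continuous_FTC2 _ _ F)//.
- rewrite -EFinB lee_fin /F powR1 mulr1 lerBlDr lerDl mulr_ge0 ?powR_ge0//.
  by rewrite invr_ge0 ltW.
- split.
  + move=> t; rewrite in_itv /= => /andP[at_ _]; apply: ex_derive; apply: dF.
    exact: lt_trans at_.
  + by apply: cvg_at_right_filter; apply: cF; rewrite in_itv /= lexx ltW.
  + by apply: cvg_at_left_filter; apply: cF; rewrite in_itv /= lexx ltW.
- move=> t; rewrite in_itv /= => /andP[at_ _].
  have t0 : (0 < t)%R by exact: lt_trans at_.
  by rewrite derive1E; apply: derive_val; exact: dF.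
Qed.

Lemma integral_expR_sqr (c : R) : (0 < c)%R ->
  \int[leb]_t (expR (- c * t ^+ 2))%:E = (Num.sqrt (pi / c))%:E.
Proof.
move=> c0; have s0 : Num.sqrt c != 0%R by rewrite gt_eqF// sqrtr_gt0.
have := @ge0_integral_affine R (fun t => (gauss_fun t)%:E) 0%R (Num.sqrt c) s0.
rewrite integralT_gauss => h.
under eq_integral => t _.
  rewrite (_ : expR _ = gauss_fun (0 + Num.sqrt c * t)); last first.
    by rewrite /gauss_fun add0r exprMn sqr_sqrtr ?ltW// mulNr.
  over.
rewrite h.
- rewrite -EFinM ger0_norm ?sqrtr_ge0// mulrC [in RHS]sqrtrM ?pi_ge0//.
  by rewrite sqrtrV// ltW.
- by apply/measurable_EFinP; exact: measurable_gauss_fun.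
- by move=> t; rewrite lee_fin gauss_fun_ge0.
Qed.

Lemma measurable_expR_sqr (c : R) : measurable_fun setT (fun t : R => expR (- c * t ^+ 2)).
Proof. by apply: measurableT_comp => //; apply: measurable_funM => //; exact: measurable_funX. Qed.

(** The bound has to be uniform in [s], which will be a combination of entries integrated later.
    Where [|t - s| <= 1] the Gaussian is at most 1 and the translated singularity has a fixed
    integral; elsewhere the power is at most 1. *)
Lemma integral_epow_gauss (e c : R) : (0 <= e < 1)%R -> (0 < c)%R ->
  exists2 C : R, (0 < C)%R & forall s : R,
    \int[leb]_t (epow e (t - s) * (expR (- c * t ^+ 2))%:E) <= C%:E.
Proof.
move=> e01 c0; have /andP[e0 e1] := e01.
have e1' : (0 < (1 - e)^-1)%R by rewrite invr_gt0 subr_gt0.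
exists (2 * (1 - e)^-1 + Num.sqrt (pi / c))%R.
  by rewrite ltr_pwDl ?sqrtr_ge0// mulr_gt0.
move=> s.
pose g (t : R) : \bar R := if (0 <= t <= 1)%R then epow e t else 0.
have g0 t : 0 <= g t by rewrite /g; case: ifP => // _; exact: epow_ge0.
have mg : measurable_fun setT g.
  apply: measurable_fun_ifT => //; last exact: measurable_epow.
  by apply: measurable_and; exact: measurable_fun_ler.
have gi : \int[leb]_t g t <= ((1 - e)^-1)%:E.
  apply: le_trans (integral_powR01 e01); rewrite [leRHS]integral_mkcond.
  rewrite le_eqVlt; apply/orP; left; apply/eqP; apply: eq_integral => t _.
  by rewrite patchE /g mem_setE /= in_itv.
have ga (a b : R) : (b = 1 \/ b = -1)%R -> \int[leb]_t g (a + b * t)%R <= ((1 - e)^-1)%:E.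
  move=> hb; have nb : (`|b| = 1)%R by case: hb => ->; rewrite ?normrN normr1.
  rewrite ge0_integral_affine//; first by rewrite nb invr1 mul1e.
  by rewrite -normr_eq0 nb oner_eq0.
have mga (a b : R) : measurable_fun setT (fun t => g (a + b * t)%R).
  by apply: (measurableT_comp mg); apply: measurable_funD => //; apply: measurable_funM.
have mE : measurable_fun setT (fun t : R => (expR (- c * t ^+ 2))%:E).
  by apply/measurable_EFinP; exact: measurable_expR_sqr.
pose G t := (g (- s + 1 * t)%R + g (s + -1 * t)%R) + (expR (- c * t ^+ 2))%:E.
apply: (@le_trans _ _ (\int[leb]_t G t)).
  apply: ge0_le_integral => //.
  - by move=> t _; apply: mule_ge0; [exact: epow_ge0|rewrite lee_fin expR_ge0].
  - apply: emeasurable_funM => //; apply: (measurableT_comp (measurable_epow e)).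
    exact: measurable_funB.
  - apply: emeasurable_funD => //; apply: emeasurable_funD; exact: mga.
  move=> t _; rewrite /G mul1r mulN1r [(- s + t)%R]addrC.
  have E1 : (expR (- c * t ^+ 2) <= 1)%R.
    by rewrite -expR0 ler_expR mulNr oppr_le0 mulr_ge0 ?sqr_ge0// ltW.
  have [h|h] := leP `|t - s|%R 1%R.
    apply: (@le_trans _ _ (epow e (t - s)%R)).
      by rewrite -[leRHS]mule1; apply: lee_wpmul2l; [exact: epow_ge0|rewrite lee_fin].
    rewrite -[leLHS]adde0; apply: leeD; last by rewrite lee_fin expR_ge0.
    move: h; have [h0|h0] := leP 0%R (t - s)%R.
      by rewrite ger0_norm// => h1; rewrite {1}/g h0 h1 leeDl.
    rewrite ltr0_norm// opprB => h1; rewrite {2}/g h1.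
    have -> : (0 <= s - t)%R by rewrite -opprB oppr_ge0 ltW.
    rewrite /= -[leLHS]add0e; apply: leeD => //.
    by rewrite /epow -[(s - t)%R]opprB oppr_eq0 normrN.
  have t0 : (t - s)%R != 0%R by rewrite -normr_gt0 (lt_trans _ h).
  rewrite /epow (negbTE t0) -[leLHS]add0e; apply: leeD; [exact: adde_ge0|rewrite -EFinM lee_fin].
  rewrite -[leRHS]mul1r ler_wpM2r ?expR_ge0//.
  rewrite powRN invf_le1 ?powR_gt0 ?normr_gt0//.
  rewrite -(powRr0 `|t - s|%R) ler_powR// ltW//.
rewrite ge0_integralD//; last 2 first.
- by move=> t _; exact: adde_ge0.
- by apply: emeasurable_funD; exact: mga.
rewrite ge0_integralD//; try exact: mga.
rewrite integral_expR_sqr// EFinD; apply: leeD => //.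
by rewrite mulr_natl mulr2n EFinD; apply: leeD; apply: ga; auto.
Qed.

End singular_1d.

(** * Integrating products entry by entry *)

Section chain.
Context {R : realType} {n p : nat}.
Local Notation mat := 'M[R]_(n, p).
Local Notation idx := ('I_n * 'I_p)%type.
Local Notation leb := (@lebesgue_measure R).
Local Open Scope ereal_scope.
Implicit Types (F : mat -> \bar R) (A X : mat) (s : seq idx).

(** The comparison is asked only of matrices that agree with [A] off [s], because the pivot rows and
    coefficients are chosen from the columns of [A] that stay fixed. *)
Lemma le_eiint_loc s F G A : (forall X, 0 <= F X) -> (forall X, 0 <= G X) ->
  measurable_fun setT F -> measurable_fun setT G ->
  (forall X, (forall k, k \notin s -> X k.1 k.2 = A k.1 k.2) -> F X <= G X) ->
  eiint s F A <= eiint s G A.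
Proof.
move=> F0 G0 mF mG; elim: s A => [|k s IH] A FG /=; first exact: FG.
apply: ge0_le_integral => //.
- by move=> t _; exact: eiint_ge0.
- exact: measurable_eiint_upd.
- exact: measurable_eiint_upd.
- move=> t _; apply: IH => X XA; apply: FG => -[a i] /=.
  rewrite in_cons negb_or => /andP[lk ls].
  by rewrite (XA (a, i))// updE (negbTE lk).
Qed.

Lemma eiint_factor s (h G : mat -> \bar R) A : (forall X, 0 <= G X) ->
  measurable_fun setT G -> (forall l X t, l \in s -> h (upd X l t) = h X) ->
  0 <= h A ->
  eiint s (fun X => h X * G X) A = h A * eiint s G A.
Proof.
move=> G0 mG; elim: s A => [//|l s IH] A inv hA /=.
have inv' l' X t : l' \in s -> h (upd X l' t) = h X.
  by move=> ls; apply: inv; rewrite in_cons ls orbT.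
under eq_integral => t _ do rewrite IH// ?inv ?mem_head//.
rewrite ge0_integralZl//.
- exact: measurable_eiint_upd.
- by move=> t _; exact: eiint_ge0.
Qed.

(* Integrating out a product whose [k]-th factor does not depend on the
   variables integrated before the [k]-th one. *)
Lemma eiint_chain s (h : idx -> mat -> \bar R) (C : R) A : uniq s ->
  (forall k X, 0 <= h k X) -> (forall k, measurable_fun setT (h k)) ->
  (0 <= C)%R -> (forall k X, k \in s -> \int[leb]_t h k (upd X k t) <= C%:E) ->
  (forall s1 k s2 l X t, s = s1 ++ k :: s2 -> l \in s2 -> h k (upd X l t) = h k X) ->
  eiint s (fun X => \prod_(k <- s) h k X) A <= (C ^+ size s)%:E.
Proof.
move=> us h0 mh C0 hC inv.
have mp s' : measurable_fun setT (fun X : mat => \prod_(k <- s') h k X).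
  elim: s' => [|k s' IH]; first by (under eq_fun do rewrite big_nil); exact: measurable_cst.
  under eq_fun do rewrite big_cons.
  exact: emeasurable_funM.
have p0 s' X : 0 <= \prod_(k <- s') h k X by apply: prode_ge0 => ? _.
elim: s us A hC inv => [|k s IH] /= us A hC inv; first by rewrite big_nil expr0.
have -> : (fun X : mat => \prod_(j <- k :: s) h j X) = (fun X : mat => h k X * \prod_(j <- s) h j X).
  by apply/funext => X; rewrite big_cons.
under eq_integral => t _.
  rewrite eiint_factor//; last by move=> l X u ls; apply: (inv [::] k s).
  over.
have mk : measurable_fun setT (fun t => h k (upd A k t)).
  by apply: (measurableT_comp (mh k)); apply: measurable_upd.
apply: (@le_trans _ _ (\int[leb]_t (h k (upd A k t) * (C ^+ size s)%:E))).
  apply: ge0_le_integral => //.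
  - by move=> t _; apply: mule_ge0 => //; exact: eiint_ge0.
  - by apply: emeasurable_funM => //; exact: measurable_eiint_upd.
  - exact: emeasurable_funM.
  - move=> t _; apply: lee_wpmul2l => //; apply: IH.
    + by case/andP: us.
    + by move=> j X js; apply: hC; rewrite in_cons js orbT.
    + by move=> s1 j s2 l X u sE; apply: (inv (k :: s1)); rewrite sE.
rewrite ge0_integralZr// ?lee_fin ?exprn_ge0// exprS EFinM.
apply: lee_wpmul2r; first by rewrite lee_fin exprn_ge0.
by apply: hC; exact: mem_head.
Qed.

End chain.

(** * Distributing the singularity of one column over its entries *)

Section column_bound.
Context {R : realType} {n p q : nat}.
Hypotheses (pn : (p.+1 < n)%N) (qp : (q < p)%N).
Variables (M : 'M[R]_(n, q)) (f : 'I_q -> 'I_n) (B : 'M[R]_(n, q)).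
Hypotheses (uG : M^T *m M \in unitmx) (finj : injective f).
Let e : R := (n - 1)%N%:R / n%:R.
Let k : R := (n - p - 1)%N%:R.
Let m : R := (n - q)%N%:R.
Let b : R := (p%:R - q%:R * e) / m.

(* The determinant is bounded below by the geometric mean of the pivot bounds
   over the [m = n - q] rows outside the pivot block; [b] is then the weight for
   which every entry gets the same integrable exponent [e = (n - 1) / n < 1]. *)
Lemma colbound_exponents :
  [/\ 0 <= e < 1, 0 < m, 0 <= k <= m, 0 <= b & k / m + b = e].
Proof.
have n0' : (0 < n)%N by exact: leq_trans pn.
have n0 : 0 < n%:R :> R by rewrite ltr0n.
have nE : (n - 1)%N%:R = n%:R - 1 :> R by rewrite natrB.
have kE : k = n%:R - p%:R - 1.
  rewrite /k natrB ?natrB//; [by rewrite ltnW// ltnW|].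
  by rewrite leq_subRL ?addn1 ltnW// ltnW.
have qn : (q < n)%N by rewrite (leq_trans qp)// ltnW// ltnW.
have mE : m = n%:R - q%:R by rewrite /m natrB// ltnW.
have m0 : 0 < m by rewrite mE subr_gt0 ltr_nat.
have e1 : 0 <= e < 1.
  by rewrite /e divr_ge0 ?ler0n// ltr_pdivrMr// mul1r ltr_nat subn1 prednK//= leqnn.
have q1p : q%:R + 1 <= p%:R :> R by rewrite natr1 ler_nat.
split => //.
- by rewrite {1}/k ler0n /= kE mE; lra.
- rewrite /b; apply: divr_ge0; last exact: ltW.
  rewrite subr_ge0.
  have : q%:R * e <= q%:R by rewrite -[leRHS]mulr1 ler_wpM2l ?ler0n//; case/andP: e1 => _ /ltW.
  by lra.
- rewrite /b -mulrDl kE mE /e nE; field.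
  by rewrite gt_eqF//= -mE gt_eqF.
Qed.

Variable (c : R).
Let y (x : 'cV[R]_n) a := x a 0 - \sum_i B a i * x (f i) 0.
Hypothesis pivot : forall (x : 'cV[R]_n) j, \det (M^T *m M) * y x j ^+ 2 <=
  (1 + q)%:R ^+ 2 * \det ((row_mx x M)^T *m row_mx x M).

Local Open Scope ereal_scope.

(** In a non-pivot row the natural bound is [|y|^(-k/m) |x|^(-b)], with two singularities in one
    variable. As [k/m + b = e], it is at most [|y|^(-e) + |x|^(-e)], where each term has one
    singularity of integrable order; [1 + q] absorbs the constant of [gram_pivot]. *)
Definition colfactor (x : 'cV[R]_n) (a : 'I_n) : \bar R :=
  (if a \in codom f then epow e (x a 0%R)
   else (1 + q)%:R%:E * (epow e (y x a) + epow e (x a 0%R))) *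
  (expR (- c * x a 0%R ^+ 2))%:E.

Lemma colfactor_gt0 x a : 0 < colfactor x a.
Proof.
rewrite /colfactor; apply: mule_gt0; last by rewrite lte_fin expR_gt0.
case: ifP => _; first exact: epow_gt0.
by apply: mule_gt0; rewrite ?lte_fin ?ltr0n// adde_gt0 ?epow_gt0.
Qed.

Lemma prode_pinfty (I : finType) (h : I -> \bar R) : (forall i, 0 < h i) ->
  (exists i, h i = +oo) -> \prod_i h i = +oo.
Proof.
move=> h0 [i hi]; rewrite (bigD1 i)//= hi gt0_mulye//.
by apply: (big_ind (fun x => 0 < x)) => // [x z x0 z0]; exact: mule_gt0.
Qed.

Lemma exists_notin_codom : exists a : 'I_n, a \notin codom f.
Proof.
apply/existsP; rewrite -negb_forall; apply/negP => /forallP h.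
have := card_codom finj; rewrite card_ord => cE.
have : (#|'I_n| <= #|codom f|)%N by apply: subset_leq_card; apply/fintype.subsetP => a _; exact: h.
rewrite cE card_ord leqNgt => /negP; apply.
by rewrite (leq_trans qp)// ltnW// ltnW.
Qed.

(** In logarithms the left side is shared out as [u] per pivot row and [v] per other row. The choice
    of [b] makes [q u + m v] equal to [- k/2 (ln D' - ln D) - p/2 ln S], so the only inequalities
    are the row-wise bounds [gle]. *)
Lemma colfactor_bound (x : 'cV[R]_n) :
  epow (k / 2) (\det ((row_mx x M)^T *m row_mx x M)) *
    (epow (p%:R / 2) (\sum_a x a 0%R ^+ 2) * (expR (- c * \sum_a x a 0%R ^+ 2))%:E) <=
  epow (k / 2) (\det (M^T *m M)) * \prod_a colfactor x a.
Proof.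
set D' := \det _; set S := (\sum_a _)%R; set D := \det _.
have [e01 m0 /andP[k0 km] b0 keq] := colbound_exponents.
have D0 : (0 < D)%R by exact: det_gram_gt0.
(* If an entry, or the residual of a non-pivot row, vanishes, the right side is infinite; otherwise
   all logarithms below are of positive numbers. *)
have [/existsP[a ha]|/existsPn h] :=
    boolP [exists a, (x a 0%R == 0%R) || ((a \notin codom f) && (y x a == 0%R))].
  have -> : \prod_a colfactor x a = +oo.
    apply: prode_pinfty; first exact: colfactor_gt0.
    exists a; rewrite /colfactor; case/orP: ha => [/eqP ->|/andP[/negbTE -> /eqP ->]].
      rewrite /epow eqxx addey; last by case: ifP.
      case: ifP => _; rewrite ?gt0_muley ?lte_fin ?ltr0n// gt0_mulye// lte_fin expR_gt0//.
    rewrite {1}/epow eqxx addye; last by rewrite /epow; case: ifP.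
    by rewrite gt0_muley ?lte_fin ?ltr0n// gt0_mulye// lte_fin expR_gt0.
  by rewrite gt0_muley ?leey//; exact: epow_gt0.
have x0 a : (x a 0 != 0)%R by have := h a; rewrite negb_or => /andP[].
have y0 a : a \notin codom f -> (y x a != 0)%R.
  by move=> ha; have := h a; rewrite negb_or ha /= => /andP[].
have [a0 ha0] := exists_notin_codom.
have D'0 : (0 < D')%R.
  have := pivot x a0; rewrite -/D' -/D => hp.
  have : (0 < (1 + q)%:R ^+ 2 * D')%R.
    by apply: lt_le_trans hp; rewrite mulr_gt0// lt_neqAle sqr_ge0 andbT eq_sym sqrf_eq0 y0.
  by rewrite pmulr_rgt0// exprn_gt0// ltr0n.
have xS a : (x a 0 ^+ 2 <= S)%R.
  rewrite /S (bigD1 a)//= lerDl sumr_ge0// => i _; exact: sqr_ge0.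
have S0 : (0 < S)%R.
  by apply: lt_le_trans (xS a0); rewrite lt_neqAle sqr_ge0 andbT eq_sym sqrf_eq0 x0.
have epE (r t : R) : (0 < t)%R -> epow r t = (expR (- r * ln t))%:E.
  by move=> t0; rewrite /epow gt_eqF// gtr0_norm// /powR gt_eqF.
have epnE (r t : R) : (t != 0)%R -> epow r t = (expR (- r * ln `|t|))%:E.
  by move=> t0; rewrite /epow (negbTE t0) /powR normr_eq0 (negbTE t0).
pose u : R := (- (e / 2) * ln S)%R.
pose v : R := (- (k / (2 * m)) * (ln D' - ln D) - (b / 2) * ln S)%R.
pose g a : R := ((if a \in codom f then u else v) - c * x a 0 ^+ 2)%R.
have lnx a : (2 * ln `|x a 0| <= ln S)%R.
  have nx : (0 < `|x a 0|)%R by rewrite normr_gt0.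
  by rewrite mulr_natl -lnXn// ler_ln ?posrE ?exprn_gt0// real_normK ?num_real.
have gle a : (expR (g a))%:E <= colfactor x a.
  rewrite /g expRD EFinM /colfactor mulNr; apply: lee_wpmul2r.
    by rewrite lee_fin expR_ge0.
  have eub : (u <= - e * ln `|x a 0|)%R.
    by have := lnx a; have /andP[e0 _] := e01; rewrite /u; nra.
  case: ifP => ha; first by rewrite epnE// lee_fin ler_expR.
  rewrite !epnE ?y0 ?ha// -EFinD -EFinM lee_fin.
  have q1 : (0 < 1 + q%:R :> R)%R by rewrite ltr_pwDl// ler0n.
  have ny : (0 < `|y x a|)%R by rewrite normr_gt0 y0// ha.
  have lny : (2 * ln `|y x a| <= ln D' - ln D + 2 * ln (1 + q%:R))%R.
    have := pivot x a; rewrite -/D' -/D natrD => hp.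
    have y2 : (0 < y x a ^+ 2)%R.
      by rewrite lt_neqAle sqr_ge0 andbT eq_sym sqrf_eq0 y0// ha.
    have q2 : (0 < (1 + q%:R : R) ^+ 2)%R by exact: exprn_gt0.
    have lp : (0 < D * y x a ^+ 2)%R by exact: mulr_gt0.
    have rp : (0 < (1 + q%:R) ^+ 2 * D')%R by exact: mulr_gt0.
    move: hp; rewrite -ler_ln ?posrE// (@lnM _ D (y x a ^+ 2)%R) ?posrE// (@lnM _ ((1 + q%:R) ^+ 2)%R D') ?posrE//.
    rewrite -[(y x a ^+ 2)%R]real_normK ?num_real//.
    rewrite !lnXn// !mulr2n; lra.
  have ln1q : (0 <= ln (1 + q%:R : R))%R by rewrite ln_ge0// lerDl ler0n.
  set t := (k / m)%R in keq.
  have t0 : (0 <= t)%R by rewrite divr_ge0// ltW.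
  have t1 : (t <= 1)%R by rewrite ler_pdivrMr// mul1r.
  have vE : v = (- (t / 2) * (ln D' - ln D) - (b / 2) * ln S)%R.
    by rewrite /v /t; field; rewrite gt_eqF.
  have vle : (v <= ln (1 + q%:R) + (- t * ln `|y x a| - b * ln `|x a 0|))%R.
    have h1 : (t * (2 * ln `|y x a|) <= t * (ln D' - ln D + 2 * ln (1 + q%:R)))%R by rewrite ler_wpM2l.
    have h2 : (b * (2 * ln `|x a 0|) <= b * ln S)%R by rewrite ler_wpM2l.
    have h3 : (t * ln (1 + q%:R) <= 1 * ln (1 + q%:R))%R by rewrite ler_wpM2r.
    by rewrite vE; move: h1 h2 h3; rewrite mulrDr; lra.
  apply: (@le_trans _ _ ((1 + q%:R) * expR (- t * ln `|y x a| - b * ln `|x a 0|)))%R.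
    by rewrite -[X in (_ <= X * _)%R]lnK ?posrE// -expRD ler_expR.
  rewrite natrD ler_wpM2l ?(ltW q1)//.
  (* Replacing the larger of the two moduli by the smaller turns the mixed power into a pure one. *)
  have [hxy|hxy] := leP (ln `|x a 0|)%R (ln `|y x a|)%R.
    rewrite -[leLHS]add0r lerD ?expR_ge0// ler_expR.
    by rewrite -keq; have : (t * ln `|x a 0| <= t * ln `|y x a|)%R by [rewrite ler_wpM2l]; lra.
  rewrite -[leLHS]addr0 lerD ?expR_ge0// ler_expR.
  by rewrite -keq; have : (b * ln `|y x a| <= b * ln `|x a 0|)%R by [rewrite ler_wpM2l// ltW]; lra.
have prodle : (expR (\sum_a g a))%:E <= \prod_a colfactor x a.
  rewrite expR_sum -prodEFin.
  suff /andP[] : 0 <= \prod_a (expR (g a))%:E <= \prod_a colfactor x a by [].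
  elim/big_ind2 : _ => [|r1 s1 r2 s2 /andP[h1 h2] /andP[h3 h4]|i _].
  - by rewrite lee01 lexx.
  - by rewrite mule_ge0//= lee_pmul.
  - by rewrite gle lee_fin expR_ge0.
apply: (@le_trans _ _ (epow (k / 2) D * (expR (\sum_a g a))%:E)); last first.
  by apply: lee_wpmul2l => //; exact: epow_ge0.
rewrite !epE// -!EFinM lee_fin -!expRD ler_expR.
have -> : (\sum_a g a = q%:R * u + m * v - c * S)%R.
  rewrite sumrB -mulr_sumr; congr (_ - _)%R.
  rewrite (bigID (mem (codom f))) /=.
  rewrite (eq_bigr (fun=> u)); last by move=> i ->.
  rewrite [X in (_ + X)%R](eq_bigr (fun=> v)); last by move=> i /negbTE ->.
  rewrite !sumr_const card_codom// card_ord.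
  have -> : #|[pred i | i \notin codom f]| = (n - q)%N.
    have := cardC (mem (codom f)); rewrite card_codom// !card_ord => h1.
    apply: (@addnI q); rewrite subnKC; last by rewrite ltnW// (leq_trans qp)// ltnW// ltnW.
    by rewrite -[RHS]h1; congr (_ + _)%N; apply: eq_card => i; rewrite !inE.
  by rewrite !mulr_natl.
rewrite /u /v le_eqVlt; apply/orP; left; apply/eqP.
have bE : (m * b = p%:R - q%:R * e)%R by rewrite /b; field; rewrite gt_eqF.
have -> : (m * (- (k / (2 * m)) * (ln D' - ln D) - b / 2 * ln S) =
   - (k / 2) * (ln D' - ln D) - (m * b) / 2 * ln S)%R by field; rewrite gt_eqF.
by rewrite bE; field.
Qed.

End column_bound.

Lemma pairwise_in (T : eqType) (r : rel T) (s : seq T) :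
  {in s &, forall x y, r x y} -> pairwise r s.
Proof.
elim: s => [//|x s IH] h /=; apply/andP; split.
  by apply/allP => y ys; apply: h; rewrite ?mem_head// in_cons ys orbT.
by apply: IH => y z ys zs; apply: h; rewrite in_cons ?ys ?zs orbT.
Qed.

Section prior_integrable.
Context {R : realType} {n p : nat}.
Local Notation mat := 'M[R]_(n, p).
Local Notation idx := ('I_n * 'I_p)%type.
Local Notation leb := (@lebesgue_measure R).
Hypothesis pn : (p.+1 < n)%N.
Variable i0 : 'I_p.
Local Open Scope ereal_scope.
Let kk : R := (n - p - 1)%N%:R.

(** Columns are counted from the right so that the next one is adjoined in front, as in
    [row_mx x M]. For [q <= p] the index is in range and [insubd] does not take its default. *)
Definition lastcols q (A : mat) : 'M[R]_(n, q) :=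
  \matrix_(a, i) A a (insubd i0 (p - q + i)%N).

Definition nextcol q : 'I_p := insubd i0 (p - q.+1)%N.

Lemma val_nextcol q : (q < p)%N -> nextcol q = (p - q.+1)%N :> nat.
Proof. by move=> qp; rewrite val_insubd ltn_subrL (leq_trans _ qp). Qed.

Lemma lastcolsS q (A : mat) : (q < p)%N ->
  lastcols q.+1 A = row_mx (\col_a A a (nextcol q)) (lastcols q A) :> 'M[R]_(n, 1 + q).
Proof.
move=> qp; apply/matrixP => a i; rewrite !mxE; case: splitP => l li.
  by rewrite mxE li ord1 addn0.
by rewrite mxE li addnA addn1 subnSK.
Qed.

Lemma lastcols_full (A : mat) : lastcols p A = A.
Proof.
by apply/matrixP => a i; rewrite mxE subnn add0n; congr (A _ _); apply/val_inj; rewrite val_insubd ltn_ord.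
Qed.

Lemma lastcols_eq q (A X : mat) : (q < p)%N ->
  (forall a i, i != nextcol q -> X a i = A a i) -> lastcols q X = lastcols q A.
Proof.
move=> qp XA; apply/matrixP => a i; rewrite !mxE; apply: XA.
apply/eqP => /(congr1 val); rewrite /= val_nextcol// val_insubd.
have iq := ltn_ord i.
have -> : (p - q + i < p)%N by rewrite -[X in (_ < X)%N](subnK (ltnW qp)) ltn_add2l.
by apply/eqP; rewrite gtn_eqF// -(subnSK qp) addSn ltnS leq_addr.
Qed.

(* Majorant of the Gaussian-weighted prior with all [gamma i = p], built on the
   last [q] columns so that columns can be integrated out one at a time; it is
   [+oo] on rank-deficient matrices, which are therefore negligible. *)
Definition Phi (c : R) q (A : mat) : \bar R :=
  epow (kk / 2) (\det ((lastcols q A)^T *m lastcols q A)) *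
  \prod_(i < q) (epow (p%:R / 2) (colsq i (lastcols q A)) *
    (expR (- c * colsq i (lastcols q A)))%:E).

Lemma Phi_gt0 c q A : 0 < Phi c q A.
Proof.
apply: mule_gt0; first exact: epow_gt0.
apply: (big_ind (fun x => 0 < x)) => // [x z x0 z0|i _]; first exact: mule_gt0.
by apply: mule_gt0; [exact: epow_gt0|rewrite lte_fin expR_gt0].
Qed.

Lemma measurable_mat_det d (T : measurableType d) q (F : T -> 'M[R]_q) :
  (forall i j, measurable_fun setT (fun t => F t i j)) ->
  measurable_fun setT (fun t => \det (F t)).
Proof.
move=> mF; apply: measurable_sum => s; apply: measurable_funM => //.
by apply: measurable_prod => i _; exact: mF.
Qed.

Lemma measurable_gram_entry d (T : measurableType d) q (F : T -> 'M[R]_(n, q)) i j :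
  (forall a i, measurable_fun setT (fun t => F t a i)) ->
  measurable_fun setT (fun t => ((F t)^T *m F t) i j).
Proof.
move=> mF; under eq_fun do rewrite mxE.
apply: measurable_sum => a; under eq_fun do rewrite mxE.
exact: measurable_funM.
Qed.

Lemma measurable_colsq d (T : measurableType d) q (F : T -> 'M[R]_(n, q)) i :
  (forall a i, measurable_fun setT (fun t => F t a i)) ->
  measurable_fun setT (fun t => colsq i (F t)).
Proof. by move=> mF; apply: measurable_sum => a; exact: measurable_funX. Qed.

Lemma measurable_Phi c q : measurable_fun setT (Phi c q).
Proof.
have ml a i : measurable_fun setT (fun A => lastcols q A a i).
  by under eq_fun do rewrite mxE; exact: measurable_coord.
apply: emeasurable_funM.
  apply: (measurableT_comp (measurable_epow _)); apply: measurable_mat_det => i j.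
  exact: measurable_gram_entry.
elim: (index_enum _) => [|i s IH].
  by (under eq_fun do rewrite big_nil); exact: measurable_cst.
under eq_fun do rewrite big_cons.
apply: emeasurable_funM => //; apply: emeasurable_funM.
  by apply: (measurableT_comp (measurable_epow _)); exact: measurable_colsq.
apply/measurable_EFinP; apply: measurableT_comp => //.
by apply: measurable_funM => //; exact: measurable_colsq.
Qed.

Lemma PhiS c q (A : mat) : (q < p)%N ->
  Phi c q.+1 A =
  epow (kk / 2) (\det ((row_mx (\col_a A a (nextcol q)) (lastcols q A))^T *m
     row_mx (\col_a A a (nextcol q)) (lastcols q A))) *
  (epow (p%:R / 2) (\sum_a A a (nextcol q) ^+ 2)%R *
    (expR (- c * \sum_a A a (nextcol q) ^+ 2))%:E) *
  \prod_(i < q) (epow (p%:R / 2) (colsq i (lastcols q A)) *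
    (expR (- c * colsq i (lastcols q A)))%:E).
Proof.
move=> qp; rewrite /Phi big_ord_recl -[RHS]muleA -(lastcolsS _ qp); congr (_ * _).
have E0 : colsq ord0 (lastcols q.+1 A) = (\sum_a A a (nextcol q) ^+ 2)%R.
  by apply: eq_bigr => a _; rewrite mxE addn0.
rewrite E0; congr (_ * _); apply: eq_bigr => i _.
suff -> : colsq (lift ord0 i) (lastcols q.+1 A) = colsq i (lastcols q A) by [].
apply: eq_bigr => a _; rewrite !mxE lift0; congr (_ ^+ 2)%R; congr (A _ (insubd _ _)).
by rewrite addnS -addSn subnSK.
Qed.

Definition colseq (j : 'I_p) : seq idx := [seq (a, j) | a <- enum 'I_n].

(** The pivot rows are listed first, hence integrated outermost: when a non-pivot entry is
    integrated, the shift by pivot entries in its factor is a constant, and the one-dimensional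
    bound is uniform in it. *)
Lemma column_step c q : (0 < c)%R -> (q < p)%N ->
  exists2 C : R, (0 < C)%R & forall A,
    eiint (colseq (nextcol q)) (Phi c q.+1) A <= C%:E * Phi c q A.
Proof.
move=> c0 qp; set j := nextcol q.
have e01 : (0 <= ((n - 1)%N%:R / n%:R : R) < 1)%R.
  have n0 : (0 < n)%N by exact: leq_trans pn.
  by rewrite divr_ge0 ?ler0n// ltr_pdivrMr ?ltr0n// mul1r ltr_nat subn1 prednK//= leqnn.
have [C1 C10 HC1] := integral_epow_gauss e01 c0.
pose C : R := ((1 + q)%:R * (C1 + C1))%R.
have q1 : (0 < (1 + q)%:R :> R)%R by rewrite ltr0n.
have C0 : (0 < C)%R by rewrite mulr_gt0// addr_gt0.
exists (C ^+ n)%R; first exact: exprn_gt0.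
(* If the remaining columns are dependent the right side is infinite, so a pivot block may be
   assumed. *)
move=> A; have [uG|nuG] := boolP ((lastcols q A)^T *m lastcols q A \in unitmx); last first.
  have -> : Phi c q A = +oo.
    move: nuG; rewrite unitmxE unitfE negbK /Phi => /eqP ->.
    rewrite {1}/epow eqxx gt0_mulye//.
    apply: (big_ind (fun x => 0 < x)) => // [x z x0 z0|i _]; first exact: mule_gt0.
    by apply: mule_gt0; [exact: epow_gt0|rewrite lte_fin expR_gt0].
  by rewrite gt0_muley ?leey// lte_fin exprn_gt0.
have [f [B [finj _ piv]]] := gram_pivot uG.
pose s1 : seq idx := [seq (f i, j) | i <- enum 'I_q].
pose s2 : seq idx := [seq (a, j) | a <- [seq a <- enum 'I_n | a \notin codom f]].
have injj : injective (fun a : 'I_n => (a, j)) by move=> a b [].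
have us : uniq (s1 ++ s2).
  rewrite cat_uniq; apply/and3P; split.
  - by rewrite map_inj_uniq ?enum_uniq// => a b [] /finj.
  - apply/hasPn => -[b l] /mapP[a]; rewrite mem_filter => /andP[ha _] [-> ->].
    by apply/negP => /mapP[i _ [ai]]; move: ha; rewrite ai codom_f.
  - by rewrite map_inj_uniq// filter_uniq// enum_uniq.
have ps : perm_eq (colseq j) (s1 ++ s2).
  apply: uniq_perm => //; first by rewrite map_inj_uniq ?enum_uniq.
  move=> [b l]; rewrite mem_cat; apply/mapP/orP.
    move=> [a _ [-> ->]]; have [/codomP[i ->]|ha] := boolP (a \in codom f).
      by left; apply/mapP; exists i => //; rewrite mem_enum.
    by right; apply/mapP; exists a => //; rewrite mem_filter ha mem_enum.
  by case=> /mapP[a _ [-> ->]]; [exists (f a)|exists a] => //; rewrite mem_enum.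
have P0 c' q' X : 0 <= Phi c' q' X by exact/ltW/Phi_gt0.
pose h (k : idx) (X : mat) := colfactor f B c (\col_a X a j) k.1.
have h0 k X : 0 <= h k X by exact/ltW/colfactor_gt0.
have mcol a : measurable_fun setT (fun X : mat => (\col_a X a j) a 0%R).
  by under eq_fun do rewrite mxE; exact: measurable_coord.
have mh k : measurable_fun setT (h k).
  apply: emeasurable_funM; last first.
    apply/measurable_EFinP; apply: measurableT_comp => //.
    by apply: measurable_funM => //; exact: measurable_funX.
  have me a : measurable_fun setT (fun X : mat => epow ((n - 1)%N%:R / n%:R) ((\col_a X a j) a 0%R)).
    exact: (measurableT_comp (measurable_epow _) (mcol a)).
  case: (k.1 \in codom f) => //; apply: emeasurable_funM => //; apply: emeasurable_funD => //.
  apply: (measurableT_comp (measurable_epow _)); apply: measurable_funB => //.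
  by apply: measurable_sum => i; exact: measurable_funM.
have mp s : measurable_fun setT (fun X : mat => \prod_(k <- s) h k X).
  elim: s => [|k s' IH]; first by (under eq_fun do rewrite big_nil); exact: measurable_cst.
  under eq_fun do rewrite big_cons.
  exact: emeasurable_funM.
have p0 s X : 0 <= \prod_(k <- s) h k X by apply: prode_ge0 => ? _.
have us' : uniq (colseq j) by rewrite (perm_uniq ps).
rewrite (perm_eiint ps us' (P0 c q.+1) (measurable_Phi c q.+1)).
apply: (@le_trans _ _ (eiint (s1 ++ s2) (fun X => Phi c q A * \prod_(k <- s1 ++ s2) h k X) A)).
  apply: le_eiint_loc => //.
  - by move=> X; apply: mule_ge0.
  - exact: measurable_Phi.
  - exact: emeasurable_funM.
  - move=> X XA; have XE : lastcols q X = lastcols q A.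
      apply: lastcols_eq => // a i ij; apply: (XA (a, i)); rewrite -(perm_mem ps).
      by apply/mapP => -[b _ [_ ib]]; rewrite ib eqxx in ij.
    have -> : \prod_(k <- s1 ++ s2) h k X = \prod_a colfactor f B c (\col_a X a j) a.
      by rewrite -(perm_big _ ps) /= big_map big_enum.
    rewrite PhiS// XE /Phi -/j.
    have := colfactor_bound pn qp uG finj c piv (\col_a X a j).
    under eq_bigr do rewrite mxE.
    move=> hb.
    rewrite [leRHS]muleAC; apply: lee_wpmul2r => //.
    by apply: prode_ge0 => i _; apply: mule_ge0; [exact: epow_ge0|rewrite lee_fin expR_ge0].
rewrite eiint_factor// muleC; apply: lee_wpmul2r => //.
rewrite [X in (_ ^+ X)%R](_ : n = size (s1 ++ s2)); last by rewrite -(perm_size ps) size_map size_enum_ord.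
apply: eiint_chain => //; first exact: ltW.
- move=> [a l] X; rewrite -(perm_mem ps) => /mapP[b _ [-> ->]].
  have mexp : measurable_fun setT (fun t : R => (expR (- c * t ^+ 2))%:E).
    by apply/measurable_EFinP; exact: measurable_expR_sqr.
  have mep s : measurable_fun setT (fun t : R => epow ((n - 1)%N%:R / n%:R) (t - s)).
    apply: (measurableT_comp (measurable_epow _)); exact: measurable_funB.
  have H1 s : \int[leb]_t (epow ((n - 1)%N%:R / n%:R) (t - s) * (expR (- c * t ^+ 2))%:E) <= C1%:E.
    exact: HC1.
  rewrite /h /colfactor /=; have [hb|hb] := boolP (b \in codom f).
    under eq_integral => t _ do rewrite !mxE eqxx -[X in epow _ X]subr0.
    apply: le_trans (H1 0%R) _; rewrite lee_fin /C natrD; have := ler0n R q; nra.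
  under eq_integral => t _.
    rewrite !mxE eqxx (_ : (t - _)%R = (t - \sum_i B b i * X (f i) j)%R); last first.
      congr (_ - _)%R; apply: eq_bigr => i _; rewrite !mxE.
      by case: eqP => // -[fb]; move: hb; rewrite -fb codom_f.
    rewrite -muleA ge0_muleDl ?epow_ge0// -[X in _ + epow _ X * _]subr0.
    over.
  rewrite ge0_integralZl_EFin//; last 2 first.
  - by move=> t _; apply: adde_ge0; apply: mule_ge0; rewrite ?epow_ge0// lee_fin expR_ge0.
  - by apply: emeasurable_funD; apply: emeasurable_funM => //; exact: mep.
  rewrite /C EFinM; apply: lee_wpmul2l; first by rewrite lee_fin ler0n.
  rewrite ge0_integralD//.
  - by rewrite EFinD; apply: leeD.
  - by move=> t _; apply: mule_ge0; rewrite ?epow_ge0// lee_fin expR_ge0.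
  - by apply: emeasurable_funM => //; exact: mep.
  - by move=> t _; apply: mule_ge0; rewrite ?epow_ge0// lee_fin expR_ge0.
  - by apply: emeasurable_funM => //; exact: mep.
(* For [k] listed before [l]: the entries differ, and [k] is a pivot or [l] is not. Either way the
   factor of [k] is free of entry [l], since a factor involves its own entry and, outside the pivot
   rows, the pivot entries. *)
pose r (k l : idx) := (k != l) && ((k.1 \in codom f) || (l.1 \notin codom f)).
have pw : pairwise r (s1 ++ s2).
  have pwn : pairwise (fun k l => k != l) (s1 ++ s2) by rewrite -uniq_pairwise.
  have pwc : pairwise (fun k l : idx => (k.1 \in codom f) || (l.1 \notin codom f)) (s1 ++ s2).
    rewrite pairwise_cat; apply/and3P; split.
    - by apply/allrelP => k l /mapP[i _ ->] _ /=; rewrite codom_f.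
    - by apply: pairwise_in => k l /mapP[i _ ->] _ /=; rewrite codom_f.
    - apply: pairwise_in => k l _ /mapP[i]; rewrite mem_filter => /andP[hi _] ->.
      by rewrite /= hi orbT.
  by rewrite pairwise_relI pwn.
move=> t1 k t2 l X t tE lt2; move: pw; rewrite tE pairwise_cat pairwise_cons.
move=> /and3P[_ _ /andP[/allP/(_ l lt2) /andP[kl hkl] _]].
have [k2 l2] : k.2 = j /\ l.2 = j.
  have kin : k \in colseq j by rewrite (perm_mem ps) tE mem_cat mem_head orbT.
  have lin : l \in colseq j by rewrite (perm_mem ps) tE mem_cat in_cons lt2 !orbT.
  by split; [case/mapP: kin => ? _ ->|case/mapP: lin => ? _ ->].
rewrite /h /colfactor !mxE.
have -> : ((k.1, j) == l) = false.
  by apply/negbTE; apply: contra kl => /eqP <-; rewrite -k2 -surjective_pairing.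
case: ifP => // hk; congr (_ * (epow _ (_ - _)%R + _) * _).
apply: eq_bigr => i _; rewrite !mxE.
case: eqP => // fl; move: hkl; rewrite hk /= -fl /= codom_f.
by [].
Qed.

(** The leftmost column comes last in the list, so it is integrated innermost, that is, first; each
    step then strips the first column of what remains. *)
Fixpoint colorder q : seq idx :=
  if q is q'.+1 then colorder q' ++ colseq (nextcol q') else [::].

Lemma mem_colorder q (k : idx) : (q <= p)%N -> (k \in colorder q) = (p - q <= k.2)%N.
Proof.
elim: q => [|q IH] qp /=; first by rewrite subn0 in_nil leqNgt ltn_ord.
rewrite mem_cat IH ?(ltnW qp)//.
have -> : (k \in colseq (nextcol q)) = (k.2 == (p - q.+1)%N :> nat).
  rewrite -val_nextcol//; apply/mapP/eqP => [[a _ ->]//|kj].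
  by exists k.1; rewrite ?mem_enum// -(val_inj kj) -surjective_pairing.
by rewrite -(subnSK qp) [RHS]leq_eqVlt [RHS]orbC eq_sym.
Qed.

Lemma uniq_colorder q : (q <= p)%N -> uniq (colorder q).
Proof.
elim: q => [//|q IH] qp /=; rewrite cat_uniq IH ?(ltnW qp)//=; apply/andP; split.
  apply/hasPn => -[a i] /mapP[b _ [_ ->]]; rewrite mem_colorder ?(ltnW qp)//=.
  by rewrite val_nextcol// -(subnSK qp) ltnn.
by rewrite map_inj_uniq ?enum_uniq// => a b [].
Qed.

Lemma integrable_Phi c : (0 < c)%R -> \int[mat_leb]_A Phi c p A < +oo.
Proof.
move=> c0; have P0 q X : 0 <= Phi c q X by exact/ltW/Phi_gt0.
have ps : perm_eq (enum [set: idx]) (colorder p).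
  apply: uniq_perm; [exact: enum_uniq|exact: uniq_colorder|].
  by move=> k; rewrite mem_colorder// subnn mem_enum in_setT.
rewrite (@ge0_integral_mat_perm _ _ _ _ _ 0%R ps)//; last exact: measurable_Phi.
suff H q : (q <= p)%N -> exists C : R, forall A, eiint (colorder q) (Phi c q) A <= C%:E.
  by have [C HC] := H p (leqnn p); apply: le_lt_trans (HC _) _; rewrite ltry.
elim: q => [_|q IH qp].
  exists 1%R => A /=; rewrite /Phi big_ord0 mule1 det_mx00 /epow oner_eq0 normr1.
  by rewrite powR1.
have [C HC] := IH (ltnW qp); have [C' C'0 HC'] := column_step c0 qp.
exists (C' * C)%R => A /=; rewrite eiint_cat.
apply: (@le_trans _ _ (eiint (colorder q) (fun X => C'%:E * Phi c q X) A)).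
  apply: le_eiint => //.
  - by move=> X; exact: eiint_ge0.
  - by apply: measurable_eiint => //; exact: measurable_Phi.
  - by apply: emeasurable_funM => //; exact: measurable_Phi.
rewrite eiintZl//; [|exact: ltW|exact: measurable_Phi].
by rewrite EFinM; apply: lee_wpmul2l => //; rewrite lee_fin ltW.
Qed.

End prior_integrable.

(** * Gaussian majorant and almost-everywhere minorant of the prior *)

Section prior_bounds.
Context {R : realType} {n p : nat}.
Local Notation mat := 'M[R]_(n, p).
Local Notation idx := ('I_n * 'I_p)%type.
Hypotheses (pn : (p.+1 < n)%N) (p0 : (0 < p)%N).
Variable gamma : 'I_p -> R.
Hypothesis gp : forall i, 0 <= gamma i <= p%:R.
Let kk : R := (n - p - 1)%N%:R.
Let i0 : 'I_p := Ordinal p0.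

Lemma sq_colsq (X : mat) : sq X = \sum_i colsq i X.
Proof. by rewrite /sq -(pair_bigA _ (fun a i => X a i ^+ 2))/= exchange_big. Qed.

Lemma colsq_ge0 (X : mat) i : 0 <= colsq i X.
Proof. by apply: sumr_ge0 => a _; exact: sqr_ge0. Qed.

Lemma colsq_le_sq (X : mat) i : colsq i X <= sq X.
Proof.
by rewrite sq_colsq (bigD1 i)//= lerDl sumr_ge0// => j _; exact: colsq_ge0.
Qed.

Lemma measurable_sq : measurable_fun setT (fun X : mat => sq X).
Proof.
by apply: measurable_sum => k; apply: measurable_funX; exact: measurable_coord.
Qed.

Lemma measurable_prior (g : 'I_p -> R) : measurable_fun setT (fun X : mat => piMSVS2 g X).
Proof.
apply: measurable_funM.
  apply: (measurableT_comp (measurable_powR _)); apply: measurable_mat_det => i j.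
  by apply: measurable_gram_entry => a l; exact: measurable_coord.
apply: measurable_prod => i _; apply: (measurableT_comp (measurable_powR _)).
have -> : (fun X : mat => colnorm X i) = (fun X => colsq i X `^ 2^-1).
  by apply/funext => X; rewrite powR12_sqrt// colsq_ge0.
apply: (measurableT_comp (measurable_powR _)); apply: measurable_colsq => a l.
exact: measurable_coord.
Qed.

Lemma prior_ge0 (X : mat) : 0 <= piMSVS2 gamma X.
Proof. by rewrite mulr_ge0 ?powR_ge0// prodr_ge0// => i _; exact: powR_ge0. Qed.

(** The free slope [a] lets a logarithm be absorbed by an arbitrarily small part of a Gaussian
    exponent. *)
Lemma ln_le_lin (a s : R) : 0 < a -> 0 < s -> ln s <= a * s - ln a.
Proof.
move=> a0 s0; have := ln_sublinear (mulr_gt0 a0 s0).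
by rewrite lnM ?posrE//; lra.
Qed.

(** Half of the Gaussian is spent on raising each exponent [gamma i] to [p], which costs a growing
    power of the norm on long columns. The slope [a = c / p] makes the cost [p / 2 * a] equal to
    [c / 2]. *)
Lemma prior_gauss_le_Phi (c : R) : 0 < c -> exists2 K, 0 < K &
  forall X : mat, ((expR (- c * sq X) * piMSVS2 gamma X)%:E <= K%:E * Phi i0 (c / 2) p X)%E.
Proof.
move=> c0; have pp : 0 < p%:R :> R by rewrite ltr0n.
pose a := c / p%:R; have a0 : 0 < a by rewrite divr_gt0.
exists (expR (p%:R * (p%:R * `|ln a|))); first exact: expR_gt0.
move=> X; rewrite /Phi lastcols_full.
have Q0 : (0 < \prod_(i < p) (epow (p%:R / 2) (colsq i X) * (expR (- (c / 2) * colsq i X))%:E))%E.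
  apply: (big_ind (fun x => 0 < x)%E) => // [x z x0 z0|i _]; first exact: mule_gt0.
  by apply: mule_gt0; [exact: epow_gt0|rewrite lte_fin expR_gt0].
have [uG|nuG] := boolP (X^T *m X \in unitmx); last first.
  move: nuG; rewrite unitmxE unitfE negbK => /eqP ->.
  by rewrite {1}/epow eqxx gt0_mulye// gt0_muley ?leey// lte_fin expR_gt0.
have d0 := det_gram_gt0 uG; have S0 i := colsq_gt0 i uG.
have epE (r t : R) : 0 < t -> epow r t = (expR (- r * ln t))%:E.
  by move=> t0; rewrite /epow gt_eqF// gtr0_norm// /powR gt_eqF.
have -> : (\prod_(i < p) (epow (p%:R / 2) (colsq i X) * (expR (- (c / 2) * colsq i X))%:E) =
    \prod_(i < p) (expR (- (p%:R / 2) * ln (colsq i X) + - (c / 2) * colsq i X))%:E)%E.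
  by apply: eq_bigr => i _; rewrite epE// -EFinM -expRD.
rewrite prior_expR// epE// prodEFin -expR_sum -!EFinM -!expRD lee_fin ler_expR sq_colsq -/kk /logdet.
suff : \sum_(i < p) (- c * colsq i X + - (gamma i / 2) * ln (colsq i X)) <=
    \sum_(i < p) (p%:R * `|ln a| + (- (p%:R / 2) * ln (colsq i X) + - (c / 2) * colsq i X)).
  rewrite [X in X <= _]big_split [X in _ <= X]big_split /= -mulr_sumr sumr_const card_ord -mulr_natl.
  lra.
apply: ler_sum => i _; have /andP[g0 g1] := gp i.
have h1 := ln_le_lin a0 (S0 i).
have h2 : (p%:R - gamma i) / 2 * ln (colsq i X) <= (p%:R - gamma i) / 2 * (a * colsq i X + `|ln a|).
  rewrite ler_wpM2l ?divr_ge0 ?subr_ge0//; apply: le_trans h1 _.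
  by rewrite lerD2l -normrN ler_norm.
have h3 : (p%:R - gamma i) / 2 * (a * colsq i X + `|ln a|) <= p%:R / 2 * (a * colsq i X + `|ln a|).
  apply: ler_wpM2r; last by lra.
  by rewrite addr_ge0// mulr_ge0 ?(ltW a0) ?colsq_ge0.
have h4 : p%:R / 2 * (a * colsq i X + `|ln a|) = c / 2 * colsq i X + p%:R / 2 * `|ln a|.
  by rewrite /a; field; rewrite gt_eqF.
have h5 : 0 <= p%:R / 2 * `|ln a| by rewrite mulr_ge0// divr_ge0// ltW.
move: h2 h3 h5; rewrite h4; lra.
Qed.

Lemma prior_gauss_integrable (c : R) : 0 < c ->
  mat_leb.-integrable setT (fun X : mat => (expR (- c * sq X) * piMSVS2 gamma X)%:E).
Proof.
move=> c0; have [K K0 HK] := prior_gauss_le_Phi c0.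
have mf : measurable_fun setT (fun X : mat => (expR (- c * sq X) * piMSVS2 gamma X)%:E).
  apply/measurable_EFinP; apply: measurable_funM; last exact: measurable_prior.
  apply: measurableT_comp => //; apply: measurable_funM => //; exact: measurable_sq.
apply/integrableP; split => //.
have c2 : 0 < c / 2 by rewrite divr_gt0.
have mP : measurable_fun setT (Phi i0 (c / 2) p : mat -> \bar R) by exact: measurable_Phi.
apply: (@le_lt_trans _ _ (\int[mat_leb]_(X in setT) (K%:E * Phi i0 (c / 2) p X))%E).
  apply: ge0_le_integral => //.
  - exact: measurableT_comp.
  - by apply: emeasurable_funM; [exact: measurable_cst|exact: mP].
  - by move=> X _; rewrite gee0_abs// lee_fin mulr_ge0 ?expR_ge0 ?prior_ge0.
have P0 (X : mat) : (0 <= Phi i0 (c / 2) p X)%E by exact/ltW/Phi_gt0.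
rewrite (ge0_integralZl_EFin _ measurableT (fun X _ => P0 X) mP (ltW K0)).
by apply: lte_mul_pinfty; rewrite ?lee_fin ?(ltW K0)//; exact: integrable_Phi.
Qed.

Lemma ae_det_gram_neq0 : {ae mat_leb, forall X : mat, X^T *m X \in unitmx}.
Proof.
have Pi : mat_leb.-integrable setT (Phi i0 1 p : mat -> \bar R).
  apply/integrableP; split; first exact: measurable_Phi.
  under eq_integral do rewrite gee0_abs ?(ltW (Phi_gt0 _ _ _ _))//.
  exact: integrable_Phi.
apply: filterS (integrable_ae measurableT Pi) => X /(_ I).
apply: contraTT => nuG; rewrite /Phi lastcols_full.
move: nuG; rewrite unitmxE unitfE negbK => /eqP ->.
rewrite {1}/epow eqxx gt0_mulye//.
apply: (big_ind (fun x => 0 < x)%E) => // [x z x0 z0|i _]; first exact: mule_gt0.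
by apply: mule_gt0; [exact: epow_gt0|rewrite lte_fin expR_gt0].
Qed.

Lemma det_gram_le (X : mat) : \det (X^T *m X) <= #|{perm 'I_p}|%:R * sq X ^+ p.
Proof.
have Gle i j : `|(X^T *m X) i j| <= sq X.
  rewrite mxE; apply: le_trans (ler_norm_sum _ _ _) _.
  apply: (@le_trans _ _ ((colsq i X + colsq j X) / 2)); last first.
    by have := colsq_le_sq X i; have := colsq_le_sq X j; lra.
  rewrite /colsq -big_split mulr_suml; apply: ler_sum => a _ /=.
  rewrite mxE normrM -(@real_normK _ (X a i)) ?num_real// -(@real_normK _ (X a j)) ?num_real//.
  by have := sqr_ge0 (`|X a i| - `|X a j|); rewrite sqrrB; lra.
apply: le_trans (ler_norm _) _; apply: le_trans (ler_norm_sum _ _ _) _.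
have -> : #|{perm 'I_p}|%:R * sq X ^+ p = \sum_(s : {perm 'I_p}) sq X ^+ p.
  by rewrite sumr_const mulr_natl.
apply: ler_sum => s _; rewrite normrM normrX normrN1 expr1n mul1r normr_prod.
have -> : sq X ^+ p = \prod_(i < p) sq X by rewrite prodr_const card_ord.
by apply: ler_prod => i _; rewrite normr_ge0 Gle.
Qed.

(** On rank-deficient matrices the prior is [0], hence the exceptional set. Elsewhere the
    determinant and the column norms grow at most polynomially, so the prior is at least a multiple
    of [(sq X)^(- C2)]; the logarithm is absorbed by [expR (- sq X)], the slope [a = 1 / (C2 + 1)]
    being chosen to have [C2 a <= 1]. *)
Lemma prior_ae_lower : exists2 c, 0 < c &
  {ae mat_leb, forall X : mat, c * expR (- sq X) <= piMSVS2 gamma X}.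
Proof.
pose K : R := #|{perm 'I_p}|%:R.
have K1 : 1 <= K by rewrite ler1n; apply/card_gt0P; exists 1%g.
pose C1 := kk / 2 * ln K; pose C2 := kk / 2 * p%:R + \sum_i gamma i / 2.
have kk0 : 0 <= kk by rewrite ler0n.
have C20 : 0 <= C2.
  rewrite addr_ge0 ?mulr_ge0 ?divr_ge0 ?ler0n// sumr_ge0// => i _.
  by have /andP[g0 _] := gp i; rewrite divr_ge0.
pose a : R := (C2 + 1)^-1; have a0 : 0 < a by rewrite invr_gt0; lra.
exists (expR (- C1 - C2 * `|ln a|)); first exact: expR_gt0.
apply: filterS ae_det_gram_neq0 => X uG.
have d0 := det_gram_gt0 uG; have S0 i := colsq_gt0 i uG.
have sq0 : 0 < sq X by exact: lt_le_trans (S0 i0) (colsq_le_sq _ _).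
have K0 : 0 < K by lra.
rewrite prior_expR// -expRD ler_expR -/kk /logdet.
have h1 : ln (\det (X^T *m X)) <= ln K + p%:R * ln (sq X).
  rewrite mulr_natl -lnXn// -lnM ?posrE ?exprn_gt0// ler_ln ?posrE//.
    exact: det_gram_le.
  by rewrite mulr_gt0 ?exprn_gt0.
have h2 : \sum_i gamma i / 2 * ln (colsq i X) <= (\sum_i gamma i / 2) * ln (sq X).
  rewrite mulr_suml; apply: ler_sum => i _; have /andP[g0 _] := gp i.
  by rewrite ler_wpM2l ?divr_ge0// ler_ln ?posrE// colsq_le_sq.
have h3 : kk / 2 * ln (\det (X^T *m X)) <= kk / 2 * (ln K + p%:R * ln (sq X)).
  by rewrite ler_wpM2l// divr_ge0.
have h4 : C2 * ln (sq X) <= C2 * (a * sq X + `|ln a|).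
  rewrite ler_wpM2l//; apply: le_trans (ln_le_lin a0 sq0) _.
  by rewrite lerD2l -normrN ler_norm.
have h5 : C2 * (a * sq X) <= sq X.
  rewrite mulrA -[leRHS]mul1r ler_wpM2r ?(ltW sq0)// /a ler_pdivrMr; lra.
have -> : \sum_i - (gamma i / 2) * ln (colsq i X) = - \sum_i gamma i / 2 * ln (colsq i X).
  by rewrite -sumrN; apply: eq_bigr => i _; rewrite mulNr.
have h6 : C2 * ln (sq X) = kk / 2 * p%:R * ln (sq X) + (\sum_i gamma i / 2) * ln (sq X).
  by rewrite /C2 mulrDl.
move: h2 h3 h4 h5 h6; rewrite /C1 !mulrDr; lra.
Qed.

End prior_bounds.

(** * Gaussian moments *)

Section gaussian_1d.
Context {R : realType}.
Local Notation leb := (@lebesgue_measure R).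

Lemma integrable_expR_sqr (c : R) : 0 < c ->
  leb.-integrable setT (fun t : R => (expR (- c * t ^+ 2))%:E).
Proof.
move=> c0; apply/integrableP; split.
  by apply/measurable_EFinP; exact: measurable_expR_sqr.
under eq_integral do rewrite gee0_abs ?lee_fin ?expR_ge0//.
by rewrite integral_expR_sqr// ltry.
Qed.

Lemma sqr_expR_le (h t : R) : 0 < h -> t ^+ 2 * expR (- h * t ^+ 2) <= (1 - expR (- h * t ^+ 2)) / h.
Proof.
move=> h0; rewrite ler_pdivlMr// mulNr expRN.
set E := expR _; have E0 : 0 < E by exact: expR_gt0.
have : 1 + h * t ^+ 2 <= E by exact: expR_ge1Dx.
rewrite -subr_ge0 => hE.
have -> : t ^+ 2 / E * h = (h * t ^+ 2) / E by ring.
by rewrite ler_pdivrMr// mulrBl mul1r mulVf ?gt_eqF//; lra.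
Qed.

Lemma sqr_ge_expR (h t : R) : 0 < h -> (1 - expR (- h * t ^+ 2)) / h <= t ^+ 2.
Proof.
move=> h0; rewrite ler_pdivrMr//; have := expR_ge1Dx (- h * t ^+ 2).
by rewrite mulNr; lra.
Qed.

(* The integrand is squeezed between difference quotients in [s] of
   [expR (- s^2 t^2 / 2)], whose integral is [J / s]. *)
Lemma integral_sqr_expR :
  (\int[leb]_t (t ^+ 2 * expR (- 2^-1 * t ^+ 2))%:E = (Num.sqrt (pi / 2^-1))%:E)%E.
Proof.
pose J : R := Num.sqrt (pi / 2^-1); pose c (s : R) := 2^-1 * s ^+ 2.
have c1 : c 1 = 2^-1 by rewrite /c expr1n mulr1.
have JE s : 0 < s -> Rintegral leb setT (fun t => expR (- c s * t ^+ 2)) = J / s.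
  move=> s0; rewrite /Rintegral integral_expR_sqr /=; last by rewrite mulr_gt0 ?exprn_gt0.
  rewrite /c invfM mulrA sqrtrM ?divr_ge0 ?pi_ge0//.
  by rewrite sqrtrV ?sqr_ge0// sqrtr_sqr gtr0_norm.
have iE s : 0 < s -> leb.-integrable setT (EFin \o (fun t : R => expR (- c s * t ^+ 2))).
  by move=> s0; apply: integrable_expR_sqr; rewrite mulr_gt0// exprn_gt0.
pose m (s t : R) := t ^+ 2 * expR (- c s * t ^+ 2).
have mm s : measurable_fun setT (m s).
  by apply: measurable_funM; [exact: measurable_funX|exact: measurable_expR_sqr].
have up s s' t : 0 < s' -> s' < s -> m s t <= (expR (- c s' * t ^+ 2) - expR (- c s * t ^+ 2)) / (c s - c s').
  move=> s'0 s's; have h0 : 0 < c s - c s' by rewrite /c -mulrBr mulr_gt0// subr_gt0 ltr_pXn2r ?nnegrE// ltW// (lt_trans s'0).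
  have := sqr_expR_le t h0; rewrite /m => h.
  have -> : expR (- c s * t ^+ 2) = expR (- (c s - c s') * t ^+ 2) * expR (- c s' * t ^+ 2).
    by rewrite -expRD; congr expR; ring.
  rewrite mulrA; have := expR_gt0 (- c s' * t ^+ 2); set F := expR (- c s' * _) => F0.
  apply: le_trans (ler_wpM2r (ltW F0) h) _.
  by rewrite le_eqVlt; apply/orP; left; apply/eqP; ring.
have lo s s' t : 0 < s' -> s' < s -> (expR (- c s' * t ^+ 2) - expR (- c s * t ^+ 2)) / (c s - c s') <= m s' t.
  move=> s'0 s's; have h0 : 0 < c s - c s' by rewrite /c -mulrBr mulr_gt0// subr_gt0 ltr_pXn2r ?nnegrE// ltW// (lt_trans s'0).
  have := sqr_ge_expR t h0; rewrite /m => h.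
  have -> : expR (- c s * t ^+ 2) = expR (- (c s - c s') * t ^+ 2) * expR (- c s' * t ^+ 2).
    by rewrite -expRD; congr expR; ring.
  have := expR_gt0 (- c s' * t ^+ 2); set F := expR (- c s' * _) => F0.
  apply: le_trans (ler_wpM2r (ltW F0) h).
  by rewrite le_eqVlt; apply/orP; left; apply/eqP; ring.
have iD s s' : 0 < s -> 0 < s' -> leb.-integrable setT
    (EFin \o (fun t : R => (expR (- c s' * t ^+ 2) - expR (- c s * t ^+ 2)) / (c s - c s'))).
  move=> s0 s'0; have := integrableZr measurableT (c s - c s')^-1 (integrableB measurableT (iE _ s'0) (iE _ s0)).
  by [].
have DE s s' : 0 < s' -> s' < s -> Rintegral leb setT
    (fun t : R => (expR (- c s' * t ^+ 2) - expR (- c s * t ^+ 2)) / (c s - c s')) =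
    J * 2 / (s * s' * (s + s')).
  move=> s'0 s's; have s0 : 0 < s by exact: lt_trans s's.
  rewrite RintegralZr//; last exact: (integrableB measurableT (iE _ s'0) (iE _ s0)).
  rewrite RintegralB//; [|exact: iE|exact: iE].
  have e1 : s != 0 by rewrite gt_eqF.
  have e2 : s' != 0 by rewrite gt_eqF.
  have e3 : s - s' != 0 by rewrite gt_eqF// subr_gt0.
  have e4 : s + s' != 0 by rewrite gt_eqF// addr_gt0.
  have -> : c s - c s' = (s - s') * (s + s') / 2 by rewrite /c; field.
  by rewrite !JE//; field; rewrite e1 e2 e3 e4.
have im s : 0 < s -> leb.-integrable setT (EFin \o m s).
  move=> s0; have s2 : 0 < s / 2 by rewrite divr_gt0.
  have ss2 : s / 2 < s by lra.
  apply: (@le_integrable _ _ _ leb setT measurableT _ _ _ _ (iD _ _ s0 s2)).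
    by apply/measurable_EFinP; exact: mm.
  move=> t _; rewrite !abse_EFin lee_fin.
  rewrite ger0_norm; last by rewrite mulr_ge0 ?sqr_ge0 ?expR_ge0.
  by apply: le_trans (ler_norm _); exact: up.
pose M := Rintegral leb setT (m 1).
have ME : (\int[leb]_t (t ^+ 2 * expR (- 2^-1 * t ^+ 2))%:E = M%:E)%E.
  rewrite /M /Rintegral /m c1 fineK//; have := integrable_fin_num measurableT (im 1 ltr01).
  by rewrite /m c1.
(* As [s] tends to 1 from either side, both bounds tend to [J]. *)
have h1 s : 1 < s -> J * 2 / (s * (s + 1)) <= M.
  move=> s1; have s0 : 0 < s by lra.
  have := DE s 1 ltr01 s1; rewrite mulr1 => <-.
  by apply: le_Rintegral => //; [exact: iD|exact: im|move=> t _; exact: lo].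
have h2 s : 0 < s -> s < 1 -> M <= J * 2 / (s * (s + 1)).
  move=> s0 s1; have := DE 1 s s0 s1; rewrite mul1r [1 + s]addrC => <-.
  by apply: le_Rintegral => //; [exact: im|exact: iD|move=> t _; exact: up].
have J0 : 0 <= J by exact: sqrtr_ge0.
have M0 : 0 <= M by apply: Rintegral_ge0 => t _; rewrite mulr_ge0 ?sqr_ge0 ?expR_ge0.
have M1 : 0 < 2 * (M + 1) by lra.
have hd e : 0 < e -> exists d, [/\ 0 < d, d <= 2^-1 & d * (2 * (M + 1)) <= e].
  move=> e0; exists (Num.min 2^-1 (e / (2 * (M + 1)))); split.
  - by rewrite lt_min divr_gt0 ?andbT//; lra.
  - by rewrite ge_min lexx.
  - by rewrite -ler_pdivlMr// ge_min lexx orbT.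
rewrite ME; congr (_%:E); rewrite -/J; clearbody J M; clear -hd h1 h2 J0 M0.
apply: le_anti; apply/andP; split; apply/ler_addgt0Pr => e /hd[d [d0 d1 d2]];
  have dM := mulr_ge0 (ltW d0) M0; have ddM := mulr_ge0 (ltW d0) dM; have dJ := mulr_ge0 (ltW d0) J0.
- have := h2 (1 - d); rewrite ler_pdivlMr; last by rewrite mulr_gt0; lra.
  by move=> /(_ ltac:(lra) ltac:(lra)); nra.
- have := h1 (1 + d); rewrite ler_pdivrMr; last by rewrite mulr_gt0; lra.
  by move=> /(_ ltac:(lra)); nra.
Qed.

End gaussian_1d.

Section mat_gauss.
Context {R : realType} {n p : nat}.
Local Notation mat := 'M[R]_(n, p).
Local Notation idx := ('I_n * 'I_p)%type.
Implicit Types (f g : mat -> R) (X : mat) (k l m : idx) (c C : R).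

Definition intg f := mat_leb.-integrable setT (EFin \o f).
Definition lint f : R := Rintegral mat_leb setT f.

Lemma intg_le f g : measurable_fun setT f -> intg g -> (forall X, `|f X| <= g X) -> intg f.
Proof.
move=> mf gi fg; apply: (@le_integrable _ _ _ mat_leb setT measurableT _ _ _ _ gi).
  exact/measurable_EFinP.
by move=> X _; rewrite /= lee_fin; apply: le_trans (fg X) (ler_norm _).
Qed.

Lemma intgD f g : intg f -> intg g -> intg (fun X => f X + g X).
Proof. by move=> fi gi; have := integrableD measurableT fi gi. Qed.

Lemma intgB f g : intg f -> intg g -> intg (fun X => f X - g X).
Proof. by move=> fi gi; have := integrableB measurableT fi gi. Qed.

Lemma intgZ c f : intg f -> intg (fun X => c * f X).
Proof. by move=> fi; have := integrableZl measurableT c fi. Qed.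

Lemma intg_norm f : intg f -> intg (fun X => `|f X|).
Proof.
by move=> fi; apply: eq_integrable (integrable_abse fi) => // X _.
Qed.

Lemma lintD f g : intg f -> intg g -> lint (fun X => f X + g X) = lint f + lint g.
Proof. by move=> fi gi; exact: RintegralD. Qed.

Lemma lintB f g : intg f -> intg g -> lint (fun X => f X - g X) = lint f - lint g.
Proof. by move=> fi gi; exact: RintegralB. Qed.

Lemma lintZ c f : intg f -> lint (fun X => c * f X) = c * lint f.
Proof. by move=> fi; exact: RintegralZl. Qed.

Lemma le_lint f g : intg f -> intg g -> (forall X, f X <= g X) -> lint f <= lint g.
Proof. by move=> fi gi fg; apply: le_Rintegral => // X _. Qed.

Lemma le_norm_lint f g : intg f -> intg g -> (forall X, `|f X| <= g X) -> `|lint f| <= lint g.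
Proof.
move=> fi gi fg; apply: le_trans (le_normr_Rintegral measurableT fi) _.
by apply: le_lint => //; exact: intg_norm.
Qed.

Lemma intg_lint_sum (I : finType) (F : I -> mat -> R) : (forall i, intg (F i)) ->
  intg (fun X => \sum_i F i X) /\ lint (fun X => \sum_i F i X) = \sum_i lint (F i).
Proof.
move=> Fi; rewrite unlock; elim: (index_enum I) => [|i r [ir IH]] /=.
  split.
    by apply: eq_integrable (integrable0 _ setT) => // X _.
  by rewrite /lint /Rintegral integral0_eq.
by split; [exact: intgD|rewrite lintD// IH].
Qed.

Lemma lint_affine (th : mat) (c : mat) f : (forall a i, c a i != 0) -> intg f ->
  lint (fun X => f (mat_affine th c X)) = (\prod_(k : idx) `|c k.1 k.2|^-1) * lint f.
Proof. by move=> c0 fi; exact: Rintegral_mat_affine. Qed.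

Lemma lint_scale (th : mat) c f : 0 < c -> intg f ->
  intg (fun X => f (th + c *: X)) /\
  lint (fun X => f (th + c *: X)) = c ^- #|{: idx}| * lint f.
Proof.
move=> c0 fi; have cn0 a i : (const_mx c : mat) a i != 0 by rewrite mxE gt_eqF.
have E X : th + c *: X = mat_affine th (const_mx c) X by apply/matrixP => a i; rewrite !mxE.
split.
  by under eq_fun do rewrite E; have := integrable_mat_affine th cn0 fi.
under eq_fun do rewrite E; rewrite lint_affine//; congr (_ * _).
under eq_bigr do rewrite mxE gtr0_norm//.
by rewrite prodr_const exprVn.
Qed.

(** Sign changes of entries preserve Lebesgue measure; every vanishing Gaussian moment below comes
    from such a symmetry. *)
Lemma lint_flip (e : idx -> R) f : (forall k, `|e k| = 1) -> intg f ->
  (forall X, f (\matrix_(a, i) (e (a, i) * X a i)) = - f X) -> lint f = 0.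
Proof.
move=> e1 fi fe; pose c : mat := \matrix_(a, i) e (a, i).
have cn0 a i : c a i != 0 by rewrite mxE -normr_eq0 e1 oner_eq0.
have := lint_affine 0 cn0 fi.
have -> : (fun X => f (mat_affine 0 c X)) = (fun X => (-1) * f X).
  apply/funext => X; rewrite mulN1r -fe; congr f.
  by apply/matrixP => a i; rewrite !mxE add0r.
rewrite lintZ// big1 ?mul1r => [|k _]; first by lra.
by rewrite mxE e1 invr1.
Qed.

Lemma integral_gauss_prod (h : idx -> R -> R) (v : idx -> R) :
  (forall k t, 0 <= h k t) -> (forall k, measurable_fun setT (h k)) ->
  (forall k, (\int[@lebesgue_measure R]_t (h k t)%:E = (v k)%:E)%E) ->
  intg (fun X => \prod_k h k (X k.1 k.2)) /\ lint (fun X => \prod_k h k (X k.1 k.2)) = \prod_k v k.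
Proof.
move=> h0 mh hv.
have E : (\int[mat_leb]_X (\prod_k h k ((X : mat) k.1 k.2))%:E = (\prod_k v k)%:E)%E.
  under eq_integral do rewrite -prodEFin.
  rewrite (ge0_integral_mat_prod (f := fun k t => (h k t)%:E)).
  - by rewrite (eq_bigr (fun k => (v k)%:E)) ?prodEFin// => k _; exact: hv.
  - by move=> k t; rewrite lee_fin.
  - by move=> k; exact/measurable_EFinP.
split; last by rewrite /lint /Rintegral E.
apply/integrableP; split.
  apply/measurable_EFinP; apply: measurable_prod => k _.
  by apply: (measurableT_comp (mh k)); exact: measurable_coord.
by under eq_integral do rewrite /= ger0_norm ?prodr_ge0//; rewrite E ltry.
Qed.

Lemma expR_sq c X : expR (- c * sq X) = \prod_k expR (- c * X k.1 k.2 ^+ 2).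
Proof. by rewrite -expR_sum mulr_sumr. Qed.

Lemma intg_gauss c : 0 < c -> intg (fun X => expR (- c * sq X)).
Proof.
move=> c0; have [+ _] := integral_gauss_prod (h := fun _ t => expR (- c * t ^+ 2))
  (v := fun=> Num.sqrt (pi / c)) (fun _ _ => expR_ge0 _) (fun _ => measurable_expR_sqr _) (fun _ => integral_expR_sqr c0).
by under eq_fun do rewrite -expR_sq.
Qed.

Definition gs X : R := \prod_(k : idx) (Num.sqrt (1 / (2 * pi)) * expR (- 2^-1 * X k.1 k.2 ^+ 2)).
Definition kap : R := \prod_(k : idx) Num.sqrt (1 / (2 * pi)).

Lemma kap_gt0 : 0 < kap.
Proof. by apply: prodr_gt0 => k _; rewrite sqrtr_gt0 divr_gt0// mulr_gt0// pi_gt0. Qed.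

Lemma gsE X : gs X = kap * expR (- 2^-1 * sq X).
Proof. by rewrite /gs big_split expR_sq. Qed.

Lemma gs_ge0 X : 0 <= gs X.
Proof. by rewrite gsE mulr_ge0 ?expR_ge0// ltW// kap_gt0. Qed.

Lemma gsN X : gs (- X) = gs X. Proof. by rewrite !gsE sqN. Qed.

Lemma measurable_gs : measurable_fun setT gs.
Proof.
apply: measurable_prod => k _; apply: measurable_funM; first exact: measurable_cst.
by apply: (measurableT_comp (measurable_expR_sqr 2^-1)); exact: measurable_coord.
Qed.

Lemma sqrt_normal : Num.sqrt (1 / (2 * pi)) * Num.sqrt (pi / 2^-1) = 1 :> R.
Proof.
have p0 := pi_gt0 R; rewrite -sqrtrM ?divr_ge0 ?mulr_ge0 ?ltW//.
have pn : pi != 0 :> R by rewrite gt_eqF.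
have -> : 1 / (2 * pi) * (pi / 2^-1) = 1 :> R.
  by rewrite invrK mul1r mulrC [2 * _]mulrC mulfV// mulf_neq0// pnatr_eq0.
by rewrite sqrtr1.
Qed.

Lemma integral_normal_density :
  (\int[@lebesgue_measure R]_t (Num.sqrt (1 / (2 * pi)) * expR (- 2^-1 * t ^+ 2))%:E = 1%:E)%E.
Proof.
under eq_integral do rewrite EFinM.
rewrite ge0_integralZl// ?integral_expR_sqr// -?EFinM ?sqrt_normal//.
by apply/measurable_EFinP; exact: measurable_expR_sqr.
Qed.

Lemma measurable_normal_density :
  measurable_fun setT (fun t : R => Num.sqrt (1 / (2 * pi)) * expR (- 2^-1 * t ^+ 2)).
Proof. by apply: measurable_funM => //; exact: measurable_expR_sqr. Qed.

Lemma lint_gs : intg gs /\ lint gs = 1.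
Proof.
have [] := integral_gauss_prod (h := fun _ t => Num.sqrt (1 / (2 * pi)) * expR (- 2^-1 * t ^+ 2))
  (v := fun=> 1) _ (fun=> measurable_normal_density) (fun=> integral_normal_density).
  by move=> k t; rewrite mulr_ge0 ?expR_ge0 ?sqrtr_ge0.
by rewrite big1.
Qed.

Lemma sq_le_expR e : 0 < e -> exists2 K, 1 <= K & forall X,
  [/\ nm X <= K * expR (e * sq X), sq X <= K * expR (e * sq X) & 1 <= K * expR (e * sq X)].
Proof.
move=> e0; exists (1 + e^-1); first by rewrite lerDl invr_ge0 ltW.
move=> X; have s0 := sq_ge0 X; have := nm_ge0 X; have := nm_sqr X.
have h1 := expR_ge1Dx (e * sq X); set E := expR _ in h1 *; set q := sq X in h1 s0 *.
have i0 : 0 < e^-1 by rewrite invr_gt0.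
have ie : e^-1 * e = 1 by rewrite mulVf// gt_eqF.
have eq0 : 0 <= e * q by rewrite mulr_ge0// ltW.
have E1 : 1 <= E by lra.
have iE : e^-1 + q <= e^-1 * E.
  by apply: le_trans (ler_wpM2l (ltW i0) h1); rewrite mulrDr mulrA ie mul1r mulr1.
move=> m2 m0; have : 0 <= (nm X - 1) ^+ 2 by exact: sqr_ge0.
by split; nra.
Qed.

(** Integrability is carried along with the value, so that moments of polynomials are assembled by
    linearity in one go. *)
Definition mom f (v : R) := intg (fun w => f w * gs w) /\ lint (fun w => f w * gs w) = v.

Lemma gs_moment_intg f c C : measurable_fun setT f -> c < 2^-1 ->
  (forall X, `|f X| <= C * expR (c * sq X)) -> intg (fun X => f X * gs X).
Proof.
move=> mf c1 fC; have c0 : 0 < 2^-1 - c by rewrite subr_gt0.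
apply: intg_le (intgZ (C * kap) (intg_gauss c0)) _.
  by apply: measurable_funM => //; exact: measurable_gs.
move=> X; rewrite normrM (ger0_norm (gs_ge0 X)) gsE.
apply: le_trans (ler_wpM2r _ (fC X)) _; first by rewrite mulr_ge0 ?expR_ge0 ?ltW ?kap_gt0.
have -> : - (2^-1 - c) * sq X = c * sq X + - 2^-1 * sq X by ring.
rewrite expRD le_eqVlt; apply/orP; left; apply/eqP; ring.
Qed.

Lemma lint_gs2_diag k : lint (fun X => (X k.1 k.2 * X k.1 k.2) * gs X) = 1.
Proof.
pose q (t : R) : R := Num.sqrt (1 / (2 * pi)) * expR (- 2^-1 * t ^+ 2).
have q0 t : 0 <= q t by rewrite mulr_ge0 ?expR_ge0 ?sqrtr_ge0.
pose h l t : R := (if l == k then t ^+ 2 else 1) * q t.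
have h0 l t : 0 <= h l t by rewrite /h; case: (l == k); rewrite mulr_ge0 ?sqr_ge0.
have mh l : measurable_fun setT (h l).
  rewrite /h; apply: measurable_funM; last exact: measurable_normal_density.
  by case: (l == k) => //; exact: measurable_funX.
have hv l : (\int[@lebesgue_measure R]_t (h l t)%:E = 1%:E)%E.
  rewrite /h /q; case: (l == k); last first.
    by under eq_integral do rewrite mul1r; exact: integral_normal_density.
  under eq_integral do rewrite mulrCA EFinM.
  rewrite ge0_integralZl// ?integral_sqr_expR// -?EFinM ?sqrt_normal//.
    by apply/measurable_EFinP; apply: measurable_funM;
      [exact: measurable_funX|exact: measurable_expR_sqr].
  by move=> t _; rewrite lee_fin mulr_ge0 ?sqr_ge0 ?expR_ge0.
have [_] := integral_gauss_prod h0 mh hv; rewrite big1// => <-.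
congr lint; apply/funext => X; rewrite /h big_split/= -/(gs X); congr (_ * _).
by rewrite (bigD1 k)//= eqxx big1 ?mulr1 ?expr2// => l /negbTE ->.
Qed.

Lemma entry_le_expR e : 0 < e -> exists2 K, 1 <= K & forall X k, `|X k.1 k.2| <= K * expR (e * sq X).
Proof.
move=> e0; have [K K1 h] := sq_le_expR e0; exists K => // X k.
by have [+ _ _] := h X; apply: le_trans; exact: nm_entry.
Qed.

Lemma measurable_entry k : measurable_fun setT (fun X => X k.1 k.2).
Proof. exact: measurable_coord. Qed.

Lemma mom0 : mom (fun _ : mat => 1) 1.
Proof. by rewrite /mom; under eq_fun do rewrite mul1r; exact: lint_gs. Qed.

(** Three entries bounded at this rate cost [3/8], below the [1/2] of the Gaussian. *)
Let e8 : 0 < 8^-1 :> R. Proof. by lra. Qed.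

Lemma mom_odd f : intg (fun X => f X * gs X) -> (forall X, f (- X) = - f X) -> mom f 0.
Proof.
move=> fi fN; split=> //; apply: (lint_flip (e := fun=> -1)) => [l||X]; [by rewrite normrN1|by []|].
have -> : (\matrix_(a, i) (-1 * X a i) : mat) = - X by apply/matrixP => a i; rewrite !mxE mulN1r.
by rewrite gsN fN mulNr.
Qed.

Lemma mom1 k : mom (fun X => X k.1 k.2) 0.
Proof.
apply: mom_odd => [|X]; last by rewrite mxE.
have [K K1 h] := entry_le_expR e8.
by apply: (gs_moment_intg (c := 8^-1) (C := K)) => //; [exact: measurable_entry|lra].
Qed.

Lemma mom2 k l : mom (fun X => X k.1 k.2 * X l.1 l.2) (k == l)%:R.
Proof.
have i2 : intg (fun X => (X k.1 k.2 * X l.1 l.2) * gs X).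
  have [K K1 h] := entry_le_expR e8.
  apply: (gs_moment_intg (c := 4^-1) (C := K * K)).
  - by apply: measurable_funM; exact: measurable_entry.
  - lra.
  move=> X; rewrite normrM; apply: le_trans (ler_pM _ _ (h X k) (h X l)) _ => //.
  rewrite mulrACA -expRD (_ : 8^-1 * sq X + _ = 4^-1 * sq X)//; lra.
split=> //; have [<-|kl] := eqVneq k l; first exact: lint_gs2_diag.
apply: (lint_flip (e := fun m => if m == k then -1 else 1)) => [j||X] //.
  by case: (j == k); rewrite ?normrN1 ?normr1.
set Y := \matrix_(a, i) _.
have E j : Y j.1 j.2 = (if j == k then -1 else 1) * X j.1 j.2 by rewrite mxE -surjective_pairing.
have -> : gs Y = gs X.
  rewrite !gsE; congr (_ * expR (_ * _)); apply: eq_bigr => j _.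
  by rewrite E exprMn; case: (j == k); rewrite ?sqrrN ?expr1n mul1r.
by rewrite !E eqxx eq_sym (negbTE kl); ring.
Qed.

Lemma mom3 k l m : mom (fun X => X k.1 k.2 * X l.1 l.2 * X m.1 m.2) 0.
Proof.
apply: mom_odd => [|X]; last by rewrite !mxE; ring.
have [K K1 h] := entry_le_expR e8.
apply: (gs_moment_intg (c := 3 / 8) (C := K * K * K)).
- by apply: measurable_funM; [apply: measurable_funM|]; exact: measurable_entry.
- lra.
move=> X; rewrite !normrM.
have h2 := ler_pM (normr_ge0 _) (normr_ge0 _) (h X k) (h X l).
apply: le_trans (ler_pM (mulr_ge0 (normr_ge0 _) (normr_ge0 _)) (normr_ge0 _) h2 (h X m)) _.
have -> : 3 / 8 * sq X = 8^-1 * sq X + 8^-1 * sq X + 8^-1 * sq X by lra.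
by rewrite !expRD le_eqVlt; apply/orP; left; apply/eqP; ring.
Qed.

End mat_gauss.

(** * Remainder estimates and the posterior mean *)

Section remainder.
Context {R : realType} {n p : nat}.
Local Notation mat := 'M[R]_(n, p).
Local Notation idx := ('I_n * 'I_p)%type.

(** Positive and negative parts become iterated integrals with parameter [z], whose joint
    measurability is Tonelli's. *)
Lemma measurable_lint_param (F : mat -> mat -> R) :
  measurable_fun setT (fun u : mat * mat => F u.1 u.2) ->
  (forall z, intg (F z)) -> measurable_fun setT (fun z => lint (F z)).
Proof.
move=> mF Fi; pose G (u : mat * mat) := (F u.1 u.2)%:E.
have mG : measurable_fun setT G by exact/measurable_EFinP.
have m0 : measurable_fun setT (fun z : mat => (z, 0 : mat)).
  by apply: measurable_fun_pair => //; exact: measurable_cst.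
have mFz z : measurable_fun setT (EFin \o F z) by exact: measurable_int (Fi z).
have -> : (fun z => lint (F z)) = (fun z =>
    fine (eiint (enum [set: idx]) (fun X => (G^\+)%E (z, X)) 0) -
    fine (eiint (enum [set: idx]) (fun X => (G^\-)%E (z, X)) 0)).
  apply/funext => z; rewrite /lint integrable_posneg; last exact: Fi.
  rewrite !ge0_integral_mat_leb//; [|exact: measurable_funeneg|exact: measurable_funepos].
  by congr (fine _ - fine _); apply: eq_eiint => X; rewrite ?funeposE ?funenegE.
have mfine (E : mat * mat -> \bar R) : (forall u, 0 <= E u)%E -> measurable_fun setT E ->
    measurable_fun setT (fun z : mat => fine (eiint (enum [set: idx]) (fun X => E (z, X)) 0)).
  move=> E0 mE; apply: measurableT_comp => //.
  exact: (measurableT_comp (measurable_eiint_param (enum [set: idx]) E0 mE) m0).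
exact: (measurable_funB (mfine _ (fun u => funepos_ge0 G u) (measurable_funepos mG))
  (mfine _ (fun u => funeneg_ge0 G u) (measurable_funeneg mG))).
Qed.

Lemma lint_ge0 (f : mat -> R) : (forall X, 0 <= f X) -> 0 <= lint f.
Proof. by move=> f0; apply: Rintegral_ge0 => X _; exact: f0. Qed.

(** From [exp x >= (x / j)^j] with [j = m + 1], whence [q = (m + 1) / a]. It makes the prior mass
    away from [th] negligible against the powers of [1 / s] lost by rescaling. *)
Lemma expR_inv_sqr_le (a : R) (m : nat) : 0 < a -> exists2 C, 0 <= C & forall s, 0 < s ->
  s ^- m.+1 * expR (- (a / s ^+ 2)) <= C * s ^+ m.+1.
Proof.
move=> a0; pose q := m.+1%:R / a; have q0 : 0 < q by rewrite divr_gt0// ltr0n.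
exists (q ^+ m.+1); first by rewrite exprn_ge0// ltW.
move=> s s0; have s20 : 0 < s ^+ 2 by rewrite exprn_gt0.
have mn : m.+1%:R != 0 :> R by rewrite pnatr_eq0.
have h : (q * s ^+ 2) ^- m.+1 <= expR (a / s ^+ 2).
  have -> : a / s ^+ 2 = (q * s ^+ 2)^-1 *+ m.+1.
    rewrite -mulr_natr /q; have an : a != 0 by rewrite gt_eqF.
    have sn : s != 0 by rewrite gt_eqF.
    by clear -an sn mn; move: (m.+1%:R : R) mn => M mn; field; rewrite an sn mn.
  rewrite -mulr_natr expRM_natr -exprVn; apply: lerXn2r.
  - by rewrite nnegrE invr_ge0 ltW// mulr_gt0.
  - by rewrite nnegrE expR_ge0.
  - by apply: le_trans (expR_ge1Dx _); rewrite lerDr.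
have s1 : 0 < s ^+ m.+1 by rewrite exprn_gt0.
rewrite expRN mulrC ler_pdivrMr//; have qs : 0 < (q * s ^+ 2) ^+ m.+1 by rewrite exprn_gt0// mulr_gt0.
have -> : q ^+ m.+1 * s ^+ m.+1 * s ^+ m.+1 = (q * s ^+ 2) ^+ m.+1.
  by rewrite [RHS]exprMn exprAC [s ^+ m.+1 ^+ 2]expr2 mulrA.
by rewrite -[leRHS]invrK lef_pV2 ?posrE ?invr_gt0 ?expR_gt0.
Qed.

Variables (pr : mat -> R) (th : mat) (c0 : R) (L : idx -> R) (H : idx -> idx -> R).
Hypotheses (mpr : measurable_fun setT pr) (pr0 : forall X, 0 <= pr X).
Hypothesis pri : forall c, 0 < c -> intg (fun X => expR (- c * sq X) * pr X).
Hypothesis jpr : jet pr th c0 L H.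

Definition rem (s : R) (x : mat) : R :=
  s ^- 2 * (pr (th + s *: x) - (c0 + s * lin L x + s ^+ 2 * quad H x / 2)).

Lemma remE s x : s != 0 -> pr (th + s *: x) = c0 + s * lin L x + s ^+ 2 * quad H x / 2 + s ^+ 2 * rem s x.
Proof. by move=> s0; rewrite /rem mulrA mulfV ?expf_neq0// mul1r [RHS]addrC subrK. Qed.

Lemma sqD_le (X Y : mat) : sq (X + Y) <= 2 * sq X + 2 * sq Y.
Proof.
rewrite /sq !mulr_sumr -big_split/=; apply: ler_sum => k _; rewrite mxE.
have : 0 <= (X k.1 k.2 - Y k.1 k.2) ^+ 2 by exact: sqr_ge0.
by nra.
Qed.

Lemma measurable_shift (s : R) : measurable_fun setT (fun x : mat => th + s *: x).
Proof.
apply: measurable_fun_mat => a i; under eq_fun do rewrite !mxE.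
apply: measurable_funD => //; apply: measurable_funM => //; exact: measurable_coord.
Qed.

Lemma measurable_pr_shift (s : R) : measurable_fun setT (fun x : mat => pr (th + s *: x)).
Proof. by apply: measurableT_comp => //; exact: measurable_shift. Qed.

Lemma measurable_expR_sq (c : R) : measurable_fun setT (fun x : mat => expR (c * sq x)).
Proof.
by apply: measurableT_comp => //; apply: measurable_funM => //; exact: measurable_sq.
Qed.

(** For [s <= 1] a Gaussian in [x] is dominated by one in [th + s *: x], where [pri] applies. The
    Jacobian loss is crude, but it is incurred only far from [th], where an exponentially small
    factor compensates it. *)
Lemma pr_shift (c : R) : 0 < c -> exists2 K, 0 <= K & forall s, 0 < s -> s <= 1 ->
  intg (fun x => expR (- c * sq x) * pr (th + s *: x)) /\
  lint (fun x => expR (- c * sq x) * pr (th + s *: x)) <= K * s ^- #|{: idx}|.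
Proof.
move=> cp; have c2 : 0 < c / 2 by rewrite divr_gt0.
pose G X := expR (- (c / 2) * sq X) * pr X.
have G0 X : 0 <= G X by rewrite mulr_ge0// expR_ge0.
exists (expR (c * sq th) * lint G).
  by rewrite mulr_ge0 ?expR_ge0 ?lint_ge0.
move=> s s0 s1; have [iG lG] := lint_scale th s0 (pri c2).
have le x : expR (- c * sq x) * pr (th + s *: x) <= expR (c * sq th) * G (th + s *: x).
  rewrite /G mulrA ler_wpM2r// -expRD ler_expR.
  have := sqD_le th (s *: x); rewrite sqZ => h.
  have x0 := sq_ge0 x; have s2 : s ^+ 2 * sq x <= sq x.
    by rewrite ler_piMl// exprn_ile1 ?(ltW s0).
  by nra.
have ii : intg (fun x => expR (- c * sq x) * pr (th + s *: x)).
  apply: intg_le (intgZ (expR (c * sq th)) iG) _.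
    by apply: measurable_funM; [exact: measurable_expR_sq|exact: measurable_pr_shift].
  by move=> x; rewrite ger0_norm ?mulr_ge0 ?expR_ge0.
split => //; apply: le_trans (le_lint ii (intgZ _ iG) le) _.
by rewrite lintZ// lG mulrA mulrAC.
Qed.

Lemma measurable_lin (K : idx -> R) : measurable_fun setT (fun x : mat => lin K x).
Proof.
apply: measurable_sum => k; apply: measurable_funM => //; exact: measurable_coord.
Qed.

Lemma measurable_quad (K : idx -> idx -> R) : measurable_fun setT (fun x : mat => quad K x).
Proof.
apply: measurable_sum => k; apply: measurable_sum => l; apply: measurable_funM => //.
by apply: measurable_funM; exact: measurable_coord.
Qed.

Lemma measurable_rem (s : R) : measurable_fun setT (rem s).
Proof.
apply: measurable_funM => //; apply: measurable_funB; first exact: measurable_pr_shift.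
apply: measurable_funD; last first.
  by apply: measurable_funM => //; apply: measurable_funM => //; exact: measurable_quad.
by apply: measurable_funD => //; apply: measurable_funM => //; exact: measurable_lin.
Qed.

Lemma poly_le_expR (e : R) : 0 < e -> exists2 K, 0 <= K & forall x : mat,
  `|c0| + `|lin L x| + `|quad H x| <= K * expR (e * sq x).
Proof.
move=> e0; have [KL KL0 hL] := lin_bound L; have [KH KH0 hH] := quad_bound H.
have [K K1 hK] := sq_le_expR (n := n) (p := p) e0.
have K0 : 0 <= K by lra.
exists (`|c0| * K + KL * K + KH * K); first by rewrite !addr_ge0// mulr_ge0.
move=> x; have [h1 h2 h3] := hK x; rewrite !mulrDl -!mulrA.
apply: lerD; first apply: lerD.
- by rewrite -[leLHS]mulr1 ler_wpM2l.
- by apply: le_trans (hL x) _; rewrite ler_wpM2l.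
- by apply: le_trans (hH x) _; rewrite nm_sqr ler_wpM2l.
Qed.

Lemma taylor_error_le (s : R) (x : mat) : 0 < s -> s <= 1 ->
  `|pr (th + s *: x) - (c0 + s * lin L x + s ^+ 2 * quad H x / 2)| <=
  pr (th + s *: x) + (`|c0| + `|lin L x| + `|quad H x|).
Proof.
move=> s0 s1; apply: le_trans (ler_normB _ _) _; rewrite ger0_norm// lerD2l.
apply: le_trans (ler_normD _ _) _; apply: lerD.
  apply: le_trans (ler_normD _ _) _; rewrite lerD2l normrM gtr0_norm//.
  by rewrite ler_piMl.
have q0 := normr_ge0 (quad H x).
have s2 : s ^+ 2 <= 1 by rewrite exprn_ile1 ?(ltW s0).
have h2 : `|2^-1 : R| = 2^-1 by rewrite ger0_norm.
rewrite -mulrA normrM (ger0_norm (sqr_ge0 s)) normrM h2.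
have h0 : 0 <= `|quad H x| / 2 by lra.
by apply: le_trans (ler_piMl h0 s2) _; lra.
Qed.

Lemma taylor_gauss_le (b : R) : 0 < b -> exists2 C, 0 <= C & forall s x, 0 < s -> s <= 1 ->
  expR (- b * sq x) * `|pr (th + s *: x) - (c0 + s * lin L x + s ^+ 2 * quad H x / 2)| <=
  expR (- b * sq x) * pr (th + s *: x) + C * expR (- (b / 2) * sq x).
Proof.
move=> b0; have b2 : 0 < b / 2 by rewrite divr_gt0.
have [C C0 hC] := poly_le_expR b2; exists C => // s x s0 s1.
have h := le_trans (taylor_error_le x s0 s1) (lerD (lexx _) (hC x)).
apply: le_trans (ler_wpM2l (expR_ge0 _) h) _; rewrite mulrDr lerD2l mulrCA ler_wpM2l//.
by rewrite -expRD ler_expR le_eqVlt; apply/orP; left; apply/eqP; field.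
Qed.

Lemma expR_half (b q : R) : expR (- b * q) = expR (- (b / 2) * q) * expR (- (b / 2) * q).
Proof. by rewrite -expRD -mulrDl -opprD -splitr. Qed.

Lemma intg_rem (b s : R) : 0 < b -> 0 < s -> s <= 1 ->
  intg (fun x => expR (- b * sq x) * `|rem s x|).
Proof.
move=> b0 s0 s1; have [K K0 hK] := pr_shift b0; have [ipr _] := hK s s0 s1.
have b2 : 0 < b / 2 by rewrite divr_gt0.
have [C C0 hC] := taylor_gauss_le b0.
have i2 := intgZ C (intg_gauss (n := n) (p := p) b2).
apply: intg_le (intgZ (s ^- 2) (intgD ipr i2)) _.
  apply: measurable_funM; first exact: measurable_expR_sq.
  by apply: measurableT_comp => //; exact: measurable_rem.
move=> x; rewrite normrM normr_id (ger0_norm (expR_ge0 _)) /rem normrM.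
have s2 : 0 < s ^- 2 by rewrite invr_gt0 exprn_gt0.
rewrite (gtr0_norm s2) mulrCA ler_pM2l//.
exact: hC.
Qed.

(** Near [th] the jet bounds [rem] by [e' |x|^2]. Where [|s x| > d] only integrability controls the
    prior, and half of the Gaussian is traded for [exp (- b d^2 / (2 s^2))], which beats both the
    factor [s^-2] and the Jacobian [s^(-np)]. *)
Lemma rem_lim (b e : R) : 0 < b -> 0 < e -> exists2 s1, 0 < s1 & forall s, 0 < s -> s <= s1 ->
  lint (fun x => expR (- b * sq x) * `|rem s x|) <= e.
Proof.
move=> b0 e0; have b2 : 0 < b / 2 by rewrite divr_gt0.
have b4 : 0 < b / 2 / 2 by rewrite divr_gt0.
have i4 := intg_gauss (n := n) (p := p) b4.
have [K2 K21 hK2] := sq_le_expR (n := n) (p := p) b2.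
have K20 : 0 <= K2 by apply: le_trans K21.
pose I2 := lint (fun x : mat => expR (- (b / 2) * sq x)).
pose I4 := lint (fun x : mat => expR (- (b / 2 / 2) * sq x)).
have I20 : 0 <= I2 by apply: lint_ge0 => x; rewrite expR_ge0.
have I40 : 0 <= I4 by apply: lint_ge0 => x; rewrite expR_ge0.
have KI : 0 < 2 * (K2 * I2 + 1) by rewrite mulr_gt0// ltr_wpDl// mulr_ge0.
pose e' := e / (2 * (K2 * I2 + 1)); have e'0 : 0 < e' by rewrite divr_gt0.
have [d d0 hd] := jpr e'0.
pose a := b / 2 * d ^+ 2; have a0 : 0 < a by rewrite mulr_gt0// exprn_gt0.
have [C C0 hC] := expR_inv_sqr_le #|{: idx}|.+1 a0.
have [K K0 hK] := pr_shift b2.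
have [C4 C40 hC4] := taylor_gauss_le b2.
pose T := C * (K + C4 * I4).
have T0 : 0 <= T by rewrite mulr_ge0// addr_ge0// mulr_ge0.
have T1 : 0 < 2 * (T + 1) by rewrite mulr_gt0// ltr_wpDl.
exists (Num.min 1 (e / (2 * (T + 1)))); first by rewrite lt_min ltr01 divr_gt0.
move=> s s0; rewrite le_min => /andP[s1]; rewrite ler_pdivlMr// => sT.
have s20 : 0 < s ^+ 2 by rewrite exprn_gt0.
have sV : 0 < s ^- 2 by rewrite invr_gt0.
pose eta := s ^- 2 * expR (- (a / s ^+ 2)).
have eta0 : 0 <= eta by rewrite mulr_ge0 ?expR_ge0// ltW.
have [ipr lpr] := hK s s0 s1.
have i2 := intg_gauss (n := n) (p := p) b2.
pose f1 (x : mat) := e' * K2 * expR (- (b / 2) * sq x).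
pose f2 (x : mat) := eta * (expR (- (b / 2) * sq x) * pr (th + s *: x) + C4 * expR (- (b / 2 / 2) * sq x)).
have if1 : intg f1 by exact: intgZ.
have if2 : intg f2 by apply: intgZ; apply: intgD => //; exact: intgZ.
have le x : expR (- b * sq x) * `|rem s x| <= f1 x + f2 x.
  have f10 : 0 <= f1 x by rewrite mulr_ge0 ?expR_ge0// mulr_ge0// ltW.
  have f20 : 0 <= f2 x.
    by rewrite mulr_ge0// addr_ge0// mulr_ge0 ?expR_ge0.
  rewrite /rem normrM (gtr0_norm sV).
  have [near|far] := leP (nm (s *: x)) d.
    rewrite -[leLHS]addr0 lerD// /f1 expR_half.
    have := hd _ near; rewrite linZ quadZ nmZ (gtr0_norm s0) exprMn nm_sqr => h.
    have [_ hs _] := hK2 x.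
    have : expR (b / 2 * sq x) * expR (- (b / 2) * sq x) = 1 by rewrite mulNr expRxMexpNx_1.
    move: hs; set E := expR (- _ * _); set E' := expR (b / 2 * _) => hs EE.
    have E0 : 0 <= E by exact: expR_ge0.
    have h1 : s ^- 2 * `|pr (th + s *: x) - (c0 + s * lin L x + s ^+ 2 * quad H x / 2)| <= e' * sq x.
      by rewrite mulrC ler_pdivrMr// -[leRHS]mulrA [sq x * _]mulrC.
    apply: le_trans (ler_wpM2l (mulr_ge0 E0 E0) h1) _.
    apply: le_trans (ler_wpM2l (mulr_ge0 E0 E0) (ler_wpM2l (ltW e'0) hs)) _.
    rewrite (_ : E * E * (e' * (K2 * E')) = e' * K2 * E * (E' * E)); last by ring.
    by rewrite EE mulr1.
  rewrite -[leLHS]add0r lerD// /f2 /eta -[leRHS]mulrA mulrCA ler_pM2l//.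
  have sd : d ^+ 2 <= s ^+ 2 * sq x.
    by rewrite -sqZ -nm_sqr; apply: lerXn2r; rewrite ?nnegrE ?nm_ge0 ?(ltW d0) ?(ltW far).
  have hE : expR (- (b / 2) * sq x) <= expR (- (a / s ^+ 2)).
    by rewrite ler_expR mulNr lerN2 ler_pdivrMr// /a -[leRHS]mulrA ler_pM2l// mulrC.
  rewrite expR_half -[leLHS]mulrA; apply: ler_pM; rewrite ?expR_ge0//.
  exact: hC4.
apply: le_trans (le_lint (intg_rem b0 s0 s1) (intgD if1 if2) le) _.
rewrite lintD// lintZ// lintZ; last by apply: intgD => //; exact: intgZ.
rewrite lintD//; last exact: intgZ.
rewrite lintZ// -/I2 -/I4.
have h1 : e' * K2 * I2 <= e / 2.
  rewrite /e' -!mulrA ler_pM2l// mulrC ler_pdivrMr// [leRHS](_ : _ = K2 * I2 + 1); last by lra.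
  by rewrite lerDl.
have sd1 : 1 <= s ^- #|{: idx}| by rewrite invf_ge1 ?exprn_gt0// exprn_ile1 ?(ltW s0).
have etaC : eta * s ^- #|{: idx}| <= C * s.
  have -> : eta * s ^- #|{: idx}| = s ^- #|{: idx}|.+2 * expR (- (a / s ^+ 2)).
    by rewrite /eta mulrAC; congr (_ * _); rewrite -invfM -exprD.
  apply: le_trans (hC s s0) _; rewrite ler_wpM2l// exprS ler_piMr ?(ltW s0)//.
  by rewrite exprn_ile1 ?(ltW s0).
have h2 : eta * (lint (fun x => expR (- (b / 2) * sq x) * pr (th + s *: x)) + C4 * I4) <= T * s.
  have h3 : lint (fun x => expR (- (b / 2) * sq x) * pr (th + s *: x)) + C4 * I4 <= (K + C4 * I4) * s ^- #|{: idx}|.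
    by rewrite mulrDl lerD// ler_peMr// mulr_ge0.
  apply: le_trans (ler_wpM2l eta0 h3) _.
  rewrite mulrCA mulrC /T [leRHS]mulrAC ler_wpM2r// addr_ge0// mulr_ge0//.
have h3 : T * s <= e / 2.
  apply: (@le_trans _ _ (s * (2 * (T + 1)) / 2)); last by rewrite ler_pM2r ?invr_gt0.
  by rewrite (_ : s * (2 * (T + 1)) / 2 = T * s + s) ?lerDl ?(ltW s0)//; field.
by rewrite [leRHS]splitr; apply: lerD; [exact: h1|exact: le_trans h2 h3].
Qed.

End remainder.

(** * Expansion of the marginal and of its gradient *)

Section convolution.
Context {R : realType} {n p : nat}.
Local Notation mat := 'M[R]_(n, p).
Local Notation idx := ('I_n * 'I_p)%type.
Local Notation kap := (@kap R n p).
Local Notation mom := (@mom R n p).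

Lemma mom_eq (f g : mat -> R) v : (forall w, g w = f w) -> mom f v -> mom g v.
Proof. by move=> /funext ->. Qed.

Lemma momD f g v u : mom f v -> mom g u -> mom (fun w => f w + g w) (v + u).
Proof.
move=> [fi fv] [gi gu]; rewrite /mom; under eq_fun do rewrite mulrDl.
by split; [exact: intgD|rewrite lintD// fv gu].
Qed.

Lemma momZ c f v : mom f v -> mom (fun w => c * f w) (c * v).
Proof.
move=> [fi fv]; rewrite /mom; under eq_fun do rewrite -mulrA.
by split; [exact: intgZ|rewrite lintZ// fv].
Qed.

Lemma mom_sum (I : finType) (F : I -> mat -> R) (v : I -> R) :
  (forall i, mom (F i) (v i)) -> mom (fun w => \sum_i F i w) (\sum_i v i).
Proof.
move=> h; have [h1 h2] := intg_lint_sum (fun i => (h i).1).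
rewrite /mom; under eq_fun do rewrite mulr_suml.
by split=> //; rewrite h2; apply: eq_bigr => i _; exact: (h i).2.
Qed.

Lemma sum_delta (F : idx -> R) k : \sum_l F l * (k == l)%:R = F k.
Proof.
rewrite (bigD1 k)//= eqxx mulr1 big1 ?addr0// => l lk.
by rewrite eq_sym (negbTE lk) mulr0.
Qed.

Lemma linDr (L : idx -> R) (z w : mat) : lin L (z + w) = lin L z + lin L w.
Proof. by rewrite /lin -big_split; apply: eq_bigr => k _; rewrite mxE mulrDr. Qed.

Lemma mom_lin L : mom (fun w => lin L w) 0.
Proof.
rewrite [X in mom _ X](_ : 0 = \sum_k L k * 0); last by rewrite big1// => k _; rewrite mulr0.
by apply: mom_sum => k; apply: momZ; exact: mom1.
Qed.

Lemma mom_entry_lin L k : mom (fun w => w k.1 k.2 * lin L w) (L k).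
Proof.
rewrite -[X in mom _ X](sum_delta L).
apply: mom_eq (mom_sum (fun l => momZ (L l) (mom2 k l))) => w.
by rewrite mulr_sumr; apply: eq_bigr => l _; ring.
Qed.

Lemma mom_entry_quad H k : mom (fun w => w k.1 k.2 * quad H w) 0.
Proof.
rewrite [X in mom _ X](_ : 0 = \sum_l \sum_m H l m * 0); last first.
  by rewrite big1// => l _; rewrite big1// => m _; rewrite mulr0.
apply: mom_eq (mom_sum (fun l => mom_sum (fun m => momZ (H l m) (mom3 k l m)))) => w.
rewrite mulr_sumr; apply: eq_bigr => l _; rewrite mulr_sumr; apply: eq_bigr => m _.
by ring.
Qed.

Definition symH (H : idx -> idx -> R) (k l : idx) : R := (H k l + H l k) / 2.

Lemma quadDr H (z w : mat) :
  quad H (z + w) = quad H z + 2 * lin (fun l => lin (symH H l) z) w + quad H w.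
Proof.
rewrite /lin; under [X in 2 * X]eq_bigr do rewrite mulr_suml.
rewrite mulr_sumr; under [X in _ + X + _]eq_bigr do rewrite mulr_sumr.
have -> : \sum_i \sum_i0 2 * (symH H i i0 * z i0.1 i0.2 * w i.1 i.2) =
   \sum_i \sum_i0 (H i i0 * (z i0.1 i0.2 * w i.1 i.2)) + \sum_i \sum_i0 H i0 i * (z i0.1 i0.2 * w i.1 i.2).
  rewrite -big_split; apply: eq_bigr => i _; rewrite -big_split; apply: eq_bigr => j _.
  by rewrite /symH /=; field.
rewrite [X in _ + (_ + X) + _]exchange_big /quad /= -!big_split/=; apply: eq_bigr => i _.
by rewrite -!big_split; apply: eq_bigr => j _ /=; rewrite !mxE; ring.
Qed.

(** With Gaussian rate [3/8] in [x - z] and an allowance [1/32] in [z], the best rate left in [x] is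
    their product over their sum, [3/104]. The allowance is [1/32] because eighth powers of [E32]
    appear later, and [8/32] stays below [1/2]. *)
Definition b32 : R := 3 / 104.
Definition E32 (z : mat) : R := expR (32^-1 * sq z).

Lemma E32_ge1 z : 1 <= E32 z.
Proof. by rewrite /E32 -expR0 ler_expR mulr_ge0// sq_ge0. Qed.

(* [3/8 (x-z)^2 - 3/104 x^2 + z^2/32 = 9/26 (x - 13/12 z)^2] *)
Lemma expR_sqB_le (x z : mat) : expR (- (3 / 8) * sq (x - z)) <= E32 z * expR (- b32 * sq x).
Proof.
rewrite /E32 -expRD ler_expR /b32 /sq !mulr_sumr -big_split; apply: ler_sum => k _.
rewrite !mxE; have : 0 <= (x k.1 k.2 - 13 / 12 * z k.1 k.2) ^+ 2 by exact: sqr_ge0.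
by move: (x _ _) (z _ _) => a b /=; nra.
Qed.

(** Common envelope of the Gaussian and of its product with an entry: [1/8] of the rate [1/2] is
    given up for the entry. *)
Definition gbound (g : mat -> R) (K : R) :=
  [/\ measurable_fun setT g, 0 <= K & forall y, `|g y| <= K * expR (- (3 / 8) * sq y)].

Lemma measurable_subr (z : mat) : measurable_fun setT (fun x : mat => x - z).
Proof.
apply: measurable_fun_mat => a i; under eq_fun do rewrite !mxE.
by apply: measurable_funB => //; exact: measurable_coord.
Qed.

(** The dependence on [z] is moved into the explicit factor [E32 z]; the remaining integral is free
    of [z], so the remainder is small uniformly up to that factor. *)
Lemma conv_bound g K (r : mat -> R) z : gbound g K -> measurable_fun setT r ->
  intg (fun x => expR (- b32 * sq x) * `|r x|) ->
  intg (fun x => g (x - z) * r x) /\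
  `|lint (fun x => g (x - z) * r x)| <= K * lint (fun x => expR (- b32 * sq x) * `|r x|) * E32 z.
Proof.
move=> [mg K0 gK] mr ir.
have le x : `|g (x - z) * r x| <= (K * E32 z) * (expR (- b32 * sq x) * `|r x|).
  rewrite normrM mulrA ler_wpM2r//; apply: le_trans (gK _) _.
  by rewrite -mulrA ler_wpM2l// expR_sqB_le.
have ii : intg (fun x => g (x - z) * r x).
  apply: intg_le (intgZ _ ir) le.
  by apply: measurable_funM => //; apply: measurableT_comp => //; exact: measurable_subr.
split=> //; apply: le_trans (le_norm_lint ii (intgZ _ ir) le) _.
by rewrite lintZ// mulrAC.
Qed.

Lemma gbound_gs : gbound gs kap.
Proof.
split; [exact: measurable_gs|exact: ltW (@kap_gt0 R n p)|move=> y].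
rewrite ger0_norm ?gs_ge0// gsE ler_wpM2l ?(ltW (@kap_gt0 R n p))// ler_expR.
by have := sq_ge0 y; nra.
Qed.

Lemma gbound_entry : exists K, forall k, gbound (fun w => w k.1 k.2 * gs w) K.
Proof.
have e0 : 0 < 8^-1 :> R by lra.
have [K K1 hK] := entry_le_expR (n := n) (p := p) e0.
have kp := @kap_gt0 R n p; have K0 : 0 <= K by exact: le_trans K1.
exists (K * kap) => k; split.
- by apply: measurable_funM; [exact: measurable_entry|exact: measurable_gs].
- by rewrite mulr_ge0// ltW.
move=> y; rewrite normrM (ger0_norm (gs_ge0 y)) gsE.
apply: le_trans (ler_wpM2r _ (hK y k)) _; first by rewrite mulr_ge0 ?expR_ge0// ltW.
have -> : - (3 / 8) * sq y = 8^-1 * sq y + - 2^-1 * sq y by lra.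
by rewrite expRD mulrACA.
Qed.

Lemma lint_translate g (P : mat -> R) z : intg (fun x => g (x - z) * P x) ->
  lint (fun x => g (x - z) * P x) = lint (fun w => g w * P (z + w)).
Proof.
move=> fi; have [_] := lint_scale z ltr01 fi.
rewrite expr1n invr1 mul1r => <-; congr lint; apply/funext => w.
by rewrite scale1r addrAC subrr add0r.
Qed.

Variables (pr : mat -> R) (th : mat) (c0 : R) (L : idx -> R) (H : idx -> idx -> R).
Hypotheses (mpr : measurable_fun setT pr) (pr0 : forall X, 0 <= pr X).
Hypothesis pri : forall c, 0 < c -> intg (fun X => expR (- c * sq X) * pr X).
Hypothesis jpr : jet pr th c0 L H.
Local Notation rem := (rem pr th c0 L H).

Lemma b32_gt0 : 0 < b32. Proof. by rewrite /b32; lra. Qed.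

Lemma intg_b32 (f : mat -> R) : measurable_fun setT f ->
  (forall x, `|f x| <= `|c0| + `|lin L x| + `|quad H x|) ->
  intg (fun x => expR (- b32 * sq x) * `|f x|).
Proof.
move=> mf fP; have e0 : 0 < b32 / 2 by rewrite divr_gt0// b32_gt0.
have [K K0 hK] := poly_le_expR c0 L H e0.
apply: intg_le (intgZ K (intg_gauss (n := n) (p := p) e0)) _.
  apply: measurable_funM; first exact: measurable_expR_sq.
  exact: measurableT_comp.
move=> x; rewrite normrM normr_id (ger0_norm (expR_ge0 _)).
apply: le_trans (ler_wpM2l (expR_ge0 _) (le_trans (fP x) (hK x))) _.
rewrite mulrCA -expRD ler_wpM2l// ler_expR; lra.
Qed.

(** Polynomial terms are recentred at [z], where Gaussian moments apply; the remainder stays in [x],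
    the variable in which it is small. *)
Lemma conv_expand g K s z : gbound g K -> 0 < s -> s <= 1 ->
  intg (fun x => g (x - z) * pr (th + s *: x)) /\
  lint (fun x => g (x - z) * pr (th + s *: x)) =
  c0 * lint (fun w => g w) + s * lint (fun w => g w * lin L (z + w)) +
  s ^+ 2 * (lint (fun w => g w * quad H (z + w)) / 2) +
  s ^+ 2 * lint (fun x => g (x - z) * rem s x).
Proof.
move=> gb s0 s1.
have nn x (S := `|c0| + `|lin L x| + `|quad H x|) : [/\ `|c0| <= S, `|lin L x| <= S & `|quad H x| <= S].
  by rewrite /S; have := normr_ge0 c0; have := normr_ge0 (lin L x); have := normr_ge0 (quad H x); split; lra.
have i0 : intg (fun x => g (x - z) * c0).
  by apply: (conv_bound z gb _ (intg_b32 _ _)).1 => // x; have [] := nn x.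
have mL := measurable_lin (R := R) L; have mH := measurable_quad (R := R) H.
have i1 : intg (fun x => g (x - z) * lin L x).
  by apply: (conv_bound z gb mL (intg_b32 mL _)).1 => x; have [] := nn x.
have i2 : intg (fun x => g (x - z) * quad H x).
  by apply: (conv_bound z gb mH (intg_b32 mH _)).1 => x; have [] := nn x.
have [i3 _] := conv_bound z gb (measurable_rem th c0 L H mpr s) (intg_rem th c0 L H mpr pr0 pri b32_gt0 s0 s1).
have s2 : s != 0 by rewrite gt_eqF.
have -> : (fun x => g (x - z) * pr (th + s *: x)) =
  (fun x => g (x - z) * c0 + s * (g (x - z) * lin L x) + s ^+ 2 / 2 * (g (x - z) * quad H x) + s ^+ 2 * (g (x - z) * rem s x)).
  by apply/funext => x; rewrite (remE pr th c0 L H x s2); field.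
have j1 := intgZ s i1; have j2 := intgZ (s ^+ 2 / 2) i2; have j3 := intgZ (s ^+ 2) i3.
split; first by apply: intgD => //; apply: intgD => //; exact: intgD.
rewrite lintD//; last by apply: intgD => //; exact: intgD.
rewrite lintD//; last exact: intgD.
rewrite lintD// !lintZ// (lint_translate i0) (lint_translate i1) (lint_translate i2).
congr (_ + _ + _ + _); last by rewrite mulrA mulrAC.
rewrite (_ : (fun w => g w * c0) = (fun w => c0 * g w)); last by apply/funext => w; rewrite mulrC.
rewrite lintZ//; case: gb => mg K0 hg.
have i38 : 0 < 3 / 8 :> R by lra.
exact: intg_le mg (intgZ K (intg_gauss i38)) hg.
Qed.

Definition marg (s : R) (z : mat) : R := lint (fun x => gs (x - z) * pr (th + s *: x)).

(** As [(x - z) gs (x - z)] is the [z]-gradient of [gs (x - z)], this is formally the gradient of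
    [marg]; its quotient by [marg] is the shift of the posterior mean in Tweedie's formula. *)
Definition score (s : R) (k : idx) (z : mat) : R :=
  lint (fun x => ((x - z) k.1 k.2 * gs (x - z)) * pr (th + s *: x)).

Lemma marg_expand s z : 0 < s -> s <= 1 ->
  marg s z = c0 + s * lin L z + s ^+ 2 * (lint (fun w => gs w * quad H (z + w)) / 2) +
    s ^+ 2 * lint (fun x => gs (x - z) * rem s x).
Proof.
move=> s0 s1; have [_] := conv_expand z gbound_gs s0 s1; rewrite /marg => ->.
rewrite (lint_gs (R := R) (n := n) (p := p)).2 mulr1; congr (_ + _ * _ + _ + _).
have [_] : mom (fun w => lin L (z + w)) (lin L z * 1 + 0).
  apply: mom_eq (momD (momZ (lin L z) mom0) (mom_lin L)) => w.
  by rewrite linDr mulr1.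
by rewrite mulr1 addr0 => <-; congr lint; apply/funext => w; rewrite mulrC.
Qed.

(** The constant term of the prior drops out because first moments vanish, so the score is of order
    [s]; integrating an entry against a linear or quadratic form returns its partial derivative at
    [z]. *)
Lemma score_expand s k z : 0 < s -> s <= 1 ->
  score s k z = s * L k + s ^+ 2 * lin (symH H k) z +
    s ^+ 2 * lint (fun x => ((x - z) k.1 k.2 * gs (x - z)) * rem s x).
Proof.
move=> s0 s1; have [K /(_ k) gb] := gbound_entry.
have [_] := conv_expand z gb s0 s1; rewrite /score => ->.
rewrite (mom1 k).2 mulr0 add0r; congr (_ * _ + _ * _ + _).
  have [_] : mom (fun w => w k.1 k.2 * lin L (z + w)) (lin L z * 0 + L k).
    apply: mom_eq (momD (momZ (lin L z) (mom1 k)) (mom_entry_lin L k)) => w.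
    by rewrite linDr; ring.
  by rewrite mulr0 add0r => <-; congr lint; apply/funext => w; ring.
have [_] : mom (fun w => w k.1 k.2 * quad H (z + w)) (quad H z * 0 + 2 * lin (symH H k) z + 0).
  apply: mom_eq (momD (momD (momZ (quad H z) (mom1 k))
    (momZ 2 (mom_entry_lin (fun l => lin (symH H l) z) k))) (mom_entry_quad H k)) => w.
  by rewrite quadDr; ring.
rewrite mulr0 add0r addr0 => e.
have -> : lint (fun w : mat => w k.1 k.2 * gs w * quad H (z + w)) = 2 * lin (symH H k) z.
  by rewrite -e; congr lint; apply/funext => w; ring.
by rewrite mulrC mulrA mulVf ?mul1r// pnatr_eq0.
Qed.

Lemma quad_smooth_bound : exists2 K, 0 <= K & forall z,
  `|lint (fun w => gs w * quad H (z + w))| <= K * E32 z.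
Proof.
have mH := measurable_quad (R := R) H.
have iH : intg (fun x => expR (- b32 * sq x) * `|quad H x|).
  apply: intg_b32 => // x.
  by have := normr_ge0 c0; have := normr_ge0 (lin L x); lra.
exists (kap * lint (fun x => expR (- b32 * sq x) * `|quad H x|)).
  by rewrite mulr_ge0 ?(ltW (@kap_gt0 R n p))// lint_ge0.
move=> z; have [i1 le] := conv_bound z gbound_gs mH iH.
by rewrite -(lint_translate i1).
Qed.

Lemma lint_gauss_gt0 (c : R) : 0 < c -> 0 < lint (fun X : mat => expR (- c * sq X)).
Proof.
move=> cp; have [_] := integral_gauss_prod (h := fun _ t => expR (- c * t ^+ 2))
  (v := fun=> Num.sqrt (pi / c)) (fun (_ : idx) _ => expR_ge0 _) (fun _ => measurable_expR_sqr _) (fun _ => integral_expR_sqr cp).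
under eq_fun do rewrite -expR_sq.
by move=> ->; apply: prodr_gt0 => k _; rewrite sqrtr_gt0 divr_gt0// pi_gt0.
Qed.

Lemma ae_le_lint (f g : mat -> R) : intg f -> intg g -> (forall X, 0 <= f X) -> (forall X, 0 <= g X) ->
  {ae mat_leb, forall X, f X <= g X} -> lint f <= lint g.
Proof.
move=> fi gi f0 g0 fg; apply: fine_le; [exact: integrable_fin_num|exact: integrable_fin_num|].
apply: ae_ge0_le_integral => //.
- by move=> X _; rewrite lee_fin.
- exact: measurable_int fi.
- by move=> X _; rewrite lee_fin.
- exact: measurable_int gi.
- by apply: filterS fg => X h _; rewrite lee_fin.
Qed.

(** The denominator of the posterior mean must not decay faster than [1 / E32 z]. From [|th + s x|^2
    <= 2 |th|^2 + 4 s^2 (|z|^2 + |x - z|^2)] and [4 s^2 <= 1/32], the minorant of the prior costs at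
    most [1/32] in [z] and raises the rate in [x - z] from [1/2] to [17/32]. *)
Lemma marg_lower c : 0 < c -> {ae mat_leb, forall X, c * expR (- sq X) <= pr X} ->
  exists2 K, 0 < K & forall s z, 0 < s -> s <= 1 -> s ^+ 2 <= 128^-1 -> K <= marg s z * E32 z.
Proof.
move=> c_gt0 ae; have i1732 : 0 < 17 / 32 :> R by lra.
have iI := intg_gauss (n := n) (p := p) i1732.
pose C := c * expR (- 2 * sq th) * kap; have C0 : 0 < C.
  by rewrite mulr_gt0 ?(@kap_gt0 R n p)// mulr_gt0// expR_gt0.
exists (C * lint (fun w : mat => expR (- (17 / 32) * sq w))); first by rewrite mulr_gt0// lint_gauss_gt0.
move=> s z s0 s1 s2; rewrite -ler_pdivrMr ?expR_gt0//.
pose f (x : mat) := gs (x - z) * pr (th + s *: x).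
pose g (x : mat) := gs (x - z) * (c * expR (- sq (th + s *: x))).
have fi : intg f by have [] := conv_expand z gbound_gs s0 s1.
have mg : measurable_fun setT g.
  apply: measurable_funM; first by apply: measurableT_comp (measurable_subr z); exact: measurable_gs.
  apply: measurable_funM => //; apply: measurableT_comp => //; apply: measurable_funN.
  by apply: measurableT_comp (measurable_shift th s); exact: measurable_sq.
have gsi : intg (fun x => gs (x - z)).
  have [+ _] := lint_scale (- z) ltr01 (lint_gs (R := R) (n := n) (p := p)).1.
  by under eq_fun do rewrite scale1r addrC.
have gi : intg g.
  apply: intg_le mg (intgZ c gsi) _ => x; rewrite ger0_norm; last first.
    by rewrite mulr_ge0 ?gs_ge0// mulr_ge0 ?expR_ge0// ltW.
  rewrite /g mulrCA ler_pM2l// ler_piMr ?gs_ge0// -expR0 ler_expR oppr_le0; exact: sq_ge0.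
have [wi wv] := lint_scale (- z) ltr01 iI.
have le1 : C / E32 z * lint (fun w : mat => expR (- (17 / 32) * sq w)) <= lint g.
  have -> : lint (fun w : mat => expR (- (17 / 32) * sq w)) = lint (fun w : mat => expR (- (17 / 32) * sq (- z + 1 *: w))).
    by rewrite wv expr1n invr1 mul1r.
  rewrite -lintZ//; apply: le_lint => //; first exact: intgZ.
  move=> x; rewrite /g /C gsE scale1r [- z + x]addrC /E32 -expRN.
  have -> : c * expR (- 2 * sq th) * kap * expR (- (32^-1 * sq z)) * expR (- (17 / 32) * sq (x - z)) =
    (kap * c) * expR (- 2 * sq th + - (32^-1 * sq z) + - (17 / 32) * sq (x - z)).
    by rewrite !expRD; ring.
  have -> : kap * expR (- 2^-1 * sq (x - z)) * (c * expR (- sq (th + s *: x))) =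
    (kap * c) * expR (- 2^-1 * sq (x - z) + - sq (th + s *: x)).
    by rewrite !expRD; ring.
  rewrite ler_pM2l ?mulr_gt0 ?(@kap_gt0 R n p)// ler_expR.
  have := sqD_le th (s *: x); rewrite sqZ => h1.
  have := sqD_le z (x - z); rewrite [z + _]addrC subrK => h2.
  have h3 := ler_wpM2l (sqr_ge0 s) h2.
  have z0 := sq_ge0 z; have xz0 := sq_ge0 (x - z).
  have h4 := ler_wpM2r z0 s2; have h5 := ler_wpM2r xz0 s2.
  by lra.
rewrite mulrAC; apply: le_trans le1 _.
(* The almost-everywhere minorant is stated for [X = th + s x]; both integrals are taken back to
   that variable before being compared. *)
have sV : 0 < s^-1 by rewrite invr_gt0.
have [fTi fTv] := lint_scale (- (s^-1 *: th)) sV fi.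
have [gTi gTv] := lint_scale (- (s^-1 *: th)) sV gi.
rewrite -(ler_pM2l (_ : 0 < s^-1 ^- #|{: idx}|)) ?invr_gt0 ?exprn_gt0// /marg -fTv -gTv.
have TE X : th + s *: (- (s^-1 *: th) + s^-1 *: X) = X.
  have sn : s != 0 by rewrite gt_eqF.
  by rewrite scalerDr scalerN !scalerA mulfV// !scale1r addrA subrr add0r.
apply: ae_le_lint => // [X|X|].
- by rewrite mulr_ge0 ?gs_ge0// mulr_ge0 ?expR_ge0// ltW.
- by rewrite mulr_ge0 ?gs_ge0.
by apply: filterS ae => X h; rewrite /f /g TE ler_wpM2l ?gs_ge0.
Qed.

End convolution.

(** * Elementary estimates for the posterior quotient *)

Section posterior_estimates.
Context {R : realType}.
Implicit Types X s e c B D ell q r h rho L a b x y : R.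

Lemma normM_le x y a b : `|x| <= a -> `|y| <= b -> `|x * y| <= a * b.
Proof. by move=> xa yb; rewrite normrM ler_pM. Qed.

Lemma normD_le x y a b : `|x| <= a -> `|y| <= b -> `|x + y| <= a + b.
Proof. by move=> xa yb; apply: le_trans (ler_normD _ _) _; rewrite lerD. Qed.

Lemma normB_le x y a b : `|x| <= a -> `|y| <= b -> `|x - y| <= a + b.
Proof. by move=> xa yb; apply: le_trans (ler_normB _ _) _; rewrite lerD. Qed.

Lemma common_bound (r : seq R) : exists2 M, 1 <= M & forall x, x \in r -> x <= M.
Proof.
elim: r => [|y r [M M1 hM]]; first by exists 1.
exists (M + `|y|) => [|x]; first by rewrite ler_wpDr.
rewrite in_cons => /orP[/eqP ->|/hM xM]; last by rewrite ler_wpDr.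
by rewrite (le_trans (ler_norm _))// lerDr (le_trans ler01).
Qed.

(** [X] bounds the quantities at a given [z], and [e X] the two remainders. As [B = c + s D] is
    exact, the quotient equals [L / c + s v] with [B] kept inside [v]: only a bound on [1 / B]
    enters, and [1 / B - 1 / c = - s D / (B c)] yields the limit of [v]. *)
Lemma score_ratio_est X s e c B ell q r h rho L :
  let D := ell + s * (q + r) in
  let v := (h + rho - L / c * D) / B in
  1 <= X -> 0 < s -> s <= 1 -> 0 <= e -> e <= 1 -> c != 0 -> B != 0 -> B = c + s * D ->
  `|c^-1| <= X -> `|B^-1| <= X -> `|ell| <= X -> `|q| <= X -> `|h| <= X -> `|L| <= X ->
  `|r| <= e * X -> `|rho| <= e * X ->
  [/\ (L + s * (h + rho)) / B = L / c + s * v, `|L / c| <= X ^+ 2, `|v| <= 5 * X ^+ 4 &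
      `|v - (h - L / c * ell) / c| <= 8 * (e + s) * X ^+ 6].
Proof.
move=> D v X1 s0 s1 e0 e1 c0 B0 BE hc hB hell hq hh hL hr hrho.
have X0 : 0 <= X by lra.
have Xm i j : (i <= j)%N -> X ^+ i <= X ^+ j by move=> ij; exact: ler_weXn2l.
have sn : `|s| <= s by rewrite gtr0_norm.
have eX : e * X <= X by rewrite ler_piMl.
have hlam : `|L / c| <= X ^+ 2 by rewrite expr2; exact: normM_le.
have hqr : `|q + r| <= 2 * X by apply: le_trans (normD_le hq hr) _; lra.
have hsqr : `|s * (q + r)| <= s * (2 * X) by exact: normM_le.
have hD : `|D| <= 3 * X.
  apply: le_trans (normD_le hell hsqr) _.
  by have : s * (2 * X) <= 2 * X; [rewrite ler_piMl// mulr_ge0|lra].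
have hhr : `|h + rho| <= 2 * X by apply: le_trans (normD_le hh hrho) _; lra.
have hv : `|v| <= 5 * X ^+ 4.
  apply: le_trans (normM_le (normB_le hhr (normM_le hlam hD)) hB) _.
  have -> : (2 * X + X ^+ 2 * (3 * X)) * X = 2 * X ^+ 2 + 3 * X ^+ 4 by ring.
  by have := Xm 2 4 isT; lra.
split=> //.
- rewrite /v; apply/eqP; rewrite -subr_eq0.
  have -> : (L + s * (h + rho)) / B - (L / c + s * ((h + rho - L / c * D) / B)) = L * (c + s * D - B) / (B * c).
    by field; rewrite c0 B0.
  by rewrite -BE subrr mulr0 mul0r.
- have -> : v - (h - L / c * ell) / c = (rho - L / c * (s * (q + r))) / B - (h - L / c * ell) * (s * D * B^-1 * c^-1).
    rewrite /v; apply/eqP; rewrite -subr_eq0; set lam := L / c.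
    have -> : (h + rho - lam * D) / B - (h - lam * ell) / c - ((rho - lam * (s * (q + r))) / B -
       (h - lam * ell) * (s * D * B^-1 * c^-1)) = (h - lam * ell) * (c + s * D - B) / (B * c).
      by rewrite /D; field; rewrite c0 B0.
    by rewrite -BE subrr mulr0 mul0r.
  have h1 := normM_le (normB_le hrho (normM_le hlam hsqr)) hB.
  have h2 := normM_le (normB_le hh (normM_le hlam hell)) (normM_le (normM_le (normM_le sn hD) hB) hc).
  apply: le_trans (normB_le h1 h2) _.
  have -> : (e * X + X ^+ 2 * (s * (2 * X))) * X + (X + X ^+ 2 * X) * (s * (3 * X) * X * X) =
    e * X ^+ 2 + s * (5 * X ^+ 4 + 3 * X ^+ 6) by ring.
  have h26 := ler_wpM2l e0 (Xm 2%N 6%N isT).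
  have h46 := ler_wpM2l (ltW s0) (Xm 4%N 6%N isT).
  have X60 : 0 <= X ^+ 6 by exact: exprn_ge0.
  have := mulr_ge0 e0 X60; have := mulr_ge0 (ltW s0) X60; lra.
Qed.

(** The highest power comes from [vk * vl], each factor bounded by a multiple of [X^4]; this fixes
    the exponent [8], and with it the rate in [E32]. *)
Lemma posterior_product_est X s e zk zl lk ll vk vl wk wl :
  1 <= X -> 0 < s -> s <= 1 -> 0 <= e ->
  `|zk| <= X -> `|zl| <= X -> `|lk| <= X ^+ 2 -> `|ll| <= X ^+ 2 ->
  `|vk| <= 5 * X ^+ 4 -> `|vl| <= 5 * X ^+ 4 ->
  `|vk - wk| <= 8 * (e + s) * X ^+ 6 -> `|vl - wl| <= 8 * (e + s) * X ^+ 6 ->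
  `|(zk + s * (lk + s * vk)) * (zl + s * (ll + s * vl))| <= 49 * X ^+ 8 /\
  `|(zl * vk + zk * vl + (lk + s * vk) * (ll + s * vl)) - (zl * wk + zk * wl + lk * ll)|
    <= 51 * (e + s) * X ^+ 8.
Proof.
move=> X1 s0 s1 e0 hzk hzl hlk hll hvk hvl hwk hwl.
have X0 : 0 <= X by lra.
have Xm i j : (i <= j)%N -> X ^+ i <= X ^+ j by move=> ij; exact: ler_weXn2l.
have sn : `|s| <= s by rewrite gtr0_norm.
have s1n : `|s| <= 1 by rewrite gtr0_norm.
have X6 := Xm 6%N 8%N isT; have X7 := Xm 7%N 8%N isT.
split.
  have ht z l v : `|z| <= X -> `|l| <= X ^+ 2 -> `|v| <= 5 * X ^+ 4 -> `|z + s * (l + s * v)| <= 7 * X ^+ 4.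
    move=> hz hl hv; apply: le_trans (normD_le hz (normM_le s1n (normD_le hl (normM_le s1n hv)))) _.
    by have := Xm 1%N 4%N isT; have := Xm 2%N 4%N isT; rewrite expr1; lra.
  apply: le_trans (normM_le (ht _ _ _ hzk hlk hvk) (ht _ _ _ hzl hll hvl)) _.
  by rewrite le_eqVlt; apply/orP; left; apply/eqP; ring.
have -> : zl * vk + zk * vl + (lk + s * vk) * (ll + s * vl) - (zl * wk + zk * wl + lk * ll) =
  zl * (vk - wk) + zk * (vl - wl) + s * (lk * vl + vk * ll + s * (vk * vl)) by ring.
have h1 := normM_le hzl hwk; have h2 := normM_le hzk hwl.
have h3 := normM_le sn (normD_le (normD_le (normM_le hlk hvl) (normM_le hvk hll)) (normM_le s1n (normM_le hvk hvl))).
apply: le_trans (normD_le (normD_le h1 h2) h3) _.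
have es0 : 0 <= e + s by lra.
have h4 := ler_wpM2l es0 X7; have h5 := ler_wpM2l (ltW s0) X6.
have h6 := mulr_ge0 e0 (exprn_ge0 8 X0); have h7 := mulr_ge0 (ltW s0) (exprn_ge0 8 X0).
have -> : X * (8 * (e + s) * X ^+ 6) + X * (8 * (e + s) * X ^+ 6) +
   s * (X ^+ 2 * (5 * X ^+ 4) + 5 * X ^+ 4 * X ^+ 2 + 1 * (5 * X ^+ 4 * (5 * X ^+ 4))) =
   16 * ((e + s) * X ^+ 7) + 10 * (s * X ^+ 6) + 25 * (s * X ^+ 8) by ring.
by lra.
Qed.

End posterior_estimates.

(** * Second moments of the posterior mean *)

Section posterior_limit.
Context {R : realType} {n p : nat}.
Local Notation mat := 'M[R]_(n, p).
Local Notation idx := ('I_n * 'I_p)%type.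
Local Notation kap := (@kap R n p).
Variables (pr : mat -> R) (th : mat) (c0 : R) (L : idx -> R) (H : idx -> idx -> R).
Hypotheses (mpr : measurable_fun setT pr) (pr0 : forall X, 0 <= pr X).
Hypothesis pri : forall c, 0 < c -> intg (fun X => expR (- c * sq X) * pr X).
Hypothesis jpr : jet pr th c0 L H.
Hypothesis c0_gt0 : 0 < c0.
Hypothesis pr_lower : exists2 c, 0 < c & {ae mat_leb, forall X, c * expR (- sq X) <= pr X}.
Local Notation rem := (rem pr th c0 L H).
Local Notation marg := (marg pr th).
Local Notation score := (score pr th).

(* The posterior mean of [x = (M - th) / s] given [z = (Y - th) / s], entry [k]. *)
Definition tpost (s : R) (k : idx) (z : mat) : R := z k.1 k.2 + score s k z / marg s z.

Lemma measurable_conv (g : mat -> R) K s : gbound g K -> 0 < s -> s <= 1 ->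
  measurable_fun setT (fun z : mat => lint (fun x => g (x - z) * pr (th + s *: x))).
Proof.
move=> gb s0 s1; apply: measurable_lint_param => [|z]; last first.
  by have [] := conv_expand th c0 L H mpr pr0 pri z gb s0 s1.
apply: measurable_funM.
  apply: measurableT_comp; first by case: gb.
  apply: measurable_fun_mat => a i; under eq_fun do rewrite !mxE.
  by apply: measurable_funB; apply: (measurableT_comp (measurable_coord a i)).
apply: measurableT_comp => //; apply: (measurableT_comp (measurable_shift th s)).
exact: measurable_snd.
Qed.

Lemma marg_ge0 s z : 0 <= marg s z.
Proof. by apply: lint_ge0 => x; rewrite mulr_ge0 ?gs_ge0. Qed.

Lemma measurable_tpost s k : 0 < s -> s <= 1 -> measurable_fun setT (tpost s k).
Proof.
move=> s0 s1; have [K gK] := @gbound_entry R n p.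
apply: measurable_funD; first exact: measurable_entry.
apply: measurable_funM; first exact: measurable_conv (gK k) s0 s1.
(* Inverse and power agree also at [0], where both are [0], so measurability is that of a power. *)
rewrite (_ : (fun z => (marg s z)^-1) = (fun z => marg s z `^ (-1))); last first.
  by apply/funext => z; rewrite powR_inv1// marg_ge0.
by apply: (measurableT_comp (measurable_powR _)); exact: measurable_conv (@gbound_gs R n p) s0 s1.
Qed.

(** Limit of [v] in [score_ratio_est] as [s] and the remainders vanish. *)
Definition vlim k (z : mat) : R := (lin (symH H k) z - L k / c0 * lin L z) / c0.

Lemma mom_limit k l :
  mom (fun z => z l.1 l.2 * vlim k z + z k.1 k.2 * vlim l z + L k / c0 * (L l / c0))
    ((H k l + H l k) / c0 - L k * L l / c0 ^+ 2).
Proof.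
have c0n : c0 != 0 by rewrite gt_eqF.
have h i j : mom (fun z => z i.1 i.2 * vlim j z) (c0^-1 * (symH H j i + - (L j / c0) * L i)).
  apply: mom_eq (momZ c0^-1 (momD (mom_entry_lin (symH H j) i) (momZ (- (L j / c0)) (mom_entry_lin L i)))) => z.
  by rewrite /vlim; ring.
have -> : (H k l + H l k) / c0 - L k * L l / c0 ^+ 2 =
   c0^-1 * (symH H k l + - (L k / c0) * L l) + c0^-1 * (symH H l k + - (L l / c0) * L k) + L k / c0 * (L l / c0) * 1.
  by rewrite /symH; field.
apply: mom_eq (momD (momD (h l k) (h k l)) (momZ (L k / c0 * (L l / c0)) (@mom0 R n p))) => z.
by rewrite mulr1.
Qed.

Lemma E32_8 (z : mat) M : 0 <= M -> (M * E32 z) ^+ 8 = M ^+ 8 * expR (4^-1 * sq z).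
Proof.
move=> M0; rewrite exprMn /E32 -expRM_natl; congr (_ * expR _); lra.
Qed.

(** The bound [X] of the pointwise estimates is taken to be [M * E32 z], with one [M] for all
    constants; its eighth power is integrable against [gs]. The corrections [v] depend on [z], but
    the threshold on [s] does not. *)
Lemma tpost_bounds : exists2 M, 1 <= M & forall e, 0 < e -> e <= 1 -> exists2 s1, 0 < s1 &
  forall s, 0 < s -> s <= s1 -> [/\ s <= 1, s <= e & forall k l z, exists v : idx -> R,
   [/\ tpost s k z = z k.1 k.2 + s * (L k / c0 + s * v k),
      tpost s l z = z l.1 l.2 + s * (L l / c0 + s * v l),
      `|tpost s k z * tpost s l z| <= 49 * (M ^+ 8 * expR (4^-1 * sq z)) &
      `|(z l.1 l.2 * v k + z k.1 k.2 * v l + (L k / c0 + s * v k) * (L l / c0 + s * v l)) -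
        (z l.1 l.2 * vlim k z + z k.1 k.2 * vlim l z + L k / c0 * (L l / c0))|
      <= 51 * (e + s) * (M ^+ 8 * expR (4^-1 * sq z))]].
Proof.
have c0n : c0 != 0 by rewrite gt_eqF.
have e32 : 0 < 32^-1 :> R by lra.
have [KN KN1 hN] := sq_le_expR (n := n) (p := p) e32.
have KN0 : 0 <= KN by exact: le_trans KN1.
have [KL KL0 hL] := lin_bound L.
have hS : exists2 K, 0 <= K & forall k (z : mat), `|lin (symH H k) z| <= K * nm z.
  have KP k : {K : R | 0 <= K /\ forall z : mat, `|lin (symH H k) z| <= K * nm z}.
    by apply: cid; have [K K0 h] := lin_bound (symH H k); exists K.
  exists (\sum_k sval (KP k)); first by apply: sumr_ge0 => k _; case: (svalP (KP k)).
  move=> k z; apply: le_trans ((svalP (KP k)).2 z) _; rewrite ler_wpM2r ?nm_ge0//.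
  by rewrite (bigD1 k)//= lerDl sumr_ge0// => j _; case: (svalP (KP j)).
have [KS KS0 hSz] := hS.
have [KQ KQ0 hQ] := quad_smooth_bound c0 L H.
have [Kg gK] := @gbound_entry R n p.
have [c cg hc] := pr_lower.
have [KB KB0 hB] := marg_lower th c0 L H mpr pr0 pri cg hc.
pose SL := \sum_k `|L k|.
have cV : 0 <= c0^-1 by rewrite invr_ge0 ltW.
have [M M1 hM] := common_bound [:: KN; KL * KN; KS * KN; KQ; Kg; kap; KB^-1; c0^-1; SL].
exists M => // e ep e1.
have [s1 s1p hrem] := rem_lim mpr pr0 pri jpr b32_gt0 ep.
(* [s <= 1/16] ensures the [s^2 <= 1/128] required by [marg_lower]. *)
exists (Num.min s1 (Num.min e 16^-1)); first by rewrite !lt_min s1p ep invr_gt0 ltr0n.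
move=> s s0; rewrite !le_min => /and3P[ss1 se s16].
have sle1 : s <= 1 by exact: le_trans se e1.
split=> // k l z.
have E1 := E32_ge1 z; have E0 : 0 <= E32 z by exact: le_trans E1.
have up a : a <= M -> a * E32 z <= M * E32 z by move=> h; rewrite ler_wpM2r.
have up1 a : 0 <= a -> a <= M -> a <= M * E32 z.
  by move=> a0 h; apply: le_trans h _; rewrite ler_peMr// (le_trans _ M1).
have MK x : x \in [:: KN; KL * KN; KS * KN; KQ; Kg; kap; KB^-1; c0^-1; SL] -> x * E32 z <= M * E32 z.
  by move=> /hM; exact: up.
have nmz : nm z <= KN * E32 z by have [] := hN z.
have s2 : s ^+ 2 <= 128^-1 by have := ler_pM (ltW s0) (ltW s0) s16 s16; rewrite expr2; lra.
have hBz := hB s z s0 sle1 s2.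
have Bp : 0 < marg s z.
  by rewrite lt_neqAle marg_ge0 andbT; apply/eqP => B0; move: hBz; rewrite -B0 mul0r leNgt KB0.
have Bn : marg s z != 0 by rewrite gt_eqF.
have ir := intg_rem th c0 L H mpr pr0 pri (@b32_gt0 R) s0 sle1.
have mr := measurable_rem th c0 L H mpr s.
have hr := hrem s s0 ss1.
pose D := lin L z + s * (lint (fun w => gs w * quad H (z + w)) / 2 + lint (fun x => gs (x - z) * rem s x)).
have BE : marg s z = c0 + s * D.
  by rewrite (marg_expand th c0 L H mpr pr0 pri z s0 sle1) /D; ring.
have b1 : `|c0^-1| <= M * E32 z by rewrite ger0_norm// up1// hM// !inE eqxx !orbT.
have b2 : `|(marg s z)^-1| <= M * E32 z.
  rewrite gtr0_norm ?invr_gt0//; apply: (@le_trans _ _ (KB^-1 * E32 z)); last by rewrite MK// !inE eqxx !orbT.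
  by rewrite ler_pdivlMl// ler_pdivrMr// mulrC.
have b3 : `|lin L z| <= M * E32 z.
  apply: le_trans (hL z) _; apply: le_trans (ler_wpM2l KL0 nmz) _.
  by rewrite mulrA MK// !inE eqxx !orbT.
have b4 : `|lint (fun w => gs w * quad H (z + w)) / 2| <= M * E32 z.
  have h' : KQ * E32 z <= M * E32 z by rewrite MK// !inE eqxx !orbT.
  by rewrite normrM; apply: le_trans (le_trans (hQ z) h'); rewrite ler_piMr// ger0_norm ?invf_le1 ?ler1n.
have b5 j : `|lin (symH H j) z| <= M * E32 z.
  apply: le_trans (hSz j z) _; apply: le_trans (ler_wpM2l KS0 nmz) _.
  by rewrite mulrA MK// !inE eqxx !orbT.
have b6 j : `|L j| <= M * E32 z.
  apply: up1 => //; apply: (@le_trans _ _ SL); last by rewrite hM// !inE eqxx !orbT.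
  by rewrite /SL (bigD1 j)//= lerDl sumr_ge0.
have b7 g K : gbound g K -> K <= M -> `|lint (fun x => g (x - z) * rem s x)| <= e * (M * E32 z).
  move=> gb KM; apply: le_trans (conv_bound z gb mr ir).2 _.
  have K0 : 0 <= K by case: gb.
  rewrite mulrAC [K * _ * _]mulrC; apply: ler_pM => //.
  - by apply: lint_ge0 => x; rewrite mulr_ge0 ?expR_ge0.
  - by rewrite mulr_ge0.
  - exact: up.
have b8 j : `|z j.1 j.2| <= M * E32 z.
  by apply: le_trans (nm_entry z j) _; apply: le_trans nmz _; rewrite MK// !inE eqxx.
have X1 : 1 <= M * E32 z by rewrite -[leLHS]mulr1 ler_pM.
have kM : kap <= M by rewrite hM// !inE eqxx !orbT.
have KgM : Kg <= M by rewrite hM// !inE eqxx !orbT.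
pose rho j := lint (fun x => ((x - z) j.1 j.2 * gs (x - z)) * rem s x).
pose v j := (lin (symH H j) z + rho j - L j / c0 * D) / marg s z.
have est j := score_ratio_est X1 s0 sle1 (ltW ep) e1 c0n Bn BE b1 b2 b3 b4 (b5 j) (b6 j)
  (b7 _ _ (@gbound_gs R n p) kM) (b7 _ _ (gK j) KgM).
have tE j : tpost s j z = z j.1 j.2 + s * (L j / c0 + s * v j).
  have [<- _ _ _] := est j; rewrite /tpost (score_expand th c0 L H mpr pr0 pri j z s0 sle1).
  by congr (_ + _); rewrite -/(rho j); ring.
have [_ l1 v1 w1] := est k; have [_ l2 v2 w2] := est l.
have [p1 p2] := posterior_product_est X1 s0 sle1 (ltW ep) (b8 k) (b8 l) l1 l2 v1 v2 w1 w2.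
have M0 : 0 <= M by exact: le_trans M1.
by exists v; split=> //; rewrite ?tE -E32_8.
Qed.

(** The product of two entries of the posterior mean has a term of order [s], linear in [z], whose
    Gaussian mean is zero; this is why division by [s^2] is possible. The rest is dominated by an
    explicit small multiple of [exp (|z|^2 / 4)]. *)
Lemma posterior_limit k l (e : R) : 0 < e -> exists2 s1, 0 < s1 & forall s, 0 < s -> s <= s1 ->
  [/\ s <= 1, intg (fun z => tpost s k z * tpost s l z * gs z) &
  `|s ^- 2 * (lint (fun z => tpost s k z * tpost s l z * gs z) - (k == l)%:R) -
    ((H k l + H l k) / c0 - L k * L l / c0 ^+ 2)| <= e].
Proof.
move=> e0; have [M M1 hM] := tpost_bounds.
have M0 : 0 <= M by exact: le_trans M1.
have i4 : 0 < 4^-1 :> R by lra.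
have iJ := intg_gauss (n := n) (p := p) i4.
pose J := M ^+ 8 * (kap * lint (fun z : mat => expR (- 4^-1 * sq z))).
have k0 := ltW (@kap_gt0 R n p).
have J0 : 0 <= J.
  by rewrite mulr_ge0 ?exprn_ge0// mulr_ge0// lint_ge0// => z; exact: expR_ge0.
(* [102] is twice the constant [51] of the pointwise bound, as [s <= d]. *)
have J1 : 0 < 102 * J + 1 by lra.
pose d := Num.min 1 (e / (102 * J + 1)).
have d0 : 0 < d by rewrite lt_min ltr01 divr_gt0.
have d1 : d <= 1 by rewrite ge_min lexx.
have dJ : d * (102 * J + 1) <= e by rewrite -ler_pdivlMr// ge_min lexx orbT.
have [s1 s1p hs] := hM d d0 d1; exists s1 => // s s0 ss1.
have [sle1 sd hz] := hs s s0 ss1.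
have gE (z : mat) a : a * (M ^+ 8 * expR (4^-1 * sq z)) * gs z = (a * (M ^+ 8 * kap)) * expR (- 4^-1 * sq z).
  rewrite gsE (_ : - 4^-1 * sq z = 4^-1 * sq z + - 2^-1 * sq z) ?expRD; last by lra.
  by ring.
have mt j := measurable_tpost j s0 sle1.
have it : intg (fun z => tpost s k z * tpost s l z * gs z).
  apply: intg_le (intgZ (49 * (M ^+ 8 * kap)) iJ) _.
    by apply: measurable_funM; [exact: measurable_funM|exact: measurable_gs].
  move=> z; have [v [_ _ h _]] := hz k l z; rewrite -gE normrM (ger0_norm (gs_ge0 z)).
  by rewrite ler_wpM2r ?gs_ge0.
split=> //; have [ig gv] := mom_limit k l; rewrite -gv.
have [iz zv] := mom2 (R := R) k l; rewrite -zv.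
have lv : mom (fun z => L l / c0 * z k.1 k.2 + L k / c0 * z l.1 l.2) (L l / c0 * 0 + L k / c0 * 0).
  by apply: momD; apply: momZ; exact: mom1.
have [il lv0] := lv; rewrite !mulr0 addr0 in lv0.
pose F z := s ^- 2 * (tpost s k z * tpost s l z * gs z - z k.1 k.2 * z l.1 l.2 * gs z -
  s * ((L l / c0 * z k.1 k.2 + L k / c0 * z l.1 l.2) * gs z)).
have i1 := intgB (intgB it iz) (intgZ s il).
have iF : intg F by exact: intgZ.
rewrite (_ : s ^- 2 * _ = lint F); last first.
  by rewrite lintZ// lintB; [|exact: intgB|exact: intgZ]; rewrite lintB// lintZ// lv0 mulr0 subr0.
rewrite -lintB//.
apply: (@le_trans _ _ (lint (fun z : mat => 51 * (d + s) * (M ^+ 8 * kap) * expR (- 4^-1 * sq z)))).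
  apply: le_norm_lint; [exact: intgB|exact: intgZ|move=> z].
  have [v [tk tl _ h]] := hz k l z; rewrite /F tk tl.
  have sn : s != 0 by rewrite gt_eqF.
  rewrite -gE; set a := _ - _ in h.
  have hb b : b = a * gs z -> `|b| <= 51 * (d + s) * (M ^+ 8 * expR (4^-1 * sq z)) * gs z.
    by move=> ->; rewrite normrM (ger0_norm (gs_ge0 z)) ler_wpM2r ?gs_ge0.
  have c0n : c0 != 0 by rewrite gt_eqF.
  by apply: hb; rewrite /a; field; rewrite c0n sn.
rewrite lintZ//.
have -> : 51 * (d + s) * (M ^+ 8 * kap) * lint (fun X : mat => expR (- 4^-1 * sq X)) = 51 * (d + s) * J.
  by rewrite /J; ring.
have : (d + s) * J <= (d + d) * J by rewrite ler_wpM2r// lerD2l.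
by lra.
Qed.

End posterior_limit.

(** * Risk expansion *)

Section risk_expansion.
Context {R : realType} {n p : nat}.
Local Notation mat := 'M[R]_(n, p).
Local Notation idx := ('I_n * 'I_p)%type.
Local Notation d := #|{: idx}|.

(** Integrability is asked after rescaling, where it is known, and transported back. *)
Lemma mxint_scale (F : mat -> R) (th : mat) (s : R) : 0 < s -> intg (fun x => F (th + s *: x)) ->
  mxint F = s ^+ d * lint (fun x => F (th + s *: x)).
Proof.
move=> s0 iF; have sV : 0 < s^-1 by rewrite invr_gt0.
have [] := lint_scale (- (s^-1 *: th)) sV iF.
have sn : s != 0 by rewrite gt_eqF.
have -> : (fun X => F (th + s *: (- (s^-1 *: th) + s^-1 *: X))) = F.
  by apply/funext => X; rewrite scalerDr scalerN !scalerA mulfV// !scale1r addrA subrr add0r.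
move=> Fi Fv; rewrite mxintE//; rewrite /lint in Fv *; rewrite Fv.
by rewrite exprVn invrK.
Qed.

Lemma dens_scale (th x z : mat) (s : R) : 0 < s ->
  dens (s ^- 2) (th + s *: x) (th + s *: z) = s ^- d * gs (x - z).
Proof.
move=> s0; have sn : s != 0 by rewrite gt_eqF.
rewrite /dens (pair_bigA _ (fun a i => Num.sqrt (s ^- 2 / (2 * pi)) *
   expR (- (s ^- 2 * ((th + s *: z) a i - (th + s *: x) a i) ^+ 2) / 2)))/=.
have -> : s ^- d = \prod_(k : idx) s^-1 by rewrite prodr_const exprVn.
rewrite /gs -big_split/=; apply: eq_bigr => k _.
rewrite [RHS]mulrA; congr (_ * expR _).
  have -> : s ^- 2 / (2 * pi) = s^-1 ^+ 2 * (1 / (2 * pi)) by rewrite exprVn mul1r.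
  by rewrite sqrtrM ?sqr_ge0// sqrtr_sqr gtr0_norm// invr_gt0.
by rewrite !mxE; field.
Qed.

Variables (pr : mat -> R) (th : mat) (c0 : R) (L : idx -> R) (H : idx -> idx -> R).
Hypotheses (mpr : measurable_fun setT pr) (pr0 : forall X, 0 <= pr X).
Hypothesis pri : forall c, 0 < c -> intg (fun X => expR (- c * sq X) * pr X).
Hypothesis jpr : jet pr th c0 L H.
Hypothesis c0_gt0 : 0 < c0.
Hypothesis pr_lower : exists2 c, 0 < c & {ae mat_leb, forall X, c * expR (- sq X) <= pr X}.

Lemma gbayes_scale (s : R) (z : mat) (k : idx) : 0 < s -> s <= 16^-1 ->
  gbayes (s ^- 2) pr (th + s *: z) k.1 k.2 = th k.1 k.2 + s * tpost pr th s k z.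
Proof.
move=> s0 s16; have sle1 : s <= 1 by lra.
have s2 : s ^+ 2 <= 128^-1 by have := ler_pM (ltW s0) (ltW s0) s16 s16; rewrite expr2; lra.
have [c cg hc] := pr_lower.
have [KB KB0 hB] := marg_lower th c0 L H mpr pr0 pri cg hc.
have Bn : marg pr th s z != 0.
  by apply/eqP => B0; have := hB s z s0 sle1 s2; rewrite B0 mul0r; lra.
have [i0 _] := conv_expand th c0 L H mpr pr0 pri z (@gbound_gs R n p) s0 sle1.
have [K gK] := @gbound_entry R n p.
have [i1 _] := conv_expand th c0 L H mpr pr0 pri z (gK k) s0 sle1.
have sd : s ^+ d != 0 by rewrite expf_neq0// gt_eqF.
have eq1 : (fun x => dens (s ^- 2) (th + s *: x) (th + s *: z) * pr (th + s *: x)) =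
  (fun x => s ^- d * (gs (x - z) * pr (th + s *: x))).
  by apply/funext => x; rewrite dens_scale// mulrA.
have eq2 : (fun x => (th + s *: x) k.1 k.2 * dens (s ^- 2) (th + s *: x) (th + s *: z) * pr (th + s *: x)) =
  (fun x => s ^- d * ((th k.1 k.2 + s * z k.1 k.2) * (gs (x - z) * pr (th + s *: x)) +
     s * ((x - z) k.1 k.2 * gs (x - z) * pr (th + s *: x)))).
  by apply/funext => x; rewrite dens_scale// !mxE; ring.
have j1 : intg (fun x => (th k.1 k.2 + s * z k.1 k.2) * (gs (x - z) * pr (th + s *: x)) +
     s * ((x - z) k.1 k.2 * gs (x - z) * pr (th + s *: x))).
  by apply: intgD; exact: intgZ.
rewrite /gbayes mxE.
rewrite (mxint_scale (th := th) s0); last by rewrite eq2; exact: intgZ.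
rewrite (mxint_scale (th := th) s0); last by rewrite eq1; exact: intgZ.
rewrite eq1 eq2 !lintZ// lintD; [|exact: intgZ|exact: intgZ].
rewrite !lintZ// /tpost -/(marg pr th s z) -/(score pr th s k z).
by field; rewrite Bn sd.
Qed.

Lemma risk_scale (s : R) (i j : 'I_p) : 0 < s -> s <= 16^-1 ->
  (forall a, intg (fun z => tpost pr th s (a, i) z * tpost pr th s (a, j) z * gs z)) ->
  risk (s ^- 2) (gbayes (s ^- 2) pr) th i j =
  s ^+ 2 * \sum_a lint (fun z => tpost pr th s (a, i) z * tpost pr th s (a, j) z * gs z).
Proof.
move=> s0 s16 it; rewrite /risk mxE.
have sd : s ^+ d != 0 by rewrite expf_neq0// gt_eqF.
have [is1 lsum] := intg_lint_sum it.
have E : (fun z => ((gbayes (s ^- 2) pr (th + s *: z) - th)^T *m (gbayes (s ^- 2) pr (th + s *: z) - th)) i j *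
     dens (s ^- 2) th (th + s *: z)) =
   (fun z => (s ^+ 2 / s ^+ d) * \sum_a tpost pr th s (a, i) z * tpost pr th s (a, j) z * gs z).
  apply/funext => z; have := dens_scale th 0 z s0; rewrite scaler0 addr0 sub0r gsN => ->.
  have ga a l : gbayes (s ^- 2) pr (th + s *: z) a l = th a l + s * tpost pr th s (a, l) z.
    exact: (gbayes_scale z (a, l) s0 s16).
  move: (gbayes _ _ _) ga => B ga.
  by rewrite mxE mulr_suml mulr_sumr; apply: eq_bigr => a _; rewrite !mxE !ga; field.
rewrite (mxint_scale (th := th) s0); last by rewrite E; exact: intgZ.
rewrite E lintZ// lsum; set S := \sum_a _; by field.
Qed.

(** The subtracted sum, [n delta_ij], is the same for every prior and cancels in the difference of
    two risks. *)
Lemma risk_limit (i j : 'I_p) (e : R) : 0 < e -> exists2 s1, 0 < s1 & forall s, 0 < s -> s <= s1 ->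
  `|s ^- 2 * (s ^- 2 * risk (s ^- 2) (gbayes (s ^- 2) pr) th i j - \sum_(a < n) ((a, i) == (a, j))%:R) -
    \sum_a ((H (a, i) (a, j) + H (a, j) (a, i)) / c0 - L (a, i) * L (a, j) / c0 ^+ 2)| <= e.
Proof.
move=> e0; have n0 : 0 < n%:R + 1 :> R by rewrite ltr_wpDl.
pose e' := e / (n%:R + 1); have e'0 : 0 < e' by rewrite divr_gt0.
(* Each row gets the error [e / (n + 1)]; its threshold is chosen as a function of [a] so that a
   minimum over the rows can be taken. *)
have P a : {s1 : R | 0 < s1 /\ forall s, 0 < s -> s <= s1 ->
  [/\ s <= 1, intg (fun z => tpost pr th s (a, i) z * tpost pr th s (a, j) z * gs z) &
  `|s ^- 2 * (lint (fun z => tpost pr th s (a, i) z * tpost pr th s (a, j) z * gs z) - ((a, i) == (a, j))%:R) -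
    ((H (a, i) (a, j) + H (a, j) (a, i)) / c0 - L (a, i) * L (a, j) / c0 ^+ 2)| <= e']}.
  apply: cid; have [s1 h1 h2] := posterior_limit mpr pr0 pri jpr c0_gt0 pr_lower (a, i) (a, j) e'0.
  by exists s1.
exists (Num.min 16^-1 (\big[Num.min/1]_a sval (P a))).
  rewrite lt_min invr_gt0 ltr0n/=; apply: lt_bigmin => // a _.
  by case: (svalP (P a)).
move=> s s0; rewrite le_min => /andP[s16 /bigmin_geP[_ sP]].
have h a := (svalP (P a)).2 s s0 (sP a isT).
rewrite risk_scale// => [|a]; last by have [] := h a.
have sn : s != 0 by rewrite gt_eqF.
rewrite mulrA mulVf ?expf_neq0// mul1r -sumrB mulr_sumr -sumrB.
apply: le_trans (ler_norm_sum _ _ _) _.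
apply: (@le_trans _ _ (\sum_(a < n) e')).
  by apply: ler_sum => a _; have [] := h a.
rewrite sumr_const card_ord -mulr_natr /e' -mulrA ler_piMr ?(ltW e0)// mulrC ler_pdivrMr//; lra.
Qed.

End risk_expansion.

(** SVS is the case [gamma = 0], so one expansion serves both estimators; a zero exponent gives [1]
    even at a zero column. *)
Lemma piSVS_MSVS2 (R : realType) n p : @piSVS R n p = piMSVS2 (fun=> 0).
Proof.
apply/funext => X; rewrite /piMSVS2 big1 ?mulr1// => i _.
by rewrite oppr0 powRr0.
Qed.

Lemma etaHC (R : realType) n p (gamma : 'I_p -> R) (th : 'M[R]_(n, p)) a i j :
  etaH gamma th (a, j) (a, i) = etaH gamma th (a, i) (a, j).
Proof.
have [->//|ij] := eqVneq i j.
by rewrite /etaH /= !xpair_eqE eqxx /= [j == i]eq_sym (negbTE ij) !mulr0 !mul0r.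
Qed.

(** For a prior of value [c], gradient [c l] and Hessian [c (k + l l^T)], the expression
    [(H + H^T) / c - L L^T / c^2] equals [k + k^T + l l^T]. The value [c] cancels, and so does, in
    the difference, the Hessian [k0] of the log-SVS prior, which is never made explicit. *)
Lemma limit_mx_jets (R : realType) n p (gamma : 'I_p -> R) (th : 'M[R]_(n, p))
    (l0 : 'I_n * 'I_p -> R) (k0 : 'I_n * 'I_p -> 'I_n * 'I_p -> R) (c c' : R) i j :
  (p.+1 < n)%N -> (0 < p)%N -> (forall i, 0 < colsq i th) -> 0 < c -> 0 < c' ->
  (forall i j, \sum_a l0 (a, i) * th a j = - (n - p - 1)%:R * (i == j)%:R) ->
  let T c (g : 'I_p -> R) := \sum_a
    ((c * (k0 (a, i) (a, j) + etaH g th (a, i) (a, j) + (l0 (a, i) + etaL g th (a, i)) * (l0 (a, j) + etaL g th (a, j))) +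
      c * (k0 (a, j) (a, i) + etaH g th (a, j) (a, i) + (l0 (a, j) + etaL g th (a, j)) * (l0 (a, i) + etaL g th (a, i)))) / c -
     c * (l0 (a, i) + etaL g th (a, i)) * (c * (l0 (a, j) + etaL g th (a, j))) / c ^+ 2) in
  T c gamma - T c' (fun=> 0) = limit_mx gamma th i j.
Proof.
move=> pn p0 cs cp c'p hl T; rewrite -(limit_mx_log_jets gamma i j pn p0 cs hl) /T -sumrB.
have cn : c != 0 by rewrite gt_eqF.
have c'n : c' != 0 by rewrite gt_eqF.
apply: eq_bigr => a _; rewrite (etaHC gamma) (etaHC (fun=> 0)).
have L0 k : etaL (fun=> 0) th k = 0 by rewrite /etaL mul0r oppr0 mul0r.
have H0 k l : etaH (fun=> 0) th k l = 0 by rewrite /etaH !(mul0r, oppr0, mulr0) addr0.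
by rewrite !L0 !H0; field; rewrite cn c'n.
Qed.

Theorem theorem6 (R : realType) (n p : nat) (gamma : 'I_p -> R) :
  (0 < p)%N -> (p.+1 < n)%N ->
  (forall i, 0 <= gamma i <= p%:R) ->
  (forall M : 'M[R]_(n, p), M^T *m M \in unitmx ->
     forall i j : 'I_p,
       (fun N : R => N ^+ 2 *
          (risk N (gbayes N (piMSVS2 gamma)) M - risk N (gbayes N (@piSVS R n p)) M) i j)
         @ +oo --> limit_mx gamma M i j)
  /\
  ((1 < p)%N ->
   (exists g : R, 0 < g < 2 - 2 / p%:R /\ forall i, gamma i = g) ->
   forall M : 'M[R]_(n, p), M^T *m M \in unitmx ->
     forall v : 'cV[R]_p, v != 0 -> (v^T *m limit_mx gamma M *m v) 0 0 < 0).
Proof.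
move=> p0 pn hgamma; split=> [M MU i j|p1 [g [hg gE]] M MU v v0]; last first.
  by apply: (limit_mx_neg p1 hg gE) => // k; exact: colsq_gt0.
have hzero (k : 'I_p) : 0 <= (0 : R) <= p%:R by rewrite lexx ler0n.
have [l0 [k0 [hl hjet]]] := prior_jets MU.
have lim g (hg : forall k, 0 <= g k <= p%:R) e (e0 : 0 < e) :=
  risk_limit (measurable_prior g) (prior_ge0 g) (prior_gauss_integrable pn p0 hg)
    (hjet g).2 (hjet g).1 (prior_ae_lower pn p0 hg) i j e0.
rewrite piSVS_MSVS2 -(limit_mx_jets gamma k0 i j pn p0 (fun k => colsq_gt0 k MU) (hjet gamma).1 (hjet (fun=> 0)).1 hl).
apply/cvgrPdist_le => e e0.
have e2 : 0 < e / 2 by rewrite divr_gt0.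
have [s1 s1p h1] := lim _ hgamma _ e2.
have [s2 s2p h2] := lim (fun=> 0) hzero _ e2.
near=> N.
have N0 : 0 < N by near: N; exact: nbhs_pinfty_gt.
pose s := (Num.sqrt N)^-1; have sN : 0 < Num.sqrt N by rewrite sqrtr_gt0.
have s0 : 0 < s by rewrite invr_gt0.
have NE : N = s ^- 2 by rewrite /s exprVn invrK sqr_sqrtr// ltW.
have small t : 0 < t -> t ^- 2 <= N -> s <= t.
  move=> t0 tN; rewrite /s -[leRHS]invrK lef_pV2 ?posrE ?invr_gt0//.
  by rewrite -(ler_pXn2r (_ : (0 < 2)%N)) ?nnegrE ?invr_ge0 ?sqrtr_ge0 ?(ltW t0)// exprVn sqr_sqrtr// ltW.
have ss1 : s <= s1 by apply: small => //; near: N; exact: nbhs_pinfty_ge.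
have ss2 : s <= s2 by apply: small => //; near: N; exact: nbhs_pinfty_ge.
have mB (A B : 'M[R]_p) : (A - B) i j = A i j - B i j by rewrite !mxE.
have := h1 s s0 ss1; have := h2 s s0 ss2; rewrite -NE mB.
set A2 := risk _ _ _ i j; set A1 := risk _ _ _ i j; set S := \sum_(a < n) _%:R.
set T2 := \sum_a _; set T1 := \sum_a _ => b2 b1.
(* The common leading term [S] disappears here, leaving two errors of size [e / 2]. *)
rewrite distrC (_ : N ^+ 2 * (A1 - A2) - (T1 - T2) = (N * (N * A1 - S) - T1) - (N * (N * A2 - S) - T2)); last first.
  by clear; ring.
by rewrite [leRHS]splitr; exact: normB_le.
Unshelve. all: by end_near.
Qed.
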